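(* Let $B$ be a dimer tree algebra of total weight $2N$ with checkerboard polygon $\mathcal{S}$, and for each 2-diagonal $\gamma$ of $\mathcal S$ let $f_\gamma\colon P_1(\gamma)\to P_0(\gamma)$ be the morphism for which $\gamma\mapsto\operatorname{coker}f_\gamma$ induces an equivalence $\mathrm{Diag}(\mathcal S)\to\underline{\mathrm{CMP}}\,B$ ($\operatorname{coker} f_\gamma$ being an indecomposable non-projective syzygy with minimal projective presentation $f_\gamma$). Then the checkerboard polygon is also a geometric model for the stable cosyzygy category $\underline{\mathrm{CMI}}\,B$: the mapping $\gamma\mapsto\ker(\nu f_\gamma)$ induces an equivalence $\mathrm{Diag}(\mathcal S)\to\underline{\mathrm{CMI}}\,B$, the Auslander--Reiten translations of $\mathrm{mod}\,B$ induce mutually inverse equivalences $\tau\colon\underline{\mathrm{CMP}}\,B\to\underline{\mathrm{CMI}}\,B$ and $\tau^{-1}\colon\underline{\mathrm{CMI}}\,B\to\underline{\mathrm{CMP}}\,B$, and these equivalences form a commutative triangle, i.e. $\tau\circ(\gamma\mapsto\operatorname{coker}f_\gamma)=(\gamma\mapsto\ker\nu f_\gamma)$.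
   Context: **Dimer tree algebras.** Let $K$ be an algebraically closed field. Paths are composed from left to right, modules are finitely generated right modules, and $P(i)$ is the indecomposable projective at vertex $i$. A chordless cycle in a quiver $Q$ is an oriented cyclic path $x_0\to x_1\to\dots\to x_t\to x_0$ with pairwise distinct $x_i$ such that the full subquiver on $x_0,\dots,x_t$ is equal to this cycle (cycles are taken up to rotation). Arrows lying in exactly one chordless cycle are boundary arrows; those lying in two or more are interior arrows. The dual graph $G$ of $Q$ has as vertices the chordless cycles and the boundary arrows; there is an edge between any two chordless cycles for each arrow they share, and an edge between a boundary arrow $\alpha$ and the chordless cycle containing $\alpha$. $Q$ is a finite connected quiver without loops and 2-cycles such that (Q1) every arrow lies in at least one chordless cycle; (Q2) $G$ is a tree; (Q3) the boundary arrows form a simple (non-oriented) cycle. Let $C_0$ be a chordless cycle containing exactly one interior arrow ($C_0=Q$ if $Q$ is a single chordless cycle), and let $d(C)$ be the length of the path from $C_0$ to $C$ in $G$. The potential is $W=\sum_C(-1)^{d(C)}C$, the sum over all chordless cycles, and $B=\mathrm{Jac}(Q,W)$ is the quotient of $KQ$ by the relations $\partial_\alpha W$, $\alpha\in Q_1$, where $\partial_\alpha(\alpha_1\cdots\alpha_t)=\sum_{p:\alpha_p=\alpha}\alpha_{p+1}\cdots\alpha_t\alpha_1\cdots\alpha_{p-1}$. $B$ is called a dimer tree algebra; it is finite-dimensional. **Weight.** For a boundary arrow $\alpha$, its cycle path $\mathfrak c(\alpha)=\alpha_1\cdots\alpha_\ell$ is the unique path with $\alpha_1=\alpha$ and $\alpha_\ell$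 boundary arrows, $\alpha_2,\dots,\alpha_{\ell-1}$ interior arrows, and each $\alpha_i\alpha_{i+1}$ a subpath of a chordless cycle $C_i$, with $C_i\neq C_j$ for $i\neq j$. The weight $\mathrm w(\alpha)$ is 1 if $\ell$ is odd and 2 if $\ell$ is even. The total weight is $\sum_\alpha \mathrm w(\alpha)$ over all boundary arrows, denoted $2N$. **Categories.** A syzygy is a submodule of a projective $B$-module; $\mathrm{CMP}\,B$ is the full subcategory of syzygies in $\mathrm{mod}\,B$ and $\underline{\mathrm{CMP}}\,B$ its stable category modulo projectives. A cosyzygy is a quotient of an injective $B$-module; $\underline{\mathrm{CMI}}\,B$ is the category of cosyzygies modulo injectives. $\tau,\tau^{-1}$ are the Auslander--Reiten translations of $\mathrm{mod}\,B$, and $\nu=D\mathrm{Hom}_B(-,B)$, with $D=\mathrm{Hom}_K(-,K)$, is the Nakayama functor. **The category of 2-diagonals.** Let $S$ be a regular polygon with $2N$ vertices and $R$ the clockwise rotation by $\pi/N$. A 2-diagonal is a diagonal such that the two polygons obtained by cutting along it both have an even number of vertices, at least 4. Let $\gamma$ be a 2-diagonal with endpoints $a,x$, let $b$ be the clockwise neighbor of $a$, $c$ that of $b$, $y$ that of $x$, $z$ that of $y$. The 2-pivots of $\gamma$ are $(a,z)$ (unless $a,z$ are neighbors) and $(c,x)$ (unless $c,x$ are neighbors). Let $\Gamma$ be the quiver with vertices the 2-diagonals and an arrow $\gamma\to\gamma'$ whenever $\gamma'$ is a 2-pivot of $\gamma$; with translation $R^{-2}$ it is a translation quiver, each arrow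 $\alpha\colon y\to x$ having a unique associated arrow $\sigma(\alpha)\colon R^{-2}x\to y$. $\mathrm{Diag}(S)$ is the (additive hull of the) mesh category: the path category over $K$ modulo the relations $\sum_{\alpha\colon y\to x}\sigma(\alpha)\alpha$ for all $x$. Label the vertices $1,\dots,2N$ clockwise and orient each 2-diagonal from its odd to its even endpoint. If $\gamma,\gamma'$ cross, $\gamma'$ crosses $\gamma$ from right to left if $\gamma'$ passes from the right side of $\gamma$ to its left side (with respect to the direction of $\gamma$); similarly for left to right. **Checkerboard polygon.** $\mathcal{S}$ is a $2N$-gon with 2-diagonals $\rho(i)$, $i\in Q_0$ (radical lines), constructed as follows. Step 1: draw a line segment $\rho(i)$ for each vertex $i$ such that $\rho(i)$ and $\rho(j)$ cross if and only if there is an arrow between $i$ and $j$. For each chordless cycle $i\to j\to k\to\dots\to s\to i$, the lines $\rho(i),\rho(j),\dots,\rho(s)$ bound an interior shaded polygonal region whose sides, read counterclockwise, lie on $\rho(i),\rho(j),\rho(k),\dots,\rho(s)$ in this order; cycles sharing an arrow $i\to j$ have shaded regions meeting at the crossing point of $\rho(i)$ and $\rho(j)$. For each boundary arrow $i\to j$ an endpoint of $\rho(i)$ and an endpoint of $\rho(j)$ are joined by a boundary segment, bounding together with $\rho(i),\rho(j)$ a shaded triangle whose sides, read counterclockwise, are the boundary segment, $\rho(i)$, $\rho(j)$. Step 2: label the endpoints of the lines odd/even so that the two endpoints of each $\rho(i)$ have opposite parity and the two ends of the boundary segment of each shaded triangle have opposite parity, and orient each $\rho(i)$ from odd to even. Step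 3: two consecutive shaded boundary triangles are separated by a white region with two ends $x,y$ on the boundary; if $x,y$ have the same parity, identify them; otherwise join them by a boundary segment. The result is a polygon with $2N$ vertices, and $\mathrm{Diag}(\mathcal S)$ is $\mathrm{Diag}(S)$ for the underlying $2N$-gon. **Projectives of a 2-diagonal.** $P_0(\gamma)=\bigoplus_i P(i)$ over all $i$ such that $\rho(i)$ crosses $\gamma$ from right to left; $P_1(\gamma)=\bigoplus_j P(j)$ over all $j$ such that $\rho(j)$ crosses $\gamma$ from left to right. *)

(* Defs.v *)
From HB Require Import structures.
From mathcomp Require Import all_boot all_order all_algebra all_field.
From mathcomp Require Import finmap.
From mathcomp.multinomials Require Import monalg.

Set Implicit Arguments.
Unset Strict Implicit.
Unset Printing Implicit Defensive.

Import GRing.Theory.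
Local Open Scope ring_scope.

(* The category denoted by [C] has hom spaces [hom x y / null]: [hom x y] is
   a space of representatives and [null] the ideal of representatives of 0.
   Composition is written from left to right. *)
Record kcat (K : fieldType) := KCat {
  ob :> Type;
  hom : ob -> ob -> lmodType K;
  idm : forall x, hom x x;
  cmp : forall x y z, hom x y -> hom y z -> hom x z;
  null : forall x y, hom x y -> Prop;
  cmp1m : forall x y (f : hom x y), cmp (idm x) f = f;
  cmpm1 : forall x y (f : hom x y), cmp f (idm y) = f;
  cmpA : forall x y z t (f : hom x y) (g : hom y z) (h : hom z t),
    cmp f (cmp g h) = cmp (cmp f g) h;
  cmp_linl : forall x y z (g : hom y z),
    linear (fun f : hom x y => cmp f g);
  cmp_linr : forall x y z (f : hom x y),
    linear (fun g : hom y z => cmp f g);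
  null0 : forall x y, null (0 : hom x y);
  null_lin : forall x y a (f g : hom x y),
    null f -> null g -> null (a *: f + g);
  null_cmpl : forall x y z (f : hom x y) (g : hom y z),
    null f -> null (cmp f g);
  null_cmpr : forall x y z (f : hom x y) (g : hom y z),
    null g -> null (cmp f g)
}.

Arguments idm {K} k x.

Definition heq (K : fieldType) (C : kcat K) (x y : C) (f g : hom x y) : Prop :=
  null (f - g).

Section KcatTheory.
Variable K : fieldType.

Lemma cmpBl (C : kcat K) (x y z : C) (f f' : hom x y) (g : hom y z) :
  cmp (f - f') g = cmp f g - cmp f' g.
Proof.
have E : cmp (-1 *: f' + f) g = -1 *: cmp f' g + cmp f g.
  exact: (cmp_linl g (-1) f' f).
by rewrite !scaleN1r ![- _ + _]addrC in E.
Qed.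

Lemma cmpBr (C : kcat K) (x y z : C) (f : hom x y) (g g' : hom y z) :
  cmp f (g - g') = cmp f g - cmp f g'.
Proof.
have E : cmp f (-1 *: g' + g) = -1 *: cmp f g' + cmp f g.
  exact: (cmp_linr f (-1) g' g).
by rewrite !scaleN1r ![- _ + _]addrC in E.
Qed.

Lemma cmp0m (C : kcat K) (x y z : C) (g : hom y z) :
  cmp (0 : hom x y) g = 0.
Proof. by rewrite -(subrr (0 : hom x y)) cmpBl subrr. Qed.

Lemma cmpm0 (C : kcat K) (x y z : C) (f : hom x y) :
  cmp f (0 : hom y z) = 0.
Proof. by rewrite -(subrr (0 : hom y z)) cmpBr subrr. Qed.

Lemma nullD (C : kcat K) (x y : C) (f g : hom x y) :
  null f -> null g -> null (f + g).
Proof. by move=> nf ng; rewrite -[f]scale1r; apply: null_lin. Qed.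

Lemma heq_refl (C : kcat K) (x y : C) (f : hom x y) : heq f f.
Proof. by rewrite /heq subrr; apply: null0. Qed.

Lemma heq_trans (C : kcat K) (x y : C) (g f h : hom x y) :
  heq f g -> heq g h -> heq f h.
Proof. by move=> /nullD H /H; rewrite addrA subrK. Qed.

(* A K-linear functor with prescribed action [F0] on objects. *)
Record functor (C D : kcat K) (F0 : C -> D) := Functor {
  fmap :> forall x y, hom x y -> hom (F0 x) (F0 y);
  fmap_lin : forall x y a (f g : hom x y),
    heq (fmap (a *: f + g)) (a *: fmap f + fmap g);
  fmap_null : forall x y (f : hom x y), null f -> null (fmap f);
  fmap_id : forall x, heq (fmap (idm C x)) (idm D (F0 x));
  fmap_cmp : forall x y z (f : hom x y) (g : hom y z),
    heq (fmap (cmp f g)) (cmp (fmap f) (fmap g))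
}.

Arguments fmap {C D F0} f0 {x y} _.

Lemma fmap_heq (C D : kcat K) (F0 : C -> D) (F : functor F0) (x y : C)
  (f g : hom x y) : heq f g -> heq (fmap F f) (fmap F g).
Proof.
move=> fg; have := fmap_lin F 1 (f - g) g; rewrite !scale1r subrK => H.
apply: heq_trans H _; rewrite /heq addrK; exact: fmap_null.
Qed.

Section IdFunctor.
Variable C : kcat K.

Fact idf_lin (x y : C) a (f g : hom x y) : heq (a *: f + g) (a *: f + g).
Proof. exact: heq_refl. Qed.
Fact idf_null (x y : C) (f : hom x y) : null f -> null f.
Proof. by []. Qed.
Fact idf_id (x : C) : heq (idm C x) (idm C x).
Proof. exact: heq_refl. Qed.
Fact idf_cmp (x y z : C) (f : hom x y) (g : hom y z) :
  heq (cmp f g) (cmp f g).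
Proof. exact: heq_refl. Qed.

Definition idfunctor : functor (fun x : C => x) :=
  @Functor C C (fun x => x) (fun _ _ f => f) idf_lin idf_null idf_id idf_cmp.
End IdFunctor.

Section CompFunctor.
Variables (C D E : kcat K) (F0 : C -> D) (G0 : D -> E).
Variables (F : functor F0) (G : functor G0).

Fact cmpf_lin (x y : C) a (f g : hom x y) :
  heq (fmap G (fmap F (a *: f + g)))
      (a *: fmap G (fmap F f) + fmap G (fmap F g)).
Proof. by apply: heq_trans (fmap_heq G (fmap_lin F a f g)) (fmap_lin G _ _ _). Qed.
Fact cmpf_null (x y : C) (f : hom x y) : null f -> null (fmap G (fmap F f)).
Proof. by move=> nf; do 2!apply: fmap_null. Qed.
Fact cmpf_id (x : C) : heq (fmap G (fmap F (idm C x))) (idm E (G0 (F0 x))).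
Proof. by apply: heq_trans (fmap_heq G (fmap_id F x)) (fmap_id G _). Qed.
Fact cmpf_cmp (x y z : C) (f : hom x y) (g : hom y z) :
  heq (fmap G (fmap F (cmp f g))) (cmp (fmap G (fmap F f)) (fmap G (fmap F g))).
Proof. by apply: heq_trans (fmap_heq G (fmap_cmp F f g)) (fmap_cmp G _ _). Qed.

Definition cmpfunctor : functor (fun x => G0 (F0 x)) :=
  @Functor C E (fun x => G0 (F0 x)) (fun _ _ f => fmap G (fmap F f))
    cmpf_lin cmpf_null cmpf_id cmpf_cmp.
End CompFunctor.

Definition nat_iso (C D : kcat K) (F0 G0 : C -> D)
    (F : functor F0) (G : functor G0) : Prop :=
  exists (u : forall x, hom (F0 x) (G0 x)) (v : forall x, hom (G0 x) (F0 x)),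
    (forall x, heq (cmp (u x) (v x)) (idm D (F0 x)) /\
               heq (cmp (v x) (u x)) (idm D (G0 x))) /\
    (forall x y (f : hom x y), heq (cmp (fmap F f) (u y)) (cmp (u x) (fmap G f))).

Definition mutually_inverse (C D : kcat K) (F0 : C -> D) (G0 : D -> C)
    (F : functor F0) (G : functor G0) : Prop :=
  nat_iso (cmpfunctor F G) (idfunctor C) /\
  nat_iso (cmpfunctor G F) (idfunctor D).

Definition equivalence (C D : kcat K) (F0 : C -> D) (F : functor F0) : Prop :=
  exists (G0 : D -> C) (G : functor G0), mutually_inverse F G.

Section Quotient.
Variable C : kcat K.

Record ideal (I : forall x y : C, hom x y -> Prop) : Prop := Ideal {
  ideal_null : forall x y f, null f -> I x y f;
  ideal_lin : forall x y a f g, I x y f -> I x y g -> I x y (a *: f + g);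
  ideal_cmpl : forall x y z f (g : hom y z), I x y f -> I x z (cmp f g);
  ideal_cmpr : forall x y z (f : hom x y) g, I y z g -> I x z (cmp f g)
}.

Fact ideal0 I : ideal I -> forall x y, I x y 0.
Proof. by move=> hI x y; apply: (ideal_null hI); apply: null0. Qed.

Definition quotcat I (hI : ideal I) : kcat K :=
  @KCat K C (@hom K C) (@idm K C) (@cmp K C) I
    (@cmp1m K C) (@cmpm1 K C) (@cmpA K C) (@cmp_linl K C) (@cmp_linr K C)
    (ideal0 hI) (ideal_lin hI) (ideal_cmpl hI) (ideal_cmpr hI).

Inductive ideal_gen (R : forall x y : C, hom x y -> Prop) :
    forall x y : C, hom x y -> Prop :=
| IdealGen x y f : R x y f -> @ideal_gen R x y f
| IdealNull x y f : null f -> @ideal_gen R x y f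
| IdealLin x y a f g :
    @ideal_gen R x y f -> @ideal_gen R x y g -> @ideal_gen R x y (a *: f + g)
| IdealCmpl x y z f (g : hom y z) :
    @ideal_gen R x y f -> @ideal_gen R x z (cmp f g)
| IdealCmpr x y z (f : hom x y) g :
    @ideal_gen R y z g -> @ideal_gen R x z (cmp f g).

Lemma ideal_gen_ideal R : ideal (ideal_gen R).
Proof. by split=> *; eauto using ideal_gen. Qed.

End Quotient.

Section FullSub.
Variables (C : kcat K) (P : C -> Prop).

Definition fullcat : kcat K :=
  @KCat K {x : C | P x} (fun x y => hom (sval x) (sval y))
    (fun x => idm C (sval x)) (fun x y z f g => cmp f g)
    (fun x y f => null f)
    (fun _ _ f => cmp1m f) (fun _ _ f => cmpm1 f) (fun _ _ _ _ f g h => cmpA f g h)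
    (fun _ _ _ g => cmp_linl g) (fun _ _ _ f => cmp_linr f)
    (fun _ _ => null0 _ _) (fun _ _ a f g => @null_lin K C _ _ a f g)
    (fun _ _ _ f g => @null_cmpl K C _ _ _ f g)
    (fun _ _ _ f g => @null_cmpr K C _ _ _ f g).
End FullSub.

Definition restrict (C D : kcat K) (P : C -> Prop) (P' : D -> Prop)
    (F0 : C -> D) (F : functor F0) (h : forall x, P x -> P' (F0 x)) :
  functor (C := fullcat P) (D := fullcat P')
    (fun x => exist P' (F0 (sval x)) (h (sval x) (svalP x))) :=
  @Functor (fullcat P) (fullcat P')
    (fun x => exist P' (F0 (sval x)) (h (sval x) (svalP x)))
    (fun _ _ f => fmap F f)
    (fun _ _ a f g => fmap_lin F a f g) (fun _ _ f => @fmap_null C D F0 F _ _ f)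
    (fun x => fmap_id F (sval x)) (fun _ _ _ f g => fmap_cmp F f g).

End KcatTheory.

Arguments fmap {K C D F0} f0 {x y} _.
Arguments idfunctor {K} C.

Section DProd.
Variables (K : fieldType) (I : finType) (V : I -> lmodType K).

Definition dprod : Type := {dffun forall i : I, V i}.

HB.instance Definition _ := Choice.copy dprod {dffun forall i : I, V i}.

Definition mkdprod (f : forall i, V i) : dprod := finfun f.
Definition dcoef (f : dprod) (i : I) : V i := f i.

Lemma dcoefE f i : dcoef (mkdprod f) i = f i.
Proof. exact: ffunE. Qed.

Lemma dprodP (f g : dprod) : (forall i, dcoef f i = dcoef g i) -> f = g.
Proof. by move=> fg; apply/ffunP. Qed.

Definition dadd f g := mkdprod (fun i => dcoef f i + dcoef g i).
Definition dopp f := mkdprod (fun i => - dcoef f i).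
Definition dzero := mkdprod (fun=> 0).
Definition dscale (a : K) f := mkdprod (fun i => a *: dcoef f i).

Fact daddA : associative dadd.
Proof. by move=> f g h; apply: dprodP => i; rewrite !dcoefE addrA. Qed.
Fact daddC : commutative dadd.
Proof. by move=> f g; apply: dprodP => i; rewrite !dcoefE addrC. Qed.
Fact dadd0 : left_id dzero dadd.
Proof. by move=> f; apply: dprodP => i; rewrite !dcoefE add0r. Qed.
Fact daddN : left_inverse dzero dopp dadd.
Proof. by move=> f; apply: dprodP => i; rewrite !dcoefE addNr. Qed.

HB.instance Definition _ := GRing.isZmodule.Build dprod daddA daddC dadd0 daddN.

Fact dscaleA a b f : dscale a (dscale b f) = dscale (a * b) f.
Proof. by apply: dprodP => i; rewrite !dcoefE scalerA. Qed.
Fact dscale1 : left_id 1 dscale.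
Proof. by move=> f; apply: dprodP => i; rewrite !dcoefE scale1r. Qed.
Fact dscaleDr : right_distributive dscale +%R.
Proof. by move=> a f g; apply: dprodP => i; rewrite !dcoefE scalerDr. Qed.
Fact dscaleDl f : {morph dscale^~ f : a b / a + b}.
Proof. by move=> a b; apply: dprodP => i; rewrite !dcoefE scalerDl. Qed.

HB.instance Definition _ :=
  GRing.Zmodule_isLmodule.Build K dprod dscaleA dscale1 dscaleDr dscaleDl.

Lemma dcoef_lin a f g i :
  dcoef (a *: f + g) i = a *: dcoef f i + dcoef g i.
Proof. by rewrite [LHS]dcoefE dcoefE. Qed.

Lemma dcoef0 i : dcoef 0 i = 0.
Proof. exact: dcoefE. Qed.

End DProd.

(* Formal finite direct sums of objects. *)
Record hull_ob (T : Type) := Family { fsize : nat; fterm :> 'I_fsize -> T }.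

Section AddHull.
Variables (K : fieldType) (C : kcat K).

Lemma cmp_suml (x y z : C) (I : finType) (F : I -> hom x y) (g : hom y z) :
  cmp (\sum_i F i) g = \sum_i cmp (F i) g.
Proof.
have M : {morph (fun f : hom x y => cmp f g) : f f' / f + f'}.
  by move=> f f'; have := cmp_linl g 1 f f'; rewrite !scale1r.
exact: (big_morph _ M (cmp0m _ g)).
Qed.

Lemma cmp_sumr (x y z : C) (I : finType) (f : hom x y) (F : I -> hom y z) :
  cmp f (\sum_i F i) = \sum_i cmp f (F i).
Proof.
have M : {morph (fun g : hom y z => cmp f g) : g g' / g + g'}.
  by move=> g g'; have := cmp_linr f 1 g g'; rewrite !scale1r.
exact: (big_morph _ M (cmpm0 _ f)).
Qed.

Lemma null_sum (x y : C) (I : finType) (F : I -> hom x y) :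
  (forall i, null (F i)) -> null (\sum_i F i).
Proof. by move=> nF; apply: big_ind => //; [apply: null0 | apply: nullD]. Qed.

Definition hull_entry (X Y : hull_ob C) (ij : 'I_(fsize X) * 'I_(fsize Y)) : lmodType K :=
  hom (X ij.1) (Y ij.2).

Definition hull_hom (X Y : hull_ob C) : lmodType K := dprod (@hull_entry X Y).

Definition hull_coef X Y (f : hull_hom X Y) i j : hom (X i) (Y j) :=
  dcoef f (i, j).

Definition mkhull X Y (f : forall (i : 'I_(fsize X)) (j : 'I_(fsize Y)),
    hom (X i) (Y j)) : hull_hom X Y :=
  mkdprod (fun ij => f ij.1 ij.2).

Lemma hull_coefE X Y f i j : hull_coef (@mkhull X Y f) i j = f i j.
Proof. exact: (@dcoefE _ _ (@hull_entry X Y) _ (i, j)). Qed.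

Lemma hull_coef_lin X Y a (f g : hull_hom X Y) i j :
  hull_coef (a *: f + g) i j = a *: hull_coef f i j + hull_coef g i j.
Proof. exact: (@dcoef_lin _ _ (@hull_entry X Y) a f g (i, j)). Qed.

Lemma hullP X Y (f g : hull_hom X Y) :
  (forall i j, hull_coef f i j = hull_coef g i j) -> f = g.
Proof. by move=> fg; apply: dprodP => -[i j]; apply: fg. Qed.

Definition hull_id_coef (X : hull_ob C) (i j : 'I_(fsize X)) :
    hom (X i) (X j) :=
  match i =P j with
  | ReflectT e => ecast k (hom (X i) (X k)) e (idm C _)
  | ReflectF _ => 0
  end.

Definition hull_id (X : hull_ob C) : hull_hom X X :=
  mkhull (@hull_id_coef X).

Definition hull_cmp (X Y Z : hull_ob C) (f : hull_hom X Y) (g : hull_hom Y Z) :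
    hull_hom X Z :=
  mkhull (fun i k => \sum_j cmp (hull_coef f i j) (hull_coef g j k)).

Definition hull_null (X Y : hull_ob C) (f : hull_hom X Y) : Prop :=
  forall i j, null (hull_coef f i j).

Lemma hull_id_coefii (X : hull_ob C) (i : 'I_(fsize X)) :
  hull_id_coef i i = idm C (X i).
Proof.
by rewrite /hull_id_coef; case: eqP => // e; rewrite (eq_axiomK e).
Qed.

Lemma hull_id_coefij (X : hull_ob C) (i j : 'I_(fsize X)) :
  i != j -> hull_id_coef i j = 0.
Proof. by rewrite /hull_id_coef; case: eqP. Qed.

Fact hull_cmp1m X Y (f : hull_hom X Y) : hull_cmp (hull_id X) f = f.
Proof.
apply: hullP => i j; rewrite hull_coefE (bigD1 i) //= hull_coefE /= hull_id_coefii.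
rewrite cmp1m big1 ?addr0 // => k ki.
by rewrite hull_coefE /= hull_id_coefij ?cmp0m // eq_sym.
Qed.

Fact hull_cmpm1 X Y (f : hull_hom X Y) : hull_cmp f (hull_id Y) = f.
Proof.
apply: hullP => i j; rewrite hull_coefE (bigD1 j) //= hull_coefE /= hull_id_coefii.
rewrite cmpm1 big1 ?addr0 // => k kj.
by rewrite hull_coefE /= hull_id_coefij ?cmpm0.
Qed.

Fact hull_cmpA X Y Z T (f : hull_hom X Y) (g : hull_hom Y Z) (h : hull_hom Z T) :
  hull_cmp f (hull_cmp g h) = hull_cmp (hull_cmp f g) h.
Proof.
apply: hullP => i l; rewrite !hull_coefE /=.
under eq_bigr => j _ do rewrite hull_coefE cmp_sumr /=.
under [RHS]eq_bigr => k _ do rewrite hull_coefE cmp_suml /=.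
rewrite exchange_big; apply: eq_bigr => k _; apply: eq_bigr => j _.
exact: cmpA.
Qed.

Fact hull_cmp_linl X Y Z (g : hull_hom Y Z) :
  linear (fun f : hull_hom X Y => hull_cmp f g).
Proof.
move=> a f f'; apply: hullP => i k; rewrite hull_coef_lin !hull_coefE scaler_sumr.
rewrite -big_split; apply: eq_bigr => j _; rewrite hull_coef_lin.
exact: (cmp_linl _ a).
Qed.

Fact hull_cmp_linr X Y Z (f : hull_hom X Y) :
  linear (fun g : hull_hom Y Z => hull_cmp f g).
Proof.
move=> a g g'; apply: hullP => i k; rewrite hull_coef_lin !hull_coefE scaler_sumr.
rewrite -big_split; apply: eq_bigr => j _; rewrite hull_coef_lin.
exact: (cmp_linr _ a).
Qed.

Fact hull_null0 X Y : hull_null (0 : hull_hom X Y).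
Proof. by move=> i j; rewrite [hull_coef _ _ _](@dcoef0 _ _ (@hull_entry X Y) (i, j)); apply: null0. Qed.

Fact hull_null_lin X Y a (f g : hull_hom X Y) :
  hull_null f -> hull_null g -> hull_null (a *: f + g).
Proof. by move=> nf ng i j; rewrite hull_coef_lin; apply: null_lin. Qed.

Fact hull_null_cmpl X Y Z (f : hull_hom X Y) (g : hull_hom Y Z) :
  hull_null f -> hull_null (hull_cmp f g).
Proof. by move=> nf i j; rewrite hull_coefE; apply: null_sum => k; apply: null_cmpl. Qed.

Fact hull_null_cmpr X Y Z (f : hull_hom X Y) (g : hull_hom Y Z) :
  hull_null g -> hull_null (hull_cmp f g).
Proof. by move=> ng i j; rewrite hull_coefE; apply: null_sum => k; apply: null_cmpr. Qed.

Definition addhull : kcat K :=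
  @KCat K (hull_ob C) hull_hom hull_id hull_cmp hull_null
    hull_cmp1m hull_cmpm1 hull_cmpA hull_cmp_linl hull_cmp_linr
    hull_null0 hull_null_lin hull_null_cmpl hull_null_cmpr.

End AddHull.

Record quiver := Quiver {
  vert : finType;
  arr : finType;
  src : arr -> vert;
  tgt : arr -> vert
}.

Fixpoint qpathb (Q : quiver) (i : vert Q) (s : seq (arr Q)) (j : vert Q) : bool :=
  if s is a :: s' then (src a == i) && qpathb (tgt a) s' j else i == j.

(* Paths from i to j, composed from left to right; [::] is the trivial path. *)
Definition qpath (Q : quiver) (i j : vert Q) : choiceType :=
  {s : seq (arr Q) | qpathb i s j}.

Lemma malg_basisE (K : fieldType) (T : choiceType) (f : {malg K[T]}) :
  f = \sum_(p <- msupp f) f@_p *: (mkmalgU p 1 : {malg K[T]}).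
Proof.
rewrite {1}[f]monalgE; apply: eq_bigr => p _; apply/malgP => q.
by rewrite mcoeffZ !mcoeffU mulrnAr mulr1.
Qed.

Section PathCat.
Variables (K : fieldType) (Q : quiver).
Implicit Types i j k l : vert Q.

Lemma qpathb_cat i j k (s t : seq (arr Q)) :
  qpathb i s j -> qpathb j t k -> qpathb i (s ++ t) k.
Proof.
elim: s i => [|a s IHs] i /=; first by move/eqP->.
by case/andP=> -> /IHs IH /IH ->.
Qed.

Definition qcat i j k (p : qpath i j) (q : qpath j k) : qpath i k :=
  exist _ (sval p ++ sval q) (qpathb_cat (svalP p) (svalP q)).

Definition qnil i : qpath i i := exist _ [::] (eqxx i).

Definition qhom i j : lmodType K := {malg K[qpath i j]}.

Definition qlin i j (p : qpath i j) : qhom i j := mkmalgU p 1.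

Section Extension.
Variables (i j : vert Q) (V : lmodType K).

Definition qext (h : qpath i j -> V) (f : qhom i j) : V :=
  \sum_(p <- msupp f) f@_p *: h p.

Lemma qextEw h (f : qhom i j) (d : {fset qpath i j}) :
  (msupp f `<=` d)%fset -> qext h f = \sum_(p <- d) f@_p *: h p.
Proof.
move=> le_fd; rewrite /qext; apply: big_fset_incl => // p _.
by move/mcoeff_outdom=> ->; rewrite scale0r.
Qed.

Lemma qext_is_linear h : linear (qext h).
Proof.
move=> a f g; pose d := (msupp (a *: f + g) `|` (msupp f `|` msupp g))%fset.
have dafg : (msupp (a *: f + g) `<=` d)%fset by apply: fsubsetUl.
have df : (msupp f `<=` d)%fset.
  by apply: fsubset_trans (fsubsetUl _ (msupp g)) (fsubsetUr _ _).
have dg : (msupp g `<=` d)%fset.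
  by apply: fsubset_trans (fsubsetUr (msupp f) _) (fsubsetUr _ _).
rewrite (qextEw h dafg) (qextEw h df) (qextEw h dg).
rewrite scaler_sumr -big_split; apply: eq_bigr => p _ /=.
by rewrite mcoeffD mcoeffZ scalerDl scalerA.
Qed.

HB.instance Definition _ h :=
  GRing.isLinear.Build K (qhom i j) V _ (qext h) (qext_is_linear h).

Lemma qextU h p : qext h (qlin p) = h p.
Proof.
rewrite (@qextEw _ _ [fset p]%fset) ?msuppU_le //.
by rewrite big_seq_fset1 mcoeffUU scale1r.
Qed.

Lemma eq_qext (h h' : qpath i j -> V) f : h =1 h' -> qext h f = qext h' f.
Proof. by move=> hh'; apply: eq_bigr => p _; rewrite hh'. Qed.

Lemma qext_lin_fun (h h' : qpath i j -> V) a f :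
  qext (fun p => a *: h p + h' p) f = a *: qext h f + qext h' f.
Proof.
rewrite /qext scaler_sumr -big_split; apply: eq_bigr => p _ /=.
by rewrite scalerDr !scalerA mulrC.
Qed.

End Extension.

Lemma qextE i j (f : qhom i j) : qext (@qlin i j) f = f.
Proof. by rewrite [RHS]malg_basisE. Qed.

Lemma qext_comp i j (V W : lmodType K) (u : {linear V -> W})
  (h : qpath i j -> V) f : u (qext h f) = qext (u \o h) f.
Proof. by rewrite /qext raddf_sum; apply: eq_bigr => p _; apply: linearZ_LR. Qed.

Definition qcmp i j k (f : qhom i j) (g : qhom j k) : qhom i k :=
  qext (fun p => qext (fun q => qlin (qcat p q)) g) f.

Fact qcmp_linl i j k (g : qhom j k) : linear (fun f : qhom i j => qcmp f g).
Proof. exact: qext_is_linear. Qed.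

Fact qcmp_linr i j k (f : qhom i j) : linear (fun g : qhom j k => qcmp f g).
Proof.
move=> a g g'; rewrite /qcmp -qext_lin_fun; apply: eq_qext => p.
exact: qext_is_linear.
Qed.

Fact qcmp1m i j (f : qhom i j) : qcmp (qlin (qnil i)) f = f.
Proof.
rewrite /qcmp qextU -[RHS]qextE; apply: eq_qext => p; congr qlin.
exact: val_inj.
Qed.

Fact qcmpm1 i j (f : qhom i j) : qcmp f (qlin (qnil j)) = f.
Proof.
rewrite /qcmp -[RHS]qextE; apply: eq_qext => p; rewrite qextU; congr qlin.
by apply: val_inj; rewrite /= cats0.
Qed.

Fact qcmpA i j k l (f : qhom i j) (g : qhom j k) (h : qhom k l) :
  qcmp f (qcmp g h) = qcmp (qcmp f g) h.
Proof.
pose R := GRing.isLinear.Build K (qhom i k) (qhom i l) _ (fun f => qcmp f h)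
  (@qcmp_linl i k l h).
pose u : {linear qhom i k -> qhom i l} := HB.pack (fun f => qcmp f h) R.
rewrite {1}/qcmp -[RHS]/(u (qcmp f g)) [X in u X]/qcmp qext_comp.
apply: eq_qext => p /=; rewrite -[RHS]/(u _) qext_comp [LHS]qext_comp.
apply: eq_qext => q /=; rewrite /qcmp qextU qext_comp.
apply: eq_qext => r /=; rewrite qextU; congr qlin.
by apply: val_inj; rewrite /= catA.
Qed.

Fact qnull_lin i j a (f g : qhom i j) : f = 0 -> g = 0 -> a *: f + g = 0.
Proof. by move=> -> ->; rewrite scaler0 addr0. Qed.

Fact qnull_cmpl i j k (f : qhom i j) (g : qhom j k) : f = 0 -> qcmp f g = 0.
Proof. by move=> ->; apply: (linear0 (qext _)). Qed.

Fact qnull_cmpr i j k (f : qhom i j) (g : qhom j k) : g = 0 -> qcmp f g = 0.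
Proof.
move=> ->; rewrite /qcmp [qext _ f]/qext big1 // => p _.
by rewrite (linear0 (qext _)) scaler0.
Qed.

(* The path category over K; the path algebra KQ is the direct sum of its hom
   spaces. *)
Definition pathcat : kcat K :=
  @KCat K (vert Q) qhom (fun i => qlin (qnil i)) qcmp (fun _ _ f => f = 0)
    qcmp1m qcmpm1 qcmpA qcmp_linl qcmp_linr
    (fun _ _ => erefl) qnull_lin qnull_cmpl qnull_cmpr.

(* The arrow sequence [s] as a morphism from [i] to [j], and 0 if [s] is not
   a path from [i] to [j]. *)
Definition pathelt i j (s : seq (arr Q)) : qhom i j :=
  if insub s is Some p then qlin p else 0.

End PathCat.

Record rmod (K : fieldType) (B : falgType K) := RMod {
  rcar :> vectType K;
  ract : rcar -> B -> rcar;
  ract_linl : forall b, linear (fun m => ract m b);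
  ract_linr : forall m, linear (ract m);
  ract1 : forall m, ract m 1 = m;
  ractM : forall m a b, ract m (a * b) = ract (ract m a) b
}.

Lemma lin_sub (K : fieldType) (V W : lmodType K) (f : V -> W) (hf : linear f) u v :
  f (u - v) = f u - f v.
Proof.
have E : f (-1 *: v + u) = -1 *: f v + f u by apply: hf.
by rewrite !scaleN1r ![- _ + _]addrC in E.
Qed.

Section LinfunE.
Variables (K : fieldType) (V W : vectType K).

(* [linfun] of a function known to be linear only by a proof. *)
Definition mklin (f : V -> W) (hf : linear f) : 'Hom(V, W) :=
  linfun (HB.pack_for {linear V -> W} f (GRing.isLinear.Build K V W _ f hf)).

Lemma mklinE f (hf : linear f) v : mklin hf v = f v.
Proof. exact: lfunE. Qed.
End LinfunE.

(* D = Hom_K(-, K) *)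
Section Dual.
Variables (K : fieldType) (V : vectType K).

Definition Kdual : vectType K := 'Hom(V, K^o).
Definition dapp (phi : Kdual) (v : V) : K := (phi : 'Hom(V, K^o)) v.

Lemma dapp_lin phi : linear (dapp phi : V -> K^o).
Proof. by move=> a u v; apply: linearP. Qed.

Lemma dapp_linl a (phi psi : Kdual) v :
  dapp (a *: phi + psi) v = a * dapp phi v + dapp psi v.
Proof.
have lfun_linE (U W : vectType K) (f g : 'Hom(U, W)) u :
  (a *: f + g) u = a *: f u + g u by rewrite add_lfunE scale_lfunE.
exact: (lfun_linE V K^o phi psi v).
Qed.

Lemma dapp_linr (phi : Kdual) a u v :
  dapp phi (a *: u + v) = a * dapp phi u + dapp phi v.
Proof. exact: dapp_lin. Qed.

Lemma dualP (phi psi : Kdual) : (forall v, dapp phi v = dapp psi v) -> phi = psi.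
Proof. by move=> e; apply/lfunP. Qed.

Definition mkdual (f : V -> K^o) (hf : linear f) : Kdual := mklin hf.

Lemma mkdualE f (hf : linear f) v : dapp (mkdual hf) v = f v.
Proof. exact: (@mklinE K V K^o f hf v). Qed.
End Dual.

Section Modules.
Variables (K : fieldType) (B : falgType K).
Implicit Types M N P X Y Z : rmod B.

Definition actl M (b : B) : 'End(M) := mklin (@ract_linl K B M b).

Lemma actlE M b (m : M) : actl M b m = ract m b.
Proof. exact: mklinE. Qed.

Lemma actl_lin M : linear (actl M).
Proof.
move=> a b c; apply/lfunP => m; rewrite add_lfunE scale_lfunE !actlE.
exact: ract_linr.
Qed.

Fact hom_defect_lin M N (b : B) :
  linear (fun f : 'Hom(M, N) => ((actl N b \o f)%VF - (f \o actl M b)%VF)).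
Proof.
move=> a f g; apply/lfunP => m.
rewrite !(add_lfunE, opp_lfunE, scale_lfunE, comp_lfunE) linearP scalerBr.
by rewrite -!addrA; congr (_ + _); rewrite opprD addrCA.
Qed.

Definition homv_defect M N (i : 'I_(\dim {:B})) :=
  mklin (@hom_defect_lin M N (vbasis {:B})`_i).

(* The space Hom_B(M, N), cut out by a basis of B; see [homvP]. *)
Definition homv M N : {vspace 'Hom(M, N)} :=
  (\bigcap_(i < \dim {:B}) lker (homv_defect M N i))%VS.

Lemma homvP M N (f : 'Hom(M, N)) :
  reflect (forall m b, f (ract m b) = ract (f m) b) (f \in homv M N).
Proof.
have memE : (f \in homv M N) =
  [forall i : 'I_(\dim {:B}), (actl N (vbasis {:B})`_i \o f
                               == f \o actl M (vbasis {:B})`_i)%VF].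
  have kerE i : (f \in lker (homv_defect M N i)) =
      (actl N (vbasis {:B})`_i \o f == f \o actl M (vbasis {:B})`_i)%VF.
    by rewrite memv_ker /homv_defect mklinE /= subr_eq0.
  rewrite memvE; apply/subv_bigcapP/forallP => [H i|H i _].
    by rewrite -kerE memvE H.
  by rewrite -memvE kerE H.
rewrite memE; apply: (iffP forallP) => [H m b | H i]; last first.
  by apply/eqP/lfunP => m; rewrite !comp_lfunE !actlE H.
rewrite -!actlE [b](coord_vbasis (memvf b)).
have actl_sum N' (n : N') (c : 'I_(\dim {:B}) -> K) :
    actl N' (\sum_i c i *: (vbasis {:B})`_i) n
    = \sum_i c i *: actl N' (vbasis {:B})`_i n.
  have [u ->] : exists u : {linear B -> 'End(N')}, actl N' = u.
    pose u : {linear B -> 'End(N')} := HB.pack (actl N')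
      (GRing.isLinear.Build K B 'End(N') _ (actl N') (@actl_lin N')).
    by exists u.
  have uZ a x : u (a *: x) = a *: u x by apply: linearZ_LR.
  rewrite raddf_sum sum_lfunE; apply: eq_bigr => i _.
  exact: etrans (congr1 (fun h : 'End(N') => h n) (uZ _ _)) (scale_lfunE _ _ _).
rewrite !actl_sum linear_sum; apply: eq_bigr => i _; rewrite linearZ /=.
by have /eqP/lfunP/(_ m) := H i; rewrite !comp_lfunE => ->.
Qed.

Definition mhom M N := subvs_of (homv M N).

Definition mkhom M N (f : 'Hom(M, N))
    (hf : forall m b, f (ract m b) = ract (f m) b) : mhom M N :=
  Subvs (introT (homvP f) hf).

Lemma mhom_ract M N (f : mhom M N) m b :
  vsval f (ract m b) = ract (vsval f m) b.
Proof. by have /homvP := subvsP f; apply. Qed.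

Lemma mhomP M N (f g : mhom M N) : (forall m, vsval f m = vsval g m) -> f = g.
Proof. by move=> fg; apply/val_inj/lfunP. Qed.

Fact mid_subproof M m b : \1%VF (ract m b) = ract (\1%VF m) b :> M.
Proof. by rewrite !id_lfunE. Qed.
Definition mid M : mhom M M := mkhom (@mid_subproof M).

Fact mcmp_subproof M N P (f : mhom M N) (g : mhom N P) m b :
  (vsval g \o vsval f)%VF (ract m b) = ract ((vsval g \o vsval f)%VF m) b.
Proof. by rewrite !comp_lfunE !mhom_ract. Qed.
Definition mcmp M N P (f : mhom M N) (g : mhom N P) : mhom M P :=
  mkhom (mcmp_subproof f g).

Lemma midE M m : vsval (mid M) m = m.
Proof. exact: id_lfunE. Qed.
Lemma mcmpE M N P (f : mhom M N) (g : mhom N P) m :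
  vsval (mcmp f g) m = vsval g (vsval f m).
Proof. exact: comp_lfunE. Qed.
Lemma mlinE M N a (f g : mhom M N) m :
  vsval (a *: f + g) m = a *: vsval f m + vsval g m.
Proof. by rewrite linearP add_lfunE scale_lfunE. Qed.
Lemma mzeroE M N m : vsval (0 : mhom M N) m = 0.
Proof. by rewrite linear0 zero_lfunE. Qed.

Lemma mscaleE M N a (f : mhom M N) m : vsval (a *: f) m = a *: vsval f m.
Proof. by have := mlinE a f 0 m; rewrite mzeroE !addr0. Qed.

Fact mcmp1m M N (f : mhom M N) : mcmp (mid M) f = f.
Proof. by apply: mhomP => m; rewrite mcmpE midE. Qed.
Fact mcmpm1 M N (f : mhom M N) : mcmp f (mid N) = f.
Proof. by apply: mhomP => m; rewrite mcmpE midE. Qed.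
Fact mcmpA M N P X (f : mhom M N) (g : mhom N P) (h : mhom P X) :
  mcmp f (mcmp g h) = mcmp (mcmp f g) h.
Proof. by apply: mhomP => m; rewrite !mcmpE. Qed.
Fact mcmp_linl M N P (g : mhom N P) : linear (fun f : mhom M N => mcmp f g).
Proof. by move=> a f f'; apply: mhomP => m; rewrite mlinE !mcmpE mlinE linearP. Qed.
Fact mcmp_linr M N P (f : mhom M N) : linear (fun g : mhom N P => mcmp f g).
Proof. by move=> a g g'; apply: mhomP => m; rewrite mlinE !mcmpE mlinE. Qed.
Fact mnull_lin M N a (f g : mhom M N) : f = 0 -> g = 0 -> a *: f + g = 0.
Proof. by move=> -> ->; rewrite scaler0 addr0. Qed.
Fact mnull_cmpl M N P (f : mhom M N) (g : mhom N P) : f = 0 -> mcmp f g = 0.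
Proof. by move=> ->; apply: mhomP => m; rewrite mcmpE !mzeroE linear0. Qed.
Fact mnull_cmpr M N P (f : mhom M N) (g : mhom N P) : g = 0 -> mcmp f g = 0.
Proof. by move=> ->; apply: mhomP => m; rewrite mcmpE !mzeroE. Qed.

Definition modcat : kcat K :=
  @KCat K (rmod B) (fun M N => mhom M N) mid mcmp (fun _ _ f => f = 0)
    mcmp1m mcmpm1 mcmpA mcmp_linl mcmp_linr
    (fun _ _ => erefl) mnull_lin mnull_cmpl mnull_cmpr.

Definition isom M N : Prop :=
  exists (f : mhom M N) (g : mhom N M), mcmp f g = mid M /\ mcmp g f = mid N.

Definition epi_mod M N (f : mhom M N) : Prop := limg (vsval f) = fullv.
Definition mono_mod M N (f : mhom M N) : Prop := lker (vsval f) = 0%VS.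

Definition stable M (U : {vspace M}) : Prop :=
  forall m b, m \in U -> ract m b \in U.

Section SubQuo.
Variables (M : rmod B) (U : {vspace M}) (hU : stable U).

Definition sub_act (u : subvs_of U) (b : B) : subvs_of U :=
  Subvs (hU b (subvsP u)).
Fact sub_linl b : linear (fun u => sub_act u b).
Proof. by move=> a u v; apply: val_inj; apply: ract_linl. Qed.
Fact sub_linr u : linear (sub_act u).
Proof. by move=> a b c; apply: val_inj; apply: ract_linr. Qed.
Fact sub_act1 u : sub_act u 1 = u.
Proof. by apply: val_inj; apply: ract1. Qed.
Fact sub_actM u a b : sub_act u (a * b) = sub_act (sub_act u a) b.
Proof. by apply: val_inj; apply: ractM. Qed.

Definition submod : rmod B := RMod sub_linl sub_linr sub_act1 sub_actM.

Fact sub_incl_lin : linear (fun u : submod => vsval u).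
Proof. exact: linearP. Qed.
Fact sub_incl_subproof (u : submod) b :
  mklin sub_incl_lin (ract u b) = ract (mklin sub_incl_lin u) b.
Proof. by rewrite !mklinE. Qed.
Definition sub_incl : mhom submod M := mkhom sub_incl_subproof.

(* M / U is realized on a linear complement of U: [quo_fun] is the projection
   along U. *)
Definition quo_fun (m : M) : subvs_of (U^C)%VS :=
  vsproj (U^C)%VS (daddv_pi (U^C)%VS U m).
Fact quo_fun_lin : linear quo_fun.
Proof. by move=> a m n; rewrite /quo_fun !linearP. Qed.

Lemma quo_fun_val m : vsval (quo_fun m) = daddv_pi (U^C)%VS U m.
Proof. by rewrite /quo_fun vsprojK // memv_pi. Qed.

Let capCU : ((U^C)%VS :&: U = 0)%VS.
Proof. by rewrite capvC capv_compl. Qed.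

Lemma quo_funK (c : subvs_of (U^C)%VS) : quo_fun (vsval c) = c.
Proof. by apply: val_inj; rewrite /= quo_fun_val daddv_pi_id // subvsP. Qed.

Lemma quo_fun_eq0 m : (quo_fun m == 0) = (m \in U).
Proof.
have dec : daddv_pi (U^C)%VS U m + daddv_pi U (U^C)%VS m = m.
  by apply: daddv_pi_add => //; rewrite addvC addv_complf memvf.
apply/eqP/idP => [m0|mU].
  have E0 : vsval (quo_fun m) = 0 by rewrite m0.
  by rewrite -dec -quo_fun_val E0 add0r memv_pi.
apply: val_inj; apply: etrans (quo_fun_val m) _.
have UC0 : (U :&: (U^C)%VS = 0)%VS by apply: capv_compl.
have := dec; rewrite (daddv_pi_id UC0 mU) -[X in _ = X]add0r.
exact: addIr.
Qed.

Lemma quo_fun_eqP m n : reflect (quo_fun m = quo_fun n) (m - n \in U).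
Proof.
rewrite -quo_fun_eq0 (lin_sub quo_fun_lin) subr_eq0.
exact: eqP.
Qed.

Definition quo_act (c : subvs_of (U^C)%VS) (b : B) := quo_fun (ract (vsval c) b).
Lemma quo_act_fun m b : quo_act (quo_fun m) b = quo_fun (ract m b).
Proof.
apply/quo_fun_eqP.
rewrite -(lin_sub (ract_linl b)); apply: hU.
by apply/quo_fun_eqP; rewrite quo_funK.
Qed.

Fact quo_linl b : linear (fun c => quo_act c b).
Proof. by move=> a c d; rewrite /quo_act linearP ract_linl quo_fun_lin. Qed.
Fact quo_linr c : linear (quo_act c).
Proof. by move=> a b d; rewrite /quo_act ract_linr quo_fun_lin. Qed.
Fact quo_act1 c : quo_act c 1 = c.
Proof. by rewrite /quo_act ract1 quo_funK. Qed.
Fact quo_actM c a b : quo_act c (a * b) = quo_act (quo_act c a) b.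
Proof. by rewrite {3}/quo_act quo_act_fun -ractM. Qed.

Definition quomod : rmod B := RMod quo_linl quo_linr quo_act1 quo_actM.

Fact quo_proj_subproof m b :
  mklin (quo_fun_lin : linear (quo_fun : M -> quomod)) (ract m b)
  = ract (mklin (quo_fun_lin : linear (quo_fun : M -> quomod)) m) b.
Proof. by rewrite !mklinE -quo_act_fun. Qed.
Definition quo_proj : mhom M quomod := mkhom quo_proj_subproof.

End SubQuo.

Fact lker_stable M N (f : mhom M N) : stable (lker (vsval f)).
Proof.
move=> m b; rewrite !memv_ker mhom_ract => /eqP ->.
by rewrite -actlE linear0.
Qed.

Fact limg_stable M N (f : mhom M N) : stable (limg (vsval f)).
Proof.
by move=> _ b /memv_imgP[m _ ->]; rewrite -mhom_ract memv_img ?memvf.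
Qed.

Definition kerm M N (f : mhom M N) : rmod B := submod (@lker_stable M N f).
Definition ker_incl M N (f : mhom M N) : mhom (kerm f) M :=
  sub_incl (@lker_stable M N f).
Definition cokm M N (f : mhom M N) : rmod B := quomod (@limg_stable M N f).
Definition cok_proj M N (f : mhom M N) : mhom N (cokm f) :=
  quo_proj (@limg_stable M N f).

Section Sum2.
Variables M N : rmod B.

Definition sum_act (x : M * N) (b : B) : M * N := (ract x.1 b, ract x.2 b).
Fact sum_linl b : linear (fun x => sum_act x b).
Proof. by move=> a x y; rewrite /sum_act /= !ract_linl. Qed.
Fact sum_linr x : linear (sum_act x).
Proof. by move=> a b c; rewrite /sum_act /= !ract_linr. Qed.
Fact sum_act1 x : sum_act x 1 = x.
Proof. by case: x => m n; rewrite /sum_act !ract1. Qed.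
Fact sum_actM x a b : sum_act x (a * b) = sum_act (sum_act x a) b.
Proof. by rewrite /sum_act /= !ractM. Qed.

Definition dsum2 : rmod B :=
  @RMod K B (M * N)%type sum_act sum_linl sum_linr sum_act1 sum_actM.
End Sum2.

Section Zero.
Let V : vectType K := 'M[K]_(0, 0).
Definition zero_act (x : V) (b : B) : V := 0.
Fact zero_linl b : linear (fun x => zero_act x b).
Proof. by move=> a x y; rewrite scaler0 addr0. Qed.
Fact zero_linr x : linear (zero_act x).
Proof. by move=> a x' y; rewrite scaler0 addr0. Qed.
Fact zero_act1 x : zero_act x 1 = x.
Proof. by apply/matrixP => -[]. Qed.
Fact zero_actM x a b : zero_act x (a * b) = zero_act (zero_act x a) b.
Proof. by []. Qed.

Definition mod0 : rmod B := RMod zero_linl zero_linr zero_act1 zero_actM.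
End Zero.

Definition dsum (s : seq (rmod B)) : rmod B := foldr dsum2 mod0 s.

Definition projective_mod P : Prop :=
  forall X Y (p : mhom X Y) (g : mhom P Y), epi_mod p ->
    exists h : mhom P X, mcmp h p = g.

Definition injective_mod I : Prop :=
  forall X Y (i : mhom X Y) (g : mhom X I), mono_mod i ->
    exists h : mhom Y I, mcmp i h = g.

Definition syzygy M : Prop := exists P (i : mhom M P), projective_mod P /\ mono_mod i.
Definition cosyzygy M : Prop := exists I (p : mhom I M), injective_mod I /\ epi_mod p.

Definition zeromod M : Prop := \dim {:M} = 0%N.
Definition indecomposable M : Prop :=
  ~ zeromod M /\ forall X Y, isom M (dsum2 X Y) -> zeromod X \/ zeromod Y.

Lemma mod0_eq (x y : mod0) : x = y.
Proof. by apply/matrixP => -[]. Qed.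

Lemma homE M N (f : 'Hom(M, N)) hf m : vsval (@mkhom M N f hf) m = f m.
Proof. by []. Qed.

Section SumMaps.
Variables (M N X : rmod B).

Fact inl_lin : linear (fun m : M => (m, 0) : dsum2 M N).
Proof. by move=> a m n; congr pair; rewrite /= scaler0 addr0. Qed.
Fact inl_subproof m b : mklin inl_lin (ract m b) = ract (mklin inl_lin m) b.
Proof. by rewrite !mklinE; congr pair; rewrite /= -actlE linear0. Qed.
Definition minl : mhom M (dsum2 M N) := mkhom inl_subproof.

Fact inr_lin : linear (fun n : N => (0, n) : dsum2 M N).
Proof. by move=> a m n; congr pair; rewrite /= scaler0 addr0. Qed.
Fact inr_subproof m b : mklin inr_lin (ract m b) = ract (mklin inr_lin m) b.
Proof. by rewrite !mklinE; congr pair; rewrite /= -actlE linear0. Qed.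
Definition minr : mhom N (dsum2 M N) := mkhom inr_subproof.

Variables (f : mhom M X) (g : mhom N X) (f' : mhom X M) (g' : mhom X N).

Fact copair_lin : linear (fun x : dsum2 M N => vsval f x.1 + vsval g x.2).
Proof. by move=> a x y; rewrite /= !linearP /= scalerDr addrACA. Qed.
Fact copair_subproof x b :
  mklin copair_lin (ract x b) = ract (mklin copair_lin x) b.
Proof. by rewrite !mklinE /= !mhom_ract -!actlE linearD. Qed.
Definition mcopair : mhom (dsum2 M N) X := mkhom copair_subproof.

Fact pair_lin : linear (fun x : X => (vsval f' x, vsval g' x) : dsum2 M N).
Proof. by move=> a x y; rewrite !linearP. Qed.
Fact pair_subproof x b : mklin pair_lin (ract x b) = ract (mklin pair_lin x) b.
Proof. by rewrite !mklinE !mhom_ract. Qed.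
Definition mpair : mhom X (dsum2 M N) := mkhom pair_subproof.

End SumMaps.

Lemma minlE M N m : vsval (minl M N) m = (m, 0).
Proof. exact: mklinE. Qed.
Lemma minrE M N n : vsval (minr M N) n = (0, n).
Proof. exact: mklinE. Qed.
Lemma mcopairE M N X (f : mhom M X) (g : mhom N X) x :
  vsval (mcopair f g) x = vsval f x.1 + vsval g x.2.
Proof. exact: mklinE. Qed.
Lemma mpairE M N X (f : mhom X M) (g : mhom X N) x :
  vsval (mpair f g) x = (vsval f x, vsval g x).
Proof. exact: mklinE. Qed.

Lemma projective_mod0 : projective_mod mod0.
Proof.
by move=> X Y p g _; exists 0; apply: mhomP => x; rewrite (mod0_eq x 0) !linear0.
Qed.

Lemma injective_mod0 : injective_mod mod0.
Proof. by move=> X Y i g _; exists 0; apply: mhomP => x; apply: mod0_eq. Qed.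

Lemma projective_dsum2 P Q : projective_mod P -> projective_mod Q -> projective_mod (dsum2 P Q).
Proof.
move=> hP hQ X Y p g sp.
have [h1 e1] := hP X Y p (mcmp (minl P Q) g) sp.
have [h2 e2] := hQ X Y p (mcmp (minr P Q) g) sp.
have d1 m : vsval p (vsval h1 m) = vsval g (m, 0) by rewrite -mcmpE e1 mcmpE minlE.
have d2 n : vsval p (vsval h2 n) = vsval g (0, n) by rewrite -mcmpE e2 mcmpE minrE.
exists (mcopair h1 h2); apply: mhomP => -[x y].
rewrite mcmpE mcopairE linearD /= d1 d2 -linearD; congr (vsval g _).
by congr pair; rewrite /= ?addr0 ?add0r.
Qed.

Lemma injective_dsum2 I J : injective_mod I -> injective_mod J -> injective_mod (dsum2 I J).
Proof.
move=> hI hJ X Y i g ii.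
have [h1 e1] := hI X Y i (mcmp g (mcopair (mid I) (0 : mhom J I))) ii.
have [h2 e2] := hJ X Y i (mcmp g (mcopair (0 : mhom I J) (mid J))) ii.
have d1 x : vsval h1 (vsval i x) = (vsval g x).1.
  by rewrite -mcmpE e1 mcmpE mcopairE midE mzeroE addr0.
have d2 x : vsval h2 (vsval i x) = (vsval g x).2.
  by rewrite -mcmpE e2 mcmpE mcopairE midE mzeroE add0r.
exists (mpair h1 h2); apply: mhomP => x.
by rewrite mcmpE mpairE d1 d2; case: (vsval g x).
Qed.

Lemma syzygy_dsum2 M N : syzygy M -> syzygy N -> syzygy (dsum2 M N).
Proof.
move=> [P [i [hP ii]]] [Q [j [hQ ij]]]; exists (dsum2 P Q).
exists (mpair (mcmp (mcopair (mid M) (0 : mhom N M)) i)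
              (mcmp (mcopair (0 : mhom M N) (mid N)) j)).
split; first exact: projective_dsum2.
apply/eqP; apply/lker0P => -[x y] [x' y'].
rewrite !mpairE !mcmpE !mcopairE !midE !mzeroE !addr0 !add0r /=.
by case=> /(lker0P (introT eqP ii)) -> /(lker0P (introT eqP ij)) ->.
Qed.

Lemma syzygy_mod0 : syzygy mod0.
Proof.
exists mod0, (mid mod0); split; first exact: projective_mod0.
by apply/eqP/lker0P => x y _; apply: mod0_eq.
Qed.

Lemma epi_modP M N (f : mhom M N) :
  (forall n, exists m, vsval f m = n) -> epi_mod f.
Proof.
move=> sf; apply/vspaceP => n; rewrite memvf.
by have [m <-] := sf n; rewrite memv_img ?memvf.
Qed.

Lemma epi_mod_ex M N (f : mhom M N) : epi_mod f -> forall n, exists m, vsval f m = n.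
Proof.
move=> sf n; have := memvf n; rewrite -sf => /memv_imgP[m _ ->].
by exists m.
Qed.

Lemma cosyzygy_dsum2 M N : cosyzygy M -> cosyzygy N -> cosyzygy (dsum2 M N).
Proof.
move=> [P [i [hP si]]] [Q [j [hQ sj]]]; exists (dsum2 P Q).
exists (mpair (mcmp (mcopair (mid P) (0 : mhom Q P)) i)
              (mcmp (mcopair (0 : mhom P Q) (mid Q)) j)).
split; first exact: injective_dsum2.
apply: epi_modP => -[m n]; have [x <-] := epi_mod_ex si m.
have [y <-] := epi_mod_ex sj n; exists (x, y).
by rewrite !mpairE !mcmpE !mcopairE !midE !mzeroE !addr0 !add0r.
Qed.

Lemma cosyzygy_mod0 : cosyzygy mod0.
Proof.
exists mod0, (mid mod0); split; first exact: injective_mod0.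
by apply: epi_modP => x; exists x; rewrite midE.
Qed.

Lemma syzygy_dsum (T : Type) (M : T -> rmod B) (s : seq T) :
  (forall t, syzygy (M t)) -> syzygy (dsum [seq M t | t <- s]).
Proof.
move=> hM; elim: s => [|t s IHs]; first exact: syzygy_mod0.
exact: syzygy_dsum2.
Qed.

Lemma cosyzygy_dsum (T : Type) (M : T -> rmod B) (s : seq T) :
  (forall t, cosyzygy (M t)) -> cosyzygy (dsum [seq M t | t <- s]).
Proof.
move=> hM; elim: s => [|t s IHs]; first exact: cosyzygy_mod0.
exact: cosyzygy_dsum2.
Qed.

Definition factors (C : rmod B -> Prop) M N (f : mhom M N) : Prop :=
  exists X, C X /\ exists (u : mhom M X) (v : mhom X N), f = mcmp u v.

Lemma factors_ideal (C : rmod B -> Prop) :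
  C mod0 -> (forall X Y, C X -> C Y -> C (dsum2 X Y)) ->
  ideal (C := modcat) (fun M N f => factors C f).
Proof.
move=> C0 CD; split=> /=.
- move=> M N f ->; exists mod0; split=> //; exists 0, 0; apply: mhomP => m.
  by rewrite mcmpE !mzeroE.
- move=> M N a f g [X [CX [u [v ->]]]] [Y [CY [u' [v' ->]]]].
  exists (dsum2 X Y); split; first exact: CD.
  exists (mpair u u'), (mcopair (a *: v) v'); apply: mhomP => m.
  rewrite mlinE !mcmpE mcopairE mpairE /=; congr (_ + _).
  by rewrite mscaleE.
- move=> M N P f g [X [CX [u [v ->]]]]; exists X; split=> //.
  by exists u, (mcmp v g); rewrite mcmpA.
- move=> M N P f g [X [CX [u [v ->]]]]; exists X; split=> //.
  by exists (mcmp f u), v; rewrite mcmpA.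
Qed.

Definition stmod : kcat K :=
  quotcat (factors_ideal projective_mod0 projective_dsum2).
Definition costmod : kcat K :=
  quotcat (factors_ideal injective_mod0 injective_dsum2).

Definition stCMP : kcat K := fullcat (C := stmod) syzygy.
Definition stCMI : kcat K := fullcat (C := costmod) cosyzygy.

Definition regmod : rmod B.
Proof.
apply: (@RMod K B B (fun x b => x * b)) => [b|m|m|m a b].
- by move=> a x y; rewrite mulrDl scalerAl.
- by move=> a x y; rewrite mulrDr scalerAr.
- exact: mulr1.
- exact: mulrA.
Defined.

Section Nakayama.
Variable M : rmod B.

(* The left B-module structure of Hom_B(M, B): (b h)(m) = b h(m). *)
Fact lmulh_lin (b : B) (h : mhom M regmod) :
  linear (fun m : M => b * (vsval h m : B) : regmod).
Proof. by move=> a m n; rewrite linearP /= mulrDr scalerAr. Qed.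
Fact lmulh_subproof b h m c :
  mklin (lmulh_lin b h) (ract m c) = ract (mklin (lmulh_lin b h) m) c.
Proof. by rewrite !mklinE mhom_ract /= mulrA. Qed.
Definition lmulh (b : B) (h : mhom M regmod) : mhom M regmod :=
  mkhom (lmulh_subproof b h).

Lemma lmulhE b h m : vsval (lmulh b h) m = b * (vsval h m : B) :> B.
Proof. exact: mklinE. Qed.

(* nu M = D Hom_B(M, B), with (phi b)(h) = phi (b h). *)
Local Notation V := (Kdual (mhom M regmod)).

Fact nu_act_lin (phi : V) b : linear (fun h => dapp phi (lmulh b h) : K^o).
Proof.
move=> a h h'; apply: etrans (dapp_linr phi a _ _); congr dapp.
by apply: mhomP => m; rewrite mlinE !lmulhE mlinE mulrDr scalerAr.
Qed.
Definition nu_act (phi : V) (b : B) : V := mkdual (nu_act_lin phi b).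

Lemma nu_actE phi b h : dapp (nu_act phi b) h = dapp phi (lmulh b h).
Proof. exact: mkdualE. Qed.

Fact nu_linl b : linear (fun phi => nu_act phi b).
Proof.
by move=> a phi psi; apply: dualP => h; rewrite [RHS]dapp_linl !nu_actE [LHS]dapp_linl.
Qed.
Fact nu_linr phi : linear (nu_act phi).
Proof.
move=> a b c; apply: dualP => h; rewrite [RHS]dapp_linl !nu_actE -dapp_linr.
congr dapp; apply: mhomP => m.
by rewrite mlinE !lmulhE mulrDl scalerAl.
Qed.
Fact nu_act1 phi : nu_act phi 1 = phi.
Proof.
apply: dualP => h; rewrite nu_actE; congr dapp; apply: mhomP => m.
by rewrite lmulhE mul1r.
Qed.
Fact nu_actM phi a b : nu_act phi (a * b) = nu_act (nu_act phi a) b.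
Proof.
apply: dualP => h; rewrite !nu_actE; congr dapp; apply: mhomP => m.
by rewrite !lmulhE mulrA.
Qed.

Definition nu : rmod B := RMod nu_linl nu_linr nu_act1 nu_actM.
End Nakayama.

Section NakayamaMap.
Variables (M N : rmod B) (g : mhom M N).

Fact nu_map_lin1 (phi : nu M) :
  linear (fun h : mhom N regmod => dapp phi (mcmp g h) : K^o).
Proof. by move=> a h h'; rewrite mcmp_linr; apply: dapp_linr. Qed.
Definition nu_fun (phi : nu M) : nu N := mkdual (nu_map_lin1 phi).
Lemma nu_funE phi h : dapp (nu_fun phi) h = dapp phi (mcmp g h).
Proof. exact: mkdualE. Qed.
Fact nu_map_lin2 : linear nu_fun.
Proof.
by move=> a phi psi; apply: dualP => h; rewrite [RHS]dapp_linl !nu_funE [LHS]dapp_linl.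
Qed.
Fact nu_map_subproof (phi : nu M) b :
  mklin nu_map_lin2 (ract phi b) = ract (mklin nu_map_lin2 phi) b.
Proof.
rewrite !mklinE; apply: dualP => h; rewrite nu_funE !nu_actE nu_funE.
by congr dapp; apply: mhomP => m; rewrite !(mcmpE, lmulhE).
Qed.
Definition nu_map : mhom (nu M) (nu N) := mkhom nu_map_subproof.
End NakayamaMap.

(* The bimodule DB: (phi b)(x) = phi (b x), (b phi)(x) = phi (x b). *)
Fact dual_act_lin (phi : Kdual B) b : linear (fun x : B => dapp phi (b * x) : K^o).
Proof. by move=> a x y; rewrite mulrDr -scalerAr; apply: dapp_linr. Qed.
Definition dual_act (phi : Kdual B) b : Kdual B := mkdual (dual_act_lin phi b).
Lemma dual_actE phi b x : dapp (dual_act phi b) x = dapp phi (b * x).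
Proof. exact: mkdualE. Qed.
Fact dual_linl b : linear (fun phi => dual_act phi b).
Proof.
by move=> a phi psi; apply: dualP => x; rewrite [RHS]dapp_linl !dual_actE [LHS]dapp_linl.
Qed.
Fact dual_linr phi : linear (dual_act phi).
Proof.
move=> a b c; apply: dualP => x; rewrite [RHS]dapp_linl !dual_actE.
by rewrite mulrDl -scalerAl dapp_linr.
Qed.
Fact dual_act1 phi : dual_act phi 1 = phi.
Proof. by apply: dualP => x; rewrite dual_actE mul1r. Qed.
Fact dual_actM phi a b : dual_act phi (a * b) = dual_act (dual_act phi a) b.
Proof. by apply: dualP => x; rewrite !dual_actE mulrA. Qed.

Definition dualB : rmod B := RMod dual_linl dual_linr dual_act1 dual_actM.

Fact dual_lmul_lin1 b (phi : Kdual B) : linear (fun x : B => dapp phi (x * b) : K^o).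
Proof. by move=> a x y; rewrite mulrDl -scalerAl; apply: dapp_linr. Qed.
Definition dual_lmul_fun b (phi : dualB) : dualB := mkdual (dual_lmul_lin1 b phi).
Lemma dual_lmul_funE b phi x : dapp (dual_lmul_fun b phi) x = dapp phi (x * b).
Proof. exact: mkdualE. Qed.
Fact dual_lmul_lin2 b : linear (dual_lmul_fun b).
Proof.
move=> a phi psi; apply: dualP => x.
by rewrite [RHS]dapp_linl !dual_lmul_funE [LHS]dapp_linl.
Qed.
Fact dual_lmul_subproof b (phi : dualB) c :
  mklin (dual_lmul_lin2 b) (ract phi c) = ract (mklin (dual_lmul_lin2 b) phi) c.
Proof.
rewrite !mklinE; apply: dualP => x; rewrite dual_lmul_funE !dual_actE.
by rewrite dual_lmul_funE mulrA.
Qed.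
Definition dual_lmul (b : B) : mhom dualB dualB := mkhom (dual_lmul_subproof b).

Lemma dual_lmulE b (phi : dualB) x :
  dapp (vsval (dual_lmul b) phi) x = dapp phi (x * b).
Proof. by rewrite homE mklinE dual_lmul_funE. Qed.

Section NakayamaInv.
Variable M : rmod B.
Local Notation V := (mhom dualB M).

(* (h b)(phi) = h (b phi) *)
Definition nuV_act (h : V) (b : B) : V := mcmp (dual_lmul b) h.
Fact nuV_linl b : linear (fun h => nuV_act h b).
Proof. exact: mcmp_linr. Qed.
Fact nuV_linr h : linear (nuV_act h).
Proof.
move=> a b c; apply: etrans (mcmp_linl h a _ _); congr mcmp.
apply: mhomP => phi; rewrite mlinE; apply: dualP => x.
by rewrite [RHS]dapp_linl !dual_lmulE mulrDr -scalerAr dapp_linr.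
Qed.
Fact nuV_act1 h : nuV_act h 1 = h.
Proof.
apply: mhomP => phi; rewrite mcmpE; congr (vsval h _).
by apply: dualP => x; rewrite dual_lmulE mulr1.
Qed.
Fact nuV_actM h a b : nuV_act h (a * b) = nuV_act (nuV_act h a) b.
Proof.
apply: mhomP => phi; rewrite !mcmpE; congr (vsval h _).
by apply: dualP => x; rewrite !dual_lmulE mulrA.
Qed.

Definition nuV : rmod B := RMod nuV_linl nuV_linr nuV_act1 nuV_actM.
End NakayamaInv.

Section NakayamaInvMap.
Variables (M N : rmod B) (g : mhom M N).
Fact nuV_map_lin : linear (fun h : nuV M => mcmp h g : nuV N).
Proof. exact: mcmp_linl. Qed.
Fact nuV_map_subproof h b :
  mklin nuV_map_lin (ract h b) = ract (mklin nuV_map_lin h) b.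
Proof. by rewrite !mklinE /= /nuV_act mcmpA. Qed.
Definition nuV_map : mhom (nuV M) (nuV N) := mkhom nuV_map_subproof.
End NakayamaInvMap.

(* [f] has a superfluous kernel, resp. an essential image. *)
Definition ker_superfluous M N (f : mhom M N) : Prop :=
  forall U : {vspace M}, stable U -> (U + lker (vsval f) = fullv)%VS -> U = fullv.
Definition img_essential M N (f : mhom M N) : Prop :=
  forall U : {vspace N}, stable U -> (U :&: limg (vsval f) = 0)%VS -> U = 0%VS.

(* P1 -> P0 -> M -> 0 exact, with projective covers onto M and onto the image
   of P1. *)
Record min_proj_pres P1 P0 M (p1 : mhom P1 P0) (p0 : mhom P0 M) : Prop := {
  mpp_proj1 : projective_mod P1;
  mpp_proj0 : projective_mod P0;
  mpp_surj : epi_mod p0;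
  mpp_exact : limg (vsval p1) = lker (vsval p0);
  mpp_min0 : ker_superfluous p0;
  mpp_min1 : ker_superfluous p1
}.

Record min_inj_copres M I0 I1 (i0 : mhom M I0) (i1 : mhom I0 I1) : Prop := {
  mic_inj0 : injective_mod I0;
  mic_inj1 : injective_mod I1;
  mic_mono : mono_mod i0;
  mic_exact : limg (vsval i0) = lker (vsval i1);
  mic_min0 : img_essential i0;
  mic_min1 : img_essential i1
}.

Record proj_presentation M := ProjPresentation {
  pp1 : rmod B;
  pp0 : rmod B;
  pp_d : mhom pp1 pp0;
  pp_aug : mhom pp0 M;
  pp_min : min_proj_pres pp_d pp_aug
}.

Record inj_copresentation M := InjCopresentation {
  ip0 : rmod B;
  ip1 : rmod B;
  ip_aug : mhom M ip0;
  ip_d : mhom ip0 ip1;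
  ip_min : min_inj_copres ip_aug ip_d
}.

(* tau : mod B / proj -> mod B / inj, built from a choice of minimal projective
   presentations: tau M = ker (nu P1 -> nu P0), and tau g is the class of the
   map induced on kernels by any lift (g1, g0) of g to the presentations. *)
Record AR_translation := {
  ar_pres : forall M, proj_presentation M;
  ar_ob := fun M : rmod B => kerm (nu_map (pp_d (ar_pres M)));
  ar_fun : functor (C := stmod) (D := costmod) ar_ob;
  ar_spec : forall M N (g : mhom M N)
      (g0 : mhom (pp0 (ar_pres M)) (pp0 (ar_pres N)))
      (g1 : mhom (pp1 (ar_pres M)) (pp1 (ar_pres N)))
      (h : mhom (ar_ob M) (ar_ob N)),
    mcmp (pp_aug (ar_pres M)) g = mcmp g0 (pp_aug (ar_pres N)) ->
    mcmp (pp_d (ar_pres M)) g0 = mcmp g1 (pp_d (ar_pres N)) ->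
    mcmp h (ker_incl (nu_map (pp_d (ar_pres N))))
      = mcmp (ker_incl (nu_map (pp_d (ar_pres M)))) (nu_map g1) ->
    heq (fmap ar_fun (g : hom (M : stmod) (N : stmod)))
        (h : hom (ar_ob M : costmod) (ar_ob N : costmod))
}.

(* Dually, tau^-1 M = coker (nu^-1 I0 -> nu^-1 I1). *)
Record AR_translation_inv := {
  arV_copres : forall M, inj_copresentation M;
  arV_ob := fun M : rmod B => cokm (nuV_map (ip_d (arV_copres M)));
  arV_fun : functor (C := costmod) (D := stmod) arV_ob;
  arV_spec : forall M N (g : mhom M N)
      (g0 : mhom (ip0 (arV_copres M)) (ip0 (arV_copres N)))
      (g1 : mhom (ip1 (arV_copres M)) (ip1 (arV_copres N)))
      (h : mhom (arV_ob M) (arV_ob N)),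
    mcmp (ip_aug (arV_copres M)) g0 = mcmp g (ip_aug (arV_copres N)) ->
    mcmp (ip_d (arV_copres M)) g1 = mcmp g0 (ip_d (arV_copres N)) ->
    mcmp (cok_proj (nuV_map (ip_d (arV_copres M)))) h
      = mcmp (nuV_map g1) (cok_proj (nuV_map (ip_d (arV_copres N)))) ->
    heq (fmap arV_fun (g : hom (M : costmod) (N : costmod)))
        (h : hom (arV_ob M : stmod) (arV_ob N : stmod))
}.

End Modules.

Section DimerTree.
Variable Q : quiver.
Local Notation V := (vert Q).
Local Notation A := (arr Q).

Definition chordless_seq (s : seq A) : bool :=
  [&& s != [::], cycle (fun a b => tgt a == src b) s, uniq [seq src a | a <- s]
    & [forall a, (src a \in [seq src b | b <- s]) && (tgt a \in [seq src b | b <- s])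
                 ==> (a \in s)]].

(* A chordless cycle up to rotation is the set of its arrows; since its vertices
   are distinct, the set determines the cyclic order. *)
Definition chordless : {set {set A}} :=
  [set C : {set A} | has chordless_seq (permutations (enum C))].

(* One of the rotations of the cyclic path through C. *)
Definition cyc_path (C : {set A}) : seq A :=
  head [::] [seq s <- permutations (enum C) | chordless_seq s].

Definition boundary (a : A) : bool := #|[set C in chordless | a \in C]| == 1%N.
Definition interior (a : A) : bool := (1 < #|[set C in chordless | a \in C]|)%N.

(* The dual graph, on its vertices inl C, inr a. *)
Definition dvertex (v : {set A} + A) : bool :=
  match v with inl C => C \in chordless | inr a => boundary a end.

Definition dadj (u v : {set A} + A) : bool :=
  [&& dvertex u, dvertex v &
    match u, v with
    | inl C, inl C' => (C != C') && (C :&: C' != set0)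
    | inl C, inr a | inr a, inl C => a \in C
    | inr _, inr _ => false
    end].

(* Two chordless cycles are joined by one edge per shared arrow, so that in a
   tree they share at most one. *)
Definition dual_graph_tree : Prop :=
  [/\ exists v, dvertex v,
      forall u v, dvertex u -> dvertex v -> connect dadj u v,
      forall C C', C \in chordless -> C' \in chordless -> C != C' ->
        (#|C :&: C'| <= 1)%N
    & forall p, (2 < size p)%N -> ~ ucycle dadj p].

(* The length of the simple path from C to C', unique when the graph is a tree. *)
Definition dual_dist (C C' : {set A}) : nat :=
  find (fun n => [exists p : n.-tuple ({set A} + A)%type,
          [&& path dadj (inl C) p, uniq (inl C :: p) & last (inl C) p == inl C']])
    (iota 0 #|{: {set A} + A}|).

Definition boundary_simple_cycle : Prop :=
  exists (n : nat) (c : 'I_n -> A) (x : 'I_n -> V),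
    [/\ (2 < n)%N, injective c, injective x,
        forall a, boundary a <-> exists k, c k = a
      & forall k, (src (c k) = x k /\ tgt (c k) = x (ordS k)) \/
                  (src (c k) = x (ordS k) /\ tgt (c k) = x k)].

Definition adjacent (i j : V) : bool :=
  [exists a : A, (src a == i) && (tgt a == j) || (src a == j) && (tgt a == i)].

Record dimer_tree_quiver : Prop := {
  dt_nonempty : exists i : V, true;
  dt_connected : forall i j : V, connect adjacent i j;
  dt_no_loop : forall a : A, src a <> tgt a;
  dt_no_2cycle : forall a b : A, ~ (src a = tgt b /\ tgt a = src b);
  dt_Q1 : forall a : A, exists2 C, C \in chordless & a \in C;
  dt_Q2 : dual_graph_tree;
  dt_Q3 : boundary_simple_cycle
}.

(* The second case is that of a quiver with a single chordless cycle. *)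
Definition root_cycle (C0 : {set A}) : Prop :=
  C0 \in chordless /\
  (#|[set a in C0 | interior a]| = 1%N \/ C0 = [set: A]).

(* [s] is the cycle path of the boundary arrow [a]; [cs] lists the cycles C_i.
   It has at least two arrows. *)
Definition cycle_path (a : A) (s : seq A) : Prop :=
  exists cs : seq {set A},
    [/\ (0 < size cs)%N, size s = (size cs).+1, uniq cs,
        forall k, (k < size cs)%N ->
          [/\ nth set0 cs k \in chordless,
              nth a s k \in nth set0 cs k, nth a s k.+1 \in nth set0 cs k
            & tgt (nth a s k) = src (nth a s k.+1)]
      & [/\ nth a s 0 = a, boundary a, boundary (last a s)
          & forall k, (0 < k < size cs)%N -> interior (nth a s k)]].

Definition is_weight (w : A -> nat) : Prop :=
  forall a, boundary a ->
    exists2 s, cycle_path a s & w a = if odd (size s) then 1%N else 2%N.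

Definition total_weight (n : nat) : Prop :=
  exists2 w, is_weight w & n = (\sum_(a | boundary a) w a)%N.

Section Jacobian.
Variables (K : fieldType) (C0 : {set A}).

Definition cyc_deriv (a : A) (s : seq A) : qhom K (tgt a) (src a) :=
  \sum_(p < size s | nth a s p == a)
    pathelt K (tgt a) (src a) (drop p.+1 s ++ take p s).

(* The cyclic derivative at [a] of W = sum_C (-1)^d(C) C *)
Definition potential_deriv (a : A) : qhom K (tgt a) (src a) :=
  \sum_(C in chordless) (-1) ^+ dual_dist C0 C *: cyc_deriv a (cyc_path C).

Inductive jac_rel : forall i j : pathcat K Q, hom i j -> Prop :=
| JacRel a : @jac_rel (tgt a) (src a) (potential_deriv a).

(* [pi] exhibits B as the quotient of the path algebra KQ, the direct sum of the
   spaces [qhom K i j], by the ideal generated by the derivatives of W. *)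
Record jacobian_algebra (B : falgType K)
    (pi : forall i j : V, {linear qhom K i j -> B}) : Prop := {
  jac_cmp : forall i j k (f : qhom K i j) (g : qhom K j k),
    pi i k (qcmp f g) = pi i j f * pi j k g;
  jac_orth : forall i j k l (f : qhom K i j) (g : qhom K k l),
    j != k -> pi i j f * pi k l g = 0;
  jac_unit : \sum_i pi i i (qlin K (qnil i)) = 1;
  jac_surj : forall b : B, exists f : forall i j, qhom K i j,
    b = \sum_i \sum_j pi i j (f i j);
  jac_ker : forall i j (f : qhom K i j),
    pi i j f = 0 <-> ideal_gen jac_rel (f : hom (i : pathcat K Q) j)
}.

End Jacobian.
End DimerTree.

Section Projectives.
Variables (K : fieldType) (B : falgType K).

Fact right_ideal_stable (e : B) :
  stable (limg (amull e) : {vspace regmod B}).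
Proof.
move=> _ b /memv_imgP[x _ ->]; apply/memv_imgP; exists (x * b).
  exact: memvf.
by rewrite !lfunE /= mulrA.
Qed.

Definition right_ideal (e : B) : rmod B := submod (@right_ideal_stable e).

Variables (Q : quiver) (pi : forall i j : vert Q, {linear qhom K i j -> B}).

Definition proj_at (i : vert Q) : rmod B := right_ideal (pi i i (qlin K (qnil i))).
End Projectives.

Section Diagonals.
Variable N : nat.

(* The vertices of the polygon are numbered clockwise; [v] carries the label
   [v.+1]. *)
Definition pvertex : finType := 'I_N.*2.

Definition cwd (u v : pvertex) : nat := (v + N.*2 - u) %% N.*2.

(* A 2-diagonal is the pair of its odd and its even endpoint. Cutting along it
   gives polygons with (cwd o e).+1 and (cwd e o).+1 vertices. *)
Definition is_diag2 (g : pvertex * pvertex) : bool :=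
  [&& odd g.1.+1, ~~ odd g.2.+1,
      ~~ odd (cwd g.1 g.2).+1, (4 <= (cwd g.1 g.2).+1)%N,
      ~~ odd (cwd g.2 g.1).+1 & (4 <= (cwd g.2 g.1).+1)%N].

Definition diag2 : finType := {g : pvertex * pvertex | is_diag2 g}.

Definition cw2 (v : pvertex) : pvertex := ordS (ordS v).

(* Moving one endpoint of a 2-diagonal two steps clockwise yields a 2-diagonal
   unless the resulting endpoints are neighbors. *)
Definition pivot (g g' : diag2) : bool :=
  (sval g' == ((sval g).1, cw2 (sval g).2)) || (sval g' == (cw2 (sval g).1, (sval g).2)).

Definition diag_quiver : quiver :=
  @Quiver diag2 {a : diag2 * diag2 | pivot a.1 a.2}
    (fun a => (sval a).1) (fun a => (sval a).2).

(* t is the image of x under R^-2. *)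
Definition is_translate (t x : diag2) : bool :=
  sval x == (cw2 (sval t).1, cw2 (sval t).2).

Section Mesh.
Variable K : fieldType.

Inductive mesh_rel : forall t x : pathcat K diag_quiver, hom t x -> Prop :=
| MeshRel (t x : diag2) : is_translate t x ->
    @mesh_rel t x
      (\sum_(a : arr diag_quiver | tgt a == x)
         \sum_(b : arr diag_quiver | (src b == t) && (tgt b == src a))
           pathelt K (Q := diag_quiver) t x [:: b; a]).

Definition Diag : kcat K := addhull (quotcat (ideal_gen_ideal mesh_rel)).
End Mesh.

(* Going clockwise around the polygon from the tail of a chord to its head, one
   passes the vertices on its left. *)
Definition left_of (g : pvertex * pvertex) (v : pvertex) : bool :=
  (0 < cwd g.1 v < cwd g.1 g.2)%N.
Definition right_of (g : pvertex * pvertex) (v : pvertex) : bool :=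
  (cwd g.1 g.2 < cwd g.1 v)%N.

(* [cross_rl g' g]: g' crosses g from right to left. *)
Definition cross_rl (g' g : pvertex * pvertex) : bool :=
  right_of g g'.1 && left_of g g'.2.
Definition cross_lr (g' g : pvertex * pvertex) : bool :=
  left_of g g'.1 && right_of g g'.2.
Definition cross (g' g : pvertex * pvertex) : bool := cross_rl g' g || cross_lr g' g.

Definition direct (d : bool) (g : pvertex * pvertex) : pvertex * pvertex :=
  if d then g else (g.2, g.1).

End Diagonals.

(* The radical lines are the chords [rho i]. [dir C i] tells whether the
   counterclockwise traversal of the shaded region of the chordless cycle C runs
   along rho(i) from the odd to the even endpoint. Chords x_0, ..., x_t bound a
   region whose sides, read counterclockwise, lie on x_0, ..., x_t in this
   order if and only if, directed by the traversal, each chord crosses the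
   previous one from right to left (left turns). Two shaded regions meeting at a
   crossing point occupy opposite angles, hence traverse both chords in opposite
   directions; the shaded triangle of a boundary arrow a : i -> j of C likewise
   runs along the part of rho(i) behind the crossing, then along the part of
   rho(j) before it, and its third side is the polygon edge going clockwise from
   the vertex [seg a], the end of rho(i), to the start of rho(j). A polygon edge
   not of this form closes a white region between consecutive shaded triangles,
   and so lies between two shaded edges. *)
Record checkerboard (Q : quiver) (N : nat) (rho : vert Q -> diag2 N)
    (dir : {set arr Q} -> vert Q -> bool) (seg : arr Q -> pvertex N) : Prop := {
  cb_cross : forall i j, cross (sval (rho i)) (sval (rho j)) = adjacent i j;
  cb_region : forall (C : {set arr Q}) (a : arr Q), C \in chordless Q -> a \in C ->
    cross_rl (direct (dir C (tgt a)) (sval (rho (tgt a))))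
             (direct (dir C (src a)) (sval (rho (src a))));
  cb_opposite : forall (C C' : {set arr Q}) (a : arr Q),
    C \in chordless Q -> C' \in chordless Q -> C != C' -> a \in C -> a \in C' ->
    dir C' (src a) = ~~ dir C (src a) /\ dir C' (tgt a) = ~~ dir C (tgt a);
  cb_triangle : forall (C : {set arr Q}) (a : arr Q),
    C \in chordless Q -> a \in C -> boundary a ->
    (direct (dir C (src a)) (sval (rho (src a)))).2 = seg a /\
    (direct (dir C (tgt a)) (sval (rho (tgt a)))).1 = ordS (seg a);
  cb_seg_inj : forall a b : arr Q, boundary a -> boundary b -> seg a = seg b -> a = b;
  cb_white : forall v : pvertex N, exists2 a, boundary a & seg a = v \/ seg a = ordS v
}.

Section TwoDiagonalModules.
Variables (K : fieldType) (B : falgType K) (Q : quiver).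
Variable pi : forall i j : vert Q, {linear qhom K i j -> B}.
Variables (N : nat) (rho : vert Q -> diag2 N).

Definition P0 (g : diag2 N) : rmod B :=
  dsum [seq proj_at pi i | i <- enum (vert Q) & cross_rl (sval (rho i)) (sval g)].
Definition P1 (g : diag2 N) : rmod B :=
  dsum [seq proj_at pi i | i <- enum (vert Q) & cross_lr (sval (rho i)) (sval g)].

(* Additive extensions to Diag(S) of maps g |-> M g. *)
Definition syzygy_ext (M : diag2 N -> rmod B) (hM : forall g, syzygy (M g))
    (X : Diag N K) : stCMP B :=
  exist (@syzygy K B) (dsum [seq M (X k) | k <- enum 'I_(fsize X)])
    (syzygy_dsum (enum 'I_(fsize X)) (fun k => hM (X k))).

Definition cosyzygy_ext (M : diag2 N -> rmod B) (hM : forall g, cosyzygy (M g))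
    (X : Diag N K) : stCMI B :=
  exist (@cosyzygy K B) (dsum [seq M (X k) | k <- enum 'I_(fsize X)])
    (cosyzygy_dsum (enum 'I_(fsize X)) (fun k => hM (X k))).

End TwoDiagonalModules.

(* Main.v *)
Require Import Defs.
From HB Require Import structures.
From mathcomp Require Import all_boot all_order all_algebra all_field.
From mathcomp Require Import finmap.
From mathcomp.multinomials Require Import monalg.
From Stdlib Require Import ClassicalEpsilon.

Set Implicit Arguments.
Unset Strict Implicit.
Unset Printing Implicit Defensive.
Import GRing.Theory.

(** Write [D = Hom_K(-, K)] and [nu = D Hom_B(-, B)]. For every finite-dimensional
    algebra, tau = ker nu(P1 -> P0) and its dual are mutually inverse
    equivalences between the module category modulo projectives and the module
    category modulo injectives: a projective presentation of M becomes, under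
    nu, an injective copresentation of tau M, and nu^-1 nu P = P for P projective,
    nu nu^-1 I = I for I injective. The presentation need not be minimal, which
    leaves the freedom to use the sum of the f_g for the g in an object of
    Diag(S).

    What depends on the Jacobian algebra is that tau sends syzygies to
    cosyzygies and tau^-1 cosyzygies to syzygies. Applying nu to P2 -> P1 -> P0
    preserves exactness at P1 as soon as Ext^1(M, B) = 0, so it is enough to show
    Ext^2(X, B) = 0 and Ext^2(D B, Z) = 0 for all X and Z, i.e. that B is
    Gorenstein of dimension at most 1. The self-dual complex of bimodules
    B (x) B -> sum_a B (x) B -> sum_a B (x) B -> B (x) B attached to the potential
    begins a resolution of B (exactness of a presentation by generators and
    relations, expressed with Fox derivatives); since the second derivatives
    d_a d_b W are symmetric in a and b, dualizing it gives the same complex, and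
    the exactness at its end becomes the vanishing of the second cohomology.

    The functor on cosyzygies is then F followed by tau, transported along the
    isomorphisms between the kernels computed from two presentations. *)

(** No Ext group is ever formed. An extension of X by Z is a bilinear cocycle on X x B; once it
    vanishes on the idempotents it is determined by its values on the arrows, and a family of values
    is admissible when it kills each [d_a W]. So everything is a statement about families of linear
    maps indexed by arrows. [Ext^2 = 0] is used only in the form: a cocycle extends from a
    submodule, or lifts along a quotient map. Over a projective or into an injective the resulting
    cocycle is a coboundary, and this is how [Ext^1] vanishes for syzygies and cosyzygies. The cases
    Z = B and X = D B are those in which Hom(X, Z) has B as a tensor factor. Elements of that factor
    can be differentiated, and the derivative is a homotopy contracting the complex at the second
    term, up to coboundaries. Maps induced on kernels depend on lifts. They are therefore treated as
    a relation between morphisms, and a choice is made only when a functor is formed. *)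

Section Additive.
Local Open Scope ring_scope.

Lemma subrACA (V : zmodType) (a b c d : V) : (a - b) - (c - d) = (a - c) - (b - d).
Proof. by rewrite !opprB addrACA [- b - c]addrC addrACA [d - b]addrC. Qed.

Fact sub_swap (V : zmodType) (u v w u' v' w' : V) :
  u = v' -> v = u' -> w = w' -> u - v - w = - u' - - v' - w'.
Proof. by move=> -> -> ->; rewrite opprK (addrC (- u')). Qed.

Lemma lin_sum (R : pzRingType) (V W : lmodType R) (T : V -> W) (I : finType) (d : I -> R) (u : I -> V) :
  linear T -> T (\sum_n d n *: u n) = \sum_n d n *: T (u n).
Proof.
move=> lT; elim/big_rec2: _ => [|n v w _ <-]; last exact: lT.
by have := lT (-1) 0 0; rewrite scaler0 addr0 scaleN1r addNr.
Qed.

End Additive.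

(** * Linear algebra over a field and biduality *)

Section LinearAlgebra.
Local Open Scope ring_scope.
Variables (K : fieldType) (U V W : vectType K).

(** [t^-1] is a linear section of [t] over its image, so [v - t^-1 (t v)] lies in the kernel of [t],
    on which [f] vanishes. *)
Lemma lfun_factor (t : 'Hom(V, W)) (f : 'Hom(V, U)) :
  (forall v, t v = 0 -> f v = 0) -> exists g : 'Hom(W, U), forall v, g (t v) = f v.
Proof.
move=> H; exists (f \o t^-1)%VF => v; rewrite comp_lfunE; apply/eqP.
rewrite -subr_eq0 -linearB; apply/eqP/H.
by rewrite linearB /= limg_lfunVK ?memv_img ?memvf // subrr.
Qed.

Lemma lfun_ext (i : 'Hom(V, W)) (f : 'Hom(V, U)) :
  (forall v, i v = 0 -> v = 0) -> exists g : 'Hom(W, U), forall v, g (i v) = f v.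
Proof. by move=> ii; apply: lfun_factor => v /ii ->; rewrite linear0. Qed.

Lemma lfun_lift (t : 'Hom(V, W)) (f : 'Hom(U, W)) :
  (forall u, exists v, t v = f u) -> exists g : 'Hom(U, V), forall u, t (g u) = f u.
Proof.
move=> H; exists (t^-1 \o f)%VF => u; rewrite comp_lfunE limg_lfunVK //.
by have [v <-] := H u; rewrite memv_img ?memvf.
Qed.

Lemma lfun_inj_dim (t : 'Hom(V, W)) : (forall v, t v = 0 -> v = 0) ->
  (\dim {:V} <= \dim {:W})%N.
Proof.
move=> H; rewrite -(@limg_dim_eq _ _ _ t {:V}%VS); first exact/dimvS/subvf.
rewrite capfv; apply/eqP; rewrite -subv0; apply/subvP => v.
by rewrite memv_ker memv0 => /eqP/H ->.
Qed.

Lemma dapp_sep (v : V) : (forall phi : Kdual V, dapp phi v = 0) -> v = 0.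
Proof.
move=> H; rewrite [v](coord_vbasis (memvf v)) big1 // => i _.
have lc : linear (coord (vbasis {:V}) i : V -> K^o) by move=> a x y; rewrite linearP.
by have := H (mkdual lc); rewrite mkdualE => ->; rewrite scale0r.
Qed.

Lemma dapp_suml (I : finType) (c : I -> K) (phi : I -> Kdual V) v :
  dapp (\sum_i c i *: phi i) v = \sum_i c i * dapp (phi i) v.
Proof.
have Z : dapp (0 : Kdual V) v = 0.
  by have := dapp_linl (-1) 0 (0 : Kdual V) v; rewrite scaler0 addr0 mulN1r addNr.
by elim/big_rec2: _ => // i x y _ <-; exact: dapp_linl.
Qed.

Lemma dapp_sumr (I : finType) (c : I -> K) phi (x : I -> V) :
  dapp phi (\sum_i c i *: x i) = \sum_i c i * dapp phi (x i).
Proof. have Z : dapp phi 0 = 0.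
  by have := dapp_linr phi (-1) 0 0; rewrite scaler0 addr0 mulN1r addNr.
by elim/big_rec2: _ => // i y z _ <-; exact: dapp_linr. Qed.

Definition dcoord i : Kdual V := mkdual (linearP (coord (vbasis {:V}) i) : linear (_ : V -> K^o)).

Lemma dcoordE i v : dapp (dcoord i) v = coord (vbasis {:V}) i v.
Proof. exact: mkdualE. Qed.

Lemma dual_basisE (phi : Kdual V) :
  phi = \sum_(i < \dim {:V}) dapp phi (vbasis {:V})`_i *: dcoord i.
Proof.
apply: dualP => v; rewrite {1}[v](coord_vbasis (memvf v)) dapp_sumr dapp_suml.
by apply: eq_bigr => i _; rewrite dcoordE mulrC.
Qed.

(** Finite-dimensional biduality, the source of all elements of [B = D D B] and [I = D D I] that are
    obtained below from functionals. *)
Lemma bidualP (L : Kdual V -> K) : linear (L : Kdual V -> K^o) ->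
  exists v, forall phi, L phi = dapp phi v.
Proof.
move=> lL.
pose l : {linear Kdual V -> K^o} := HB.pack (L : Kdual V -> K^o)
  (GRing.isLinear.Build K (Kdual V) K^o _ L lL).
exists (\sum_(i < \dim {:V}) L (dcoord i) *: (vbasis {:V})`_i) => phi.
rewrite dapp_sumr {1}[phi]dual_basisE -[L _]/(l _) linear_sum; apply: eq_bigr => i _.
by rewrite linearZ [LHS]mulrC.
Qed.

Lemma dapp0l (x : V) : dapp (0 : Kdual V) x = 0.
Proof. by have := dapp_linl (-1) 0 (0 : Kdual V) x; rewrite scaler0 addr0 mulN1r addNr. Qed.

Lemma dapp0r (phi : Kdual V) : dapp phi 0 = 0.
Proof. by have := dapp_linr phi (-1) 0 0; rewrite scaler0 addr0 mulN1r addNr. Qed.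

Lemma dappD (phi psi : Kdual V) x : dapp (phi + psi) x = dapp phi x + dapp psi x.
Proof. by have := dapp_linl 1 phi psi x; rewrite scale1r mul1r. Qed.

Lemma dappB (phi psi : Kdual V) x : dapp (phi - psi) x = dapp phi x - dapp psi x.
Proof. by have := dapp_linl (-1) psi phi x; rewrite scaleN1r mulN1r addrC => ->; rewrite addrC. Qed.

Lemma dapp_inj (x y : V) : (forall phi : Kdual V, dapp phi x = dapp phi y) -> x = y.
Proof.
move=> e; apply/eqP; rewrite -subr_eq0; apply/eqP/dapp_sep => phi.
have := dapp_linr phi (-1) y x; rewrite scaleN1r mulN1r addrC => ->.
by rewrite e addNr.
Qed.

End LinearAlgebra.

(** * Lifting, factoring and splitting module maps *)

Section ModuleMaps.
Local Open Scope ring_scope.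
Variables (K : fieldType) (B : falgType K).
Implicit Types M N P X Y Z : rmod B.

Definition mk_mhom M N (f : M -> N) (lf : linear f)
    (ef : forall m b, f (ract m b) = ract (f m) b) : mhom M N :=
  mkhom (fun m b => etrans (mklinE lf (ract m b))
    (etrans (ef m b) (esym (congr1 (fun x => ract x b) (mklinE lf m))))).

Lemma mk_mhomE M N (f : M -> N) lf ef m : vsval (mk_mhom (f := f) lf ef) m = f m.
Proof. exact: (mklinE lf). Qed.

Lemma ract0 M b : ract (0 : M) b = 0.
Proof. by rewrite -actlE linear0. Qed.
Lemma ractD M (x y : M) b : ract (x + y) b = ract x b + ract y b.
Proof. by rewrite -!actlE linearD. Qed.
Lemma ractB M (x y : M) b : ract (x - y) b = ract x b - ract y b.
Proof. by rewrite -!actlE linearB. Qed.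
Lemma ractN M (x : M) b : ract (- x) b = - ract x b.
Proof. by rewrite -!actlE linearN. Qed.
Lemma ractZ M a (x : M) b : ract (a *: x) b = a *: ract x b.
Proof. by rewrite -!actlE linearZ. Qed.
Lemma ract_sum M (I : finType) (x : I -> M) b :
  ract (\sum_i x i) b = \sum_i ract (x i) b.
Proof. by rewrite -actlE linear_sum; apply: eq_bigr => i _; apply: actlE. Qed.
Lemma ractr_sum M (I : finType) (x : M) (b : I -> B) :
  ract x (\sum_i b i) = \sum_i ract x (b i).
Proof.
have L := @ract_linr K B M x.
have Z : ract x 0 = 0 by rewrite -(subrr 0) (lin_sub L) subrr.
apply: (big_morph _ _ Z) => b1 b2.
by have := L 1 b1 b2; rewrite !scale1r.
Qed.
Lemma ractr0 M (x : M) : ract x 0 = 0.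
Proof. by rewrite -(subrr 0) (lin_sub (@ract_linr K B M x)) subrr. Qed.

Lemma mhom_sum M N (f : mhom M N) (I : finType) (x : I -> M) :
  vsval f (\sum_i x i) = \sum_i vsval f (x i).
Proof. exact: linear_sum. Qed.

Lemma mhomB M N (f : mhom M N) x y : vsval f (x - y) = vsval f x - vsval f y.
Proof. exact: linearB. Qed.

Lemma mhomD M N (f : mhom M N) x y : vsval f (x + y) = vsval f x + vsval f y.
Proof. exact: linearD. Qed.

Lemma maddE M N (f g : mhom M N) m : vsval (f + g) m = vsval f m + vsval g m.
Proof. by have := mlinE 1 f g m; rewrite !scale1r. Qed.

Lemma mcmpBl M N P (f g : mhom M N) (h : mhom N P) :
  mcmp (f - g) h = mcmp f h - mcmp g h.
Proof. exact: (lin_sub (mcmp_linl h)). Qed.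
Lemma mcmpBr M N P (f : mhom M N) (g h : mhom N P) :
  mcmp f (g - h) = mcmp f g - mcmp f h.
Proof. exact: (lin_sub (mcmp_linr f)). Qed.
Lemma mcmpDl M N P (f g : mhom M N) (h : mhom N P) :
  mcmp (f + g) h = mcmp f h + mcmp g h.
Proof. by apply: mhomP => m; rewrite mcmpE !maddE !mcmpE linearD. Qed.
Lemma mcmpDr M N P (f : mhom M N) (g h : mhom N P) :
  mcmp f (g + h) = mcmp f g + mcmp f h.
Proof. by apply: mhomP => m; rewrite mcmpE !maddE !mcmpE. Qed.
Lemma mcmp0l M N P (h : mhom N P) : mcmp (0 : mhom M N) h = 0.
Proof. exact: mnull_cmpl. Qed.
Lemma mcmp0r M N P (h : mhom M N) : mcmp h (0 : mhom N P) = 0.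
Proof. exact: mnull_cmpr. Qed.

Lemma mono_modP M N (f : mhom M N) :
  (forall m, vsval f m = 0 -> m = 0) <-> mono_mod f.
Proof.
split=> [H | H m m0].
  by apply/eqP; rewrite -subv0; apply/subvP => m; rewrite memv_ker memv0 => /eqP/H ->.
by apply/eqP; rewrite -memv0 -H memv_ker m0.
Qed.

Lemma mono_cancel M N P (f g : mhom M N) (k : mhom N P) :
  mono_mod k -> mcmp f k = mcmp g k -> f = g.
Proof.
move=> /mono_modP ik e; apply/eqP; rewrite -subr_eq0; apply/eqP.
by apply: mhomP => m; rewrite mzeroE; apply: ik; rewrite -mcmpE mcmpBl e subrr mzeroE.
Qed.

Lemma epi_cancel M N P (f g : mhom N P) (k : mhom M N) :
  epi_mod k -> mcmp k f = mcmp k g -> f = g.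
Proof.
move=> sk e; apply: mhomP => n; have [m <-] := epi_mod_ex sk n.
by rewrite -!mcmpE e.
Qed.

Definition exact M N P (f : mhom M N) (g : mhom N P) : Prop :=
  forall n, vsval g n = 0 <-> exists m, vsval f m = n.

Lemma exactE M N P (f : mhom M N) (g : mhom N P) :
  limg (vsval f) = lker (vsval g) -> exact f g.
Proof.
move=> e n; have -> : vsval g n = 0 <-> n \in lker (vsval g) by rewrite memv_ker; split=> /eqP.
rewrite -e; split=> [/memv_imgP[m _ ->]|[m <-]]; first by exists m.
by rewrite memv_img ?memvf.
Qed.

Lemma exact0 M N P (f : mhom M N) (g : mhom N P) : exact f g -> mcmp f g = 0.
Proof.
by move=> e; apply: mhomP => m; rewrite mcmpE mzeroE; apply/e; exists m.
Qed.

Lemma exact_eq M N P (f : mhom M N) (g : mhom N P) :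
  exact f g -> limg (vsval f) = lker (vsval g).
Proof.
move=> e; apply/vspaceP => n; rewrite memv_ker; apply/memv_imgP/eqP.
  by case=> m _ ->; apply/e; exists m.
by move/e => [m <-]; exists m; rewrite ?memvf.
Qed.

Lemma mono_lift X N Y (k : mhom N Y) (f : mhom X Y) : mono_mod k ->
  (forall x, exists n, vsval k n = vsval f x) -> exists g : mhom X N, mcmp g k = f.
Proof.
move=> /mono_modP ik H; have [g gE] := lfun_lift H.
suff eg m b : g (ract m b) = ract (g m) b.
  by exists (mkhom eg); apply: mhomP => x; rewrite mcmpE /= gE.
by apply/eqP; rewrite -subr_eq0; apply/eqP/ik; rewrite linearB /= mhom_ract !gE
  mhom_ract subrr.
Qed.

Lemma epi_factor Y N X (c : mhom Y N) (f : mhom Y X) : epi_mod c ->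
  (forall y, vsval c y = 0 -> vsval f y = 0) -> exists g : mhom N X, mcmp c g = f.
Proof.
move=> /epi_mod_ex sc H; have [g gE] := lfun_factor H.
suff eg m b : g (ract m b) = ract (g m) b.
  by exists (mkhom eg); apply: mhomP => x; rewrite mcmpE /= gE.
by have [y <-] := sc m; rewrite -mhom_ract !gE mhom_ract.
Qed.

Lemma sub_inclE M (U : {vspace M}) (hU : stable U) u : vsval (sub_incl hU) u = vsval u.
Proof. exact: mklinE. Qed.

Lemma mono_sub_incl M (U : {vspace M}) (hU : stable U) : mono_mod (sub_incl hU).
Proof. by apply/mono_modP => m; rewrite sub_inclE => /eqP m0; apply/val_inj/eqP. Qed.

Lemma sub_incl_ex M (U : {vspace M}) (hU : stable U) m : m \in U ->
  exists u, vsval (sub_incl hU) u = m.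
Proof. by move=> mU; exists (Subvs mU); rewrite sub_inclE. Qed.

Lemma sub_incl_in M (U : {vspace M}) (hU : stable U) u : vsval (sub_incl hU) u \in U.
Proof. by rewrite sub_inclE subvsP. Qed.

Lemma quo_projE M (U : {vspace M}) (hU : stable U) m :
  (vsval (quo_proj hU) m = 0) <-> (m \in U).
Proof.
have -> : vsval (quo_proj hU) m = quo_fun U m by exact: mklinE.
by rewrite -quo_fun_eq0; split=> [->//|/eqP].
Qed.

Lemma epi_quo_proj M (U : {vspace M}) (hU : stable U) : epi_mod (quo_proj hU).
Proof.
apply: epi_modP => n; exists (vsval (n : subvs_of _)); rewrite [LHS]mklinE; exact: quo_funK.
Qed.

Lemma mono_ker_incl M N (f : mhom M N) : mono_mod (ker_incl f).
Proof. exact: mono_sub_incl. Qed.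
Lemma exact_ker_incl M N (f : mhom M N) : exact (ker_incl f) f.
Proof.
move=> n; split=> [n0|[m <-]].
  by apply: sub_incl_ex; rewrite memv_ker n0.
by apply/eqP; rewrite -memv_ker sub_incl_in.
Qed.
Lemma epi_cok_proj M N (f : mhom M N) : epi_mod (cok_proj f).
Proof. exact: epi_quo_proj. Qed.
Lemma exact_cok_proj M N (f : mhom M N) : exact f (cok_proj f).
Proof.
move=> n; rewrite quo_projE; split=> [/memv_imgP[m _ ->]|[m <-]]; first by exists m.
by rewrite memv_img ?memvf.
Qed.

Lemma image_fact M N (f : mhom M N) :
  exists (Y : rmod B) (p : mhom M Y) (i : mhom Y N),
    [/\ epi_mod p, mono_mod i & mcmp p i = f].
Proof.
exists (submod (@limg_stable _ _ _ _ f)).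
have [x|p e] := @mono_lift M _ _ (sub_incl (@limg_stable _ _ _ _ f)) f (mono_sub_incl _).
  by apply: sub_incl_ex; rewrite memv_img ?memvf.
exists p, (sub_incl (@limg_stable _ _ _ _ f)); split=> //; last exact: mono_sub_incl.
apply: epi_modP => y; have /memv_imgP[m _ ym] := subvsP y.
exists m; have := congr1 (fun h : mhom M N => vsval h m) e; rewrite mcmpE sub_inclE => em.
by apply: val_inj; apply: etrans em (esym ym).
Qed.

(** Projectivity speaks of epimorphisms only; [d] is replaced by its corestriction to its image,
    through which [f] factors. *)
Lemma proj_lift P Y Z (f : mhom P Y) (d : mhom Z Y) : projective_mod P ->
  (forall p, exists z, vsval d z = vsval f p) -> exists s : mhom P Z, mcmp s d = f.
Proof.
move=> hP H; have [W [p [i [sp ii e]]]] := image_fact d.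
have [x|f' ef] := mono_lift (f := f) ii.
  by have [z zE] := H x; exists (vsval p z); rewrite -mcmpE e.
by have [s es] := hP _ _ p f' sp; exists s; rewrite -e mcmpA es.
Qed.

Lemma inj_ext I Y Z (f : mhom Y I) (d : mhom Y Z) : injective_mod I ->
  (forall y, vsval d y = 0 -> vsval f y = 0) -> exists s : mhom Z I, mcmp d s = f.
Proof.
move=> hI H; have [W [p [i [sp ii e]]]] := image_fact d.
have [y y0|f' ef] := epi_factor (f := f) sp.
  by apply: H; rewrite -e mcmpE y0 linear0.
by have [s es] := hI _ _ i f' ii; exists s; rewrite -e -mcmpA es.
Qed.

Definition retract X Y : Prop :=
  exists (i : mhom X Y) (p : mhom Y X), mcmp i p = mid X.

Lemma retract_proj X Y : retract X Y -> projective_mod Y -> projective_mod X.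
Proof.
move=> [i [p e]] hY U V q g sq; have [h eh] := hY U V q (mcmp p g) sq.
by exists (mcmp i h); rewrite -mcmpA eh mcmpA e mcmp1m.
Qed.

Lemma retract_inj X Y : retract X Y -> injective_mod Y -> injective_mod X.
Proof.
move=> [i [p e]] hY U V q g sq; have [h eh] := hY U V q (mcmp g i) sq.
by exists (mcmp h p); rewrite mcmpA eh -mcmpA e mcmpm1.
Qed.

Definition mfst M N : mhom (dsum2 M N) M := mcopair (mid M) 0.
Definition msnd M N : mhom (dsum2 M N) N := mcopair 0 (mid N).
Lemma mfstE M N x : vsval (mfst M N) x = x.1.
Proof. by rewrite mcopairE midE mzeroE addr0. Qed.
Lemma msndE M N x : vsval (msnd M N) x = x.2.
Proof. by rewrite mcopairE midE mzeroE add0r. Qed.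

Lemma dsum2_id M N :
  mcmp (mfst M N) (minl M N) + mcmp (msnd M N) (minr M N) = mid (dsum2 M N).
Proof.
apply: mhomP => -[x y]; rewrite maddE !mcmpE minlE minrE mfstE msndE midE.
by congr pair; rewrite /= ?addr0 ?add0r.
Qed.

Lemma minl_fst M N : mcmp (minl M N) (mfst M N) = mid M.
Proof. by apply: mhomP => x; rewrite mcmpE mfstE minlE midE. Qed.
Lemma minl_snd M N : mcmp (minl M N) (msnd M N) = 0.
Proof. by apply: mhomP => x; rewrite mcmpE msndE minlE mzeroE. Qed.
Lemma minr_fst M N : mcmp (minr M N) (mfst M N) = 0.
Proof. by apply: mhomP => x; rewrite mcmpE mfstE minrE mzeroE. Qed.
Lemma minr_snd M N : mcmp (minr M N) (msnd M N) = mid N.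
Proof. by apply: mhomP => x; rewrite mcmpE msndE minrE midE. Qed.

Lemma dsum2_ext M N X (f g : mhom (dsum2 M N) X) :
  mcmp (minl M N) f = mcmp (minl M N) g -> mcmp (minr M N) f = mcmp (minr M N) g -> f = g.
Proof.
move=> el er; rewrite -[f]mcmp1m -[g]mcmp1m -dsum2_id !mcmpDl -!mcmpA.
by rewrite el er.
Qed.

Lemma minl_copair M N X (f : mhom M X) (g : mhom N X) : mcmp (minl M N) (mcopair f g) = f.
Proof. by apply: mhomP => x; rewrite mcmpE minlE mcopairE linear0 addr0. Qed.

Lemma minr_copair M N X (f : mhom M X) (g : mhom N X) : mcmp (minr M N) (mcopair f g) = g.
Proof. by apply: mhomP => x; rewrite mcmpE minrE mcopairE linear0 add0r. Qed.

Lemma bij_inv M N (f : mhom M N) : mono_mod f -> epi_mod f ->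
  exists g : mhom N M, mcmp f g = mid M /\ mcmp g f = mid N.
Proof.
move=> mf sf; have [x|g gE] := mono_lift (f := mid N) mf.
  by have [n <-] := epi_mod_ex sf x; exists n; rewrite midE.
by exists g; split=> //; apply: (mono_cancel mf); rewrite -mcmpA gE mcmpm1 mcmp1m.
Qed.

Lemma bij_isom M N (f : mhom M N) : mono_mod f -> epi_mod f -> isom M N.
Proof. by move=> mf sf; have [g gE] := bij_inv mf sf; exists f, g. Qed.

Lemma mono_dim M N (f : mhom M N) : mono_mod f -> (\dim {:M} <= \dim {:N})%N.
Proof. by move=> /mono_modP H; apply: lfun_inj_dim H. Qed.

Lemma mono_dim_epi M N (f : mhom M N) :
  mono_mod f -> (\dim {:N} <= \dim {:M})%N -> epi_mod f.
Proof.
move=> mf le; apply/eqP; rewrite eqEdim subvf /= (leq_trans le) //.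
by rewrite -(limg_ker_dim (vsval f) fullv) capfv mf dimv0 add0n.
Qed.

Lemma epi_endo_mono M (f : mhom M M) : epi_mod f -> mono_mod f.
Proof.
move=> sf; apply/eqP; rewrite -dimv_eq0; have := limg_ker_dim (vsval f) fullv.
by rewrite capfv sf -[X in _ = X]add0n => /addIn ->.
Qed.

End ModuleMaps.

(** * Projective covers and injective hulls *)

Section Covers.
Local Open Scope ring_scope.
Variables (K : fieldType) (B : falgType K).
Implicit Types M N P X Y Z : rmod B.

Fact act_hom_lin M (m : M) : linear (ract m : regmod B -> M).
Proof. exact: ract_linr. Qed.
Fact act_hom_act M (m : M) (x : regmod B) b : ract m (ract x b) = ract (ract m x) b.
Proof. exact: ractM. Qed.
Definition act_hom M (m : M) : mhom (regmod B) M := mk_mhom (act_hom_lin m) (act_hom_act m).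
Lemma act_homE M (m : M) x : vsval (act_hom m) x = ract m x.
Proof. exact: mk_mhomE. Qed.

Lemma projective_regmod : projective_mod (regmod B).
Proof.
move=> X Y p g sp; have [x xE] := epi_mod_ex sp (vsval g (1 : B)).
exists (act_hom x); apply: mhomP => b; rewrite mcmpE act_homE mhom_ract xE -mhom_ract.
by congr (vsval g _); rewrite /= mul1r.
Qed.

Fact coact_hom_lin0 M (xi : Kdual M) (m : M) : linear (fun b : B => dapp xi (ract m b) : K^o).
Proof. by move=> a b c; rewrite ract_linr; apply: dapp_linr. Qed.
Fact coact_hom_lin M (xi : Kdual M) :
  linear (fun m : M => mkdual (coact_hom_lin0 xi m) : dualB B).
Proof.
move=> a m n; apply: dualP => b; rewrite [RHS]dapp_linl !mkdualE ract_linl.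
exact: dapp_linr.
Qed.
Fact coact_hom_act M (xi : Kdual M) m b :
  mkdual (coact_hom_lin0 xi (ract m b)) = ract (mkdual (coact_hom_lin0 xi m) : dualB B) b.
Proof. by apply: dualP => c; rewrite dual_actE !mkdualE ractM. Qed.
(** The map attached to [xi] by the bijection [D M = Hom_B(M, D B)]. *)
Definition coact_hom M (xi : Kdual M) : mhom M (dualB B) :=
  mk_mhom (coact_hom_lin xi) (coact_hom_act xi).
Lemma coact_homE M (xi : Kdual M) m b : dapp (vsval (coact_hom xi) m) b = dapp xi (ract m b).
Proof. by rewrite mk_mhomE mkdualE. Qed.

(** Maps into [D B] correspond to functionals, by evaluation at 1, and functionals extend along
    injections. *)
Lemma injective_dualB : injective_mod (dualB B).
Proof.
move=> X Y i g /mono_modP ii.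
have lt : linear (fun x : X => dapp (vsval g x) 1 : K^o).
  by move=> a x y; rewrite linearP; apply: dapp_linl.
have [x x0|h hE] := lfun_factor (t := vsval i) (f := mkdual lt).
  by rewrite (ii x x0) linear0.
exists (coact_hom (h : Kdual Y)); apply: mhomP => x; apply: dualP => b.
rewrite mcmpE coact_homE -mhom_ract; apply: etrans (hE _) _.
by apply: etrans (mkdualE lt _) _; rewrite mhom_ract dual_actE mulr1.
Qed.

(** [Pr] is a parameter because the same cover serves twice: projectivity gives [enough_proj], an
    arbitrary property closed under sums gives [proj_ind]. *)
Lemma free_cover (Pr : rmod B -> Prop) : Pr (mod0 B) -> Pr (regmod B) ->
  (forall X Y, Pr X -> Pr Y -> Pr (dsum2 X Y)) ->
  forall M, exists P (p : mhom P M), Pr P /\ epi_mod p.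
Proof.
move=> H0 H1 H2 M.
have [P [p [hP pE]]] : exists P (p : mhom P M), Pr P /\
    forall m : M, m \in (vbasis {:M} : seq M) -> exists x, vsval p x = m.
  elim: (vbasis {:M} : seq M) => [|m s [P [p [hP pE]]]]; first by exists (mod0 B), 0.
  exists (dsum2 (regmod B) P), (mcopair (act_hom m) p); split; first exact: H2.
  move=> n; rewrite in_cons => /orP[/eqP->|/pE[x xE]].
    by exists ((1 : B), 0); rewrite mcopairE act_homE ract1 linear0 addr0.
  by exists (0, x); rewrite mcopairE linear0 add0r.
exists P, p; split=> //; apply/eqP; rewrite eqEsubv subvf /=.
rewrite -(span_basis (vbasisP {:M}%VS)); apply/span_subvP => m /pE[x <-].
by rewrite memv_img ?memvf.
Qed.

(** A projective is a retract of a finite sum of copies of [B]. *)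
Lemma proj_ind (Pr : rmod B -> Prop) : Pr (mod0 B) -> Pr (regmod B) ->
  (forall X Y, Pr X -> Pr Y -> Pr (dsum2 X Y)) ->
  (forall X Y, retract X Y -> Pr Y -> Pr X) ->
  forall P, projective_mod P -> Pr P.
Proof.
move=> H0 H1 H2 HR P hP; have [F [p [hF sp]]] := free_cover H0 H1 H2 P.
have [s sE] := hP _ _ p (mid P) sp.
by apply: HR hF; exists s, p.
Qed.

Lemma cofree_hull (Pr : rmod B -> Prop) : Pr (mod0 B) -> Pr (dualB B) ->
  (forall X Y, Pr X -> Pr Y -> Pr (dsum2 X Y)) ->
  forall M, exists I (i : mhom M I), Pr I /\ mono_mod i.
Proof.
move=> H0 H1 H2 M.
have [I [i [hI iE]]] : exists I (i : mhom M I), Pr I /\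
    forall m : M, vsval i m = 0 -> forall k, k \in enum 'I_(\dim {:M}) ->
      dapp (dcoord k) m = 0.
  elim: (enum _) => [|k s [I [i [hI iE]]]]; first by exists (mod0 B), 0.
  exists (dsum2 (dualB B) I), (mpair (coact_hom (dcoord k)) i); split; first exact: H2.
  move=> m; rewrite mpairE => -[e1 e2] l; rewrite in_cons => /orP[/eqP->|]; last exact: iE.
  have := coact_homE (dcoord k) m 1; rewrite ract1 => <-; rewrite e1.
  by rewrite /dapp lfunE.
exists I, i; split=> //; apply/mono_modP => m /iE H.
rewrite [m](coord_vbasis (memvf m)) big1 // => k _.
by rewrite -dcoordE H ?mem_enum // scale0r.
Qed.

Lemma inj_ind (Pr : rmod B -> Prop) : Pr (mod0 B) -> Pr (dualB B) ->
  (forall X Y, Pr X -> Pr Y -> Pr (dsum2 X Y)) ->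
  (forall X Y, retract X Y -> Pr Y -> Pr X) ->
  forall I, injective_mod I -> Pr I.
Proof.
move=> H0 H1 H2 HR I hI; have [F [i [hF mi]]] := cofree_hull H0 H1 H2 I.
have [s sE] := hI _ _ i (mid I) mi.
by apply: HR hF; exists i, s.
Qed.

Lemma enough_proj M : exists P (p : mhom P M), projective_mod P /\ epi_mod p.
Proof.
by apply: free_cover; [exact: projective_mod0|exact: projective_regmod|exact: projective_dsum2].
Qed.

Lemma enough_inj M : exists I (i : mhom M I), injective_mod I /\ mono_mod i.
Proof.
by apply: cofree_hull; [exact: injective_mod0|exact: injective_dualB|exact: injective_dsum2].
Qed.

Lemma nat_min (Pr : nat -> Prop) : (exists n, Pr n) ->
  exists2 n, Pr n & forall m, Pr m -> (n <= m)%N.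
Proof.
case=> n; have [k] := ubnP n; elim: k n => // k IH n nk hn.
have [[m [hm mn]]|H] := classic (exists m, Pr m /\ (m < n)%N).
  by apply: (IH m) => //; apply: leq_trans mn _.
by exists n => // m hm; rewrite leqNgt; apply/negP => mn; apply: H; exists m.
Qed.

Fixpoint miter M (h : mhom M M) (n : nat) : mhom M M :=
  if n is n'.+1 then mcmp h (miter h n') else mid M.

Lemma miterSr M (h : mhom M M) n : miter h n.+1 = mcmp (miter h n) h.
Proof.
elim: n => [|n IH] /=; first by rewrite mcmp1m mcmpm1.
by rewrite -mcmpA; congr mcmp.
Qed.

Lemma miterD M (h : mhom M M) m n : miter h (m + n) = mcmp (miter h m) (miter h n).
Proof. by elim: m => [|m IH] /=; rewrite ?mcmp1m // IH mcmpA. Qed.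

(** Among the positive powers of [h], one is taken whose image [Y] has least dimension. Its square
    has an image of the same dimension, so the power is bijective on [Y], and [Y] splits off from
    [M]. *)
Lemma fitting M (h : mhom M M) : exists n Y (p : mhom M Y) (i : mhom Y M),
  [/\ epi_mod p, mono_mod i, mcmp p i = miter h n.+1 & retract Y M].
Proof.
have [|d [n [Y [p [i [sp mi e dY]]]]] dmin] := @nat_min (fun d => exists n Y (p : mhom M Y)
    (i : mhom Y M), [/\ epi_mod p, mono_mod i, mcmp p i = miter h n.+1 & \dim {:Y} = d]).
  have [Y [p [i [sp mi e]]]] := image_fact (miter h 1).
  by exists (\dim {:Y}), 0%N, Y, p, i.
have [Y2 [q [j [sq mj e2]]]] := image_fact (mcmp i p).
have le : (d <= \dim {:Y2})%N.
  apply: dmin; exists (n + n.+1)%N, Y2, (mcmp p q), (mcmp j i); split=> //.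
  - apply: epi_modP => y; have [y1 <-] := epi_mod_ex sq y.
    by have [x <-] := epi_mod_ex sp y1; exists x; rewrite mcmpE.
  - by apply/mono_modP => y; rewrite mcmpE => /(mono_modP i).2-/(_ mi)/(mono_modP j).2 ->.
  - by rewrite -addSn miterD -e -!mcmpA; congr mcmp; rewrite !mcmpA e2.
have sj : epi_mod j by apply: mono_dim_epi => //; rewrite dY.
have sip : epi_mod (mcmp i p).
  apply: epi_modP => y; have [y2 <-] := epi_mod_ex sj y.
  by have [x <-] := epi_mod_ex sq y2; exists x; rewrite -e2 mcmpE.
have mip := epi_endo_mono sip.
have [f [g [_ gf]]] := bij_isom mip sip.
exists n, Y, p, i; split=> //.
have [x|r rE] := mono_lift (f := mid Y) mip.
  by have [y <-] := epi_mod_ex sip x; exists y; rewrite midE.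
exists i, (mcmp p r); rewrite mcmpA; apply: (mono_cancel mip).
by rewrite -!mcmpA mcmp1m; congr mcmp; rewrite -[RHS]mcmpm1; congr mcmp.
Qed.

(** [P] is chosen of least dimension. If [U + ker p = P], then [p] lifts to [U], which gives an
    endomorphism [h] of [P] with image in [U] and [mcmp h p = p]. By Fitting, the image of some
    power of [h] is a summand of [P] that still covers [M]; it is all of [P], hence so is [U]. *)
Lemma proj_cover M : exists P (p : mhom P M),
  [/\ projective_mod P, epi_mod p & ker_superfluous p].
Proof.
have [|d [P [p [hP sp dP]]] dmin] := @nat_min (fun d => exists P (p : mhom P M),
    [/\ projective_mod P, epi_mod p & \dim {:P} = d]).
  by have [P [p [hP sp]]] := enough_proj M; exists (\dim {:P}), P, p.
exists P, p; split=> // U hU eU.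
have sU : epi_mod (mcmp (sub_incl hU) p).
  apply: epi_modP => m; have [x <-] := epi_mod_ex sp m.
  have : x \in (U + lker (vsval p))%VS by rewrite eU memvf.
  case/memv_addP => u uU [k /eqP-/eqP]; rewrite memv_ker => /eqP k0 ->.
  by have [v vE] := sub_incl_ex hU uU; exists v; rewrite mcmpE vE linearD /= k0 addr0.
have [h' hE] := hP _ _ _ p sU.
pose h := mcmp h' (sub_incl hU).
have hp n : mcmp (miter h n) p = p.
  by elim: n => [|n IH] /=; rewrite ?mcmp1m // -mcmpA IH -mcmpA hE.
have [n [Y [q [i [sq mi e rY]]]]] := fitting h.
have si : epi_mod i.
  apply: mono_dim_epi => //; rewrite dP; apply: dmin; exists Y, (mcmp i p).
  split=> //; first exact: retract_proj rY hP.
  apply: epi_modP => m; have [x <-] := epi_mod_ex sp m.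
  by exists (vsval q x); rewrite -{2}(hp n.+1) -e !mcmpE.
apply/eqP; rewrite eqEsubv subvf /=; apply/subvP => x _.
have [y <-] := epi_mod_ex si x; have [z <-] := epi_mod_ex sq y.
by rewrite -mcmpE e miterSr mcmpE mcmpE sub_incl_in.
Qed.

(** Dual to [proj_cover]: if [U] meets the image of [M] in 0, then [M] embeds in [I / U], and
    extending [i] along this embedding gives an endomorphism of [I] that kills [U] and fixes [M]. A
    power of it is bijective, so [U = 0]. *)
Lemma inj_hull M : exists I (i : mhom M I),
  [/\ injective_mod I, mono_mod i & img_essential i].
Proof.
have [|d [I [i [hI mi dI]]] dmin] := @nat_min (fun d => exists I (i : mhom M I),
    [/\ injective_mod I, mono_mod i & \dim {:I} = d]).
  by have [I [i [hI mi]]] := enough_inj M; exists (\dim {:I}), I, i.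
exists I, i; split=> // U hU eU.
have mU : mono_mod (mcmp i (quo_proj hU)).
  apply/mono_modP => m; rewrite mcmpE => /quo_projE imU.
  have : vsval i m \in (U :&: limg (vsval i))%VS by rewrite memv_cap imU memv_img ?memvf.
  by rewrite eU memv0 => /eqP/(mono_modP i).2-/(_ mi).
have [h' hE] := hI _ _ _ i mU.
pose h := mcmp (quo_proj hU) h'.
have hi n : mcmp i (miter h n) = i.
  by elim: n => [|n IH] /=; rewrite ?mcmpm1 // mcmpA [mcmp i h]mcmpA hE IH.
have [n [Y [q [j [sq mj e rY]]]]] := fitting h.
have le : (\dim {:I} <= \dim {:Y})%N.
  rewrite dI; apply: dmin; exists Y, (mcmp i q).
  split=> //; first exact: retract_inj rY hI.
  apply/mono_modP => m; rewrite mcmpE => m0; apply: (mono_modP i).2 => //.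
  by rewrite -(hi n.+1) -e mcmpA mcmpE mcmpE m0 linear0.
have sj : epi_mod j.
  by apply: mono_dim_epi.
have sh : epi_mod (miter h n.+1).
  apply: epi_modP => x; have [y <-] := epi_mod_ex sj x.
  by have [z <-] := epi_mod_ex sq y; exists z; rewrite -e mcmpE.
apply/eqP; rewrite -subv0; apply/subvP => u uU; rewrite memv0; apply/eqP.
apply: (mono_modP (miter h n.+1)).2; first exact: epi_endo_mono.
by rewrite -[miter h n.+1]/(mcmp h (miter h n)) mcmpE mcmpE (iffRL (quo_projE hU u) uU) !linear0.
Qed.

End Covers.

(** * Nakayama functors *)

Section AdditiveFunctors.
Local Open Scope ring_scope.
Variables (K : fieldType) (B : falgType K).
Implicit Types M N P X Y Z : rmod B.

(** Additivity makes these endofunctors preserve retracts and finite sums, which reduces statements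
    on projectives and injectives to [B] and [D B]. *)
Record mfunctor := MFunctor {
  mfob :> rmod B -> rmod B;
  mfmap : forall M N, mhom M N -> mhom (mfob M) (mfob N);
  mfmap_id : forall M, mfmap (mid M) = mid (mfob M);
  mfmap_cmp : forall M N P (f : mhom M N) (g : mhom N P),
    mfmap (mcmp f g) = mcmp (mfmap f) (mfmap g);
  mfmapD : forall M N (f g : mhom M N), mfmap (f + g) = mfmap f + mfmap g
}.

Lemma mfmap0 (F : mfunctor) M N : mfmap F (0 : mhom M N) = 0.
Proof.
by apply: (addrI (mfmap F (0 : mhom M N))); rewrite -mfmapD !addr0.
Qed.

Lemma mf_retract (F : mfunctor) X Y : retract X Y -> retract (F X) (F Y).
Proof.
by move=> [i [p e]]; exists (mfmap F i), (mfmap F p); rewrite -mfmap_cmp e mfmap_id.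
Qed.

Lemma mf_dsum2 (F : mfunctor) X Y : retract (F (dsum2 X Y)) (dsum2 (F X) (F Y)).
Proof.
exists (mpair (mfmap F (mfst X Y)) (mfmap F (msnd X Y))).
exists (mcopair (mfmap F (minl X Y)) (mfmap F (minr X Y))).
apply: mhomP => z; rewrite mcmpE mcopairE mpairE /= -!mcmpE -!mfmap_cmp -maddE -mfmapD.
by rewrite dsum2_id mfmap_id.
Qed.

Definition idmf : mfunctor :=
  @MFunctor (fun M => M) (fun _ _ f => f) (fun _ => erefl) (fun _ _ _ _ _ => erefl)
    (fun _ _ _ _ => erefl).

Section Compose.
Variables F G : mfunctor.
Fact compmf_id M : mfmap G (mfmap F (mid M)) = mid (G (F M)).
Proof. by rewrite !mfmap_id. Qed.
Fact compmf_cmp M N P (f : mhom M N) (g : mhom N P) :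
  mfmap G (mfmap F (mcmp f g)) = mcmp (mfmap G (mfmap F f)) (mfmap G (mfmap F g)).
Proof. by rewrite !mfmap_cmp. Qed.
Fact compmfD M N (f g : mhom M N) :
  mfmap G (mfmap F (f + g)) = mfmap G (mfmap F f) + mfmap G (mfmap F g).
Proof. by rewrite !mfmapD. Qed.
Definition compmf : mfunctor :=
  @MFunctor (fun M => G (F M)) (fun _ _ f => mfmap G (mfmap F f))
    compmf_id compmf_cmp compmfD.
End Compose.

Section Transformation.
Variables (F G : mfunctor) (t : forall M, mhom (F M) (G M)).
Hypothesis tN : forall M N (f : mhom M N),
  mcmp (t M) (mfmap G f) = mcmp (mfmap F f) (t N).

Let tE M N (f : mhom M N) x :
  vsval (mfmap G f) (vsval (t M) x) = vsval (t N) (vsval (mfmap F f) x).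
Proof. by rewrite -!mcmpE tN. Qed.

Lemma bij_retract X Y : retract X Y ->
  mono_mod (t Y) /\ epi_mod (t Y) -> mono_mod (t X) /\ epi_mod (t X).
Proof.
move=> [i [p e]] [mY sY]; split.
  apply/mono_modP => x x0.
  have: vsval (mfmap F i) x = 0 by apply: (mono_modP (t Y)).2 => //; rewrite -tE x0 linear0.
  by move/(congr1 (vsval (mfmap F p))); rewrite -mcmpE -mfmap_cmp e mfmap_id midE linear0.
apply: epi_modP => x; have [y yE] := epi_mod_ex sY (vsval (mfmap G i) x).
by exists (vsval (mfmap F p) y); rewrite -tE yE -mcmpE -mfmap_cmp e mfmap_id midE.
Qed.

Lemma bij_dsum2 X Y : mono_mod (t X) /\ epi_mod (t X) -> mono_mod (t Y) /\ epi_mod (t Y) ->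
  mono_mod (t (dsum2 X Y)) /\ epi_mod (t (dsum2 X Y)).
Proof.
have dec (H : mfunctor) z : z = vsval (mfmap H (minl X Y)) (vsval (mfmap H (mfst X Y)) z)
    + vsval (mfmap H (minr X Y)) (vsval (mfmap H (msnd X Y)) z).
  by rewrite -!mcmpE -!mfmap_cmp -maddE -mfmapD dsum2_id mfmap_id midE.
move=> [mX sX] [mY sY]; split.
  apply/mono_modP => z z0; rewrite [z](dec F).
  have -> : vsval (mfmap F (mfst X Y)) z = 0.
    by apply: (mono_modP (t X)).2 => //; rewrite -tE z0 linear0.
  have -> : vsval (mfmap F (msnd X Y)) z = 0.
    by apply: (mono_modP (t Y)).2 => //; rewrite -tE z0 linear0.
  by rewrite !linear0 addr0.
apply: epi_modP => z; rewrite [z](dec G).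
have [x xE] := epi_mod_ex sX (vsval (mfmap G (mfst X Y)) z).
have [y yE] := epi_mod_ex sY (vsval (mfmap G (msnd X Y)) z).
exists (vsval (mfmap F (minl X Y)) x + vsval (mfmap F (minr X Y)) y).
by rewrite linearD /= -!tE xE yE.
Qed.
End Transformation.

Definition allzero X := forall x : X, x = 0.

Lemma allzero_inj X : allzero X -> injective_mod X.
Proof. by move=> X0 Y Z i g _; exists 0; apply: mhomP => y; rewrite (X0 (vsval g y)); apply: X0. Qed.
Lemma allzero_proj X : allzero X -> projective_mod X.
Proof. by move=> X0 Y Z i g _; exists 0; apply: mhomP => y; rewrite (X0 y) !linear0. Qed.
Lemma allzero_bij X Y (f : mhom X Y) : allzero X -> allzero Y -> mono_mod f /\ epi_mod f.
Proof.
move=> X0 Y0; split; first by apply/mono_modP => x _; apply: X0.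
by apply: epi_modP => y; exists 0; rewrite (Y0 y) linear0.
Qed.
End AdditiveFunctors.

Section NakayamaFunctors.
Local Open Scope ring_scope.
Variables (K : fieldType) (B : falgType K).
Implicit Types M N P X Y Z : rmod B.

Lemma nu_mapE M N (g : mhom M N) (phi : nu M) h :
  dapp (vsval (nu_map g) phi) h = dapp phi (mcmp g h).
Proof. by rewrite homE mklinE nu_funE. Qed.

Lemma nuV_mapE M N (g : mhom M N) (h : nuV M) : vsval (nuV_map g) h = mcmp h g.
Proof. by rewrite homE mklinE. Qed.

Fact nu_map_id M : nu_map (mid M) = mid (nu M).
Proof. by apply: mhomP => phi; apply: dualP => h; rewrite nu_mapE midE mcmp1m. Qed.
Fact nu_map_cmp M N P (f : mhom M N) (g : mhom N P) :
  nu_map (mcmp f g) = mcmp (nu_map f) (nu_map g).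
Proof.
by apply: mhomP => phi; apply: dualP => h; rewrite mcmpE !nu_mapE mcmpA.
Qed.
Fact nu_mapD M N (f g : mhom M N) : nu_map (f + g) = nu_map f + nu_map g.
Proof.
apply: mhomP => phi; apply: dualP => h; rewrite maddE nu_mapE.
have := @mcmp_linl K B _ _ _ h 1 f g; rewrite !scale1r => ->.
have := dapp_linr phi 1 (mcmp f h) (mcmp g h); rewrite scale1r mul1r => ->.
have := dapp_linl 1 (vsval (nu_map f) phi) (vsval (nu_map g) phi) h.
by rewrite scale1r mul1r => ->; rewrite !nu_mapE.
Qed.
Definition nuF : mfunctor B := MFunctor nu_map_id nu_map_cmp nu_mapD.

Fact nuV_map_id M : nuV_map (mid M) = mid (nuV M).
Proof. by apply: mhomP => h; rewrite nuV_mapE midE mcmpm1. Qed.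
Fact nuV_map_cmp M N P (f : mhom M N) (g : mhom N P) :
  nuV_map (mcmp f g) = mcmp (nuV_map f) (nuV_map g).
Proof. by apply: mhomP => h; rewrite mcmpE !nuV_mapE mcmpA. Qed.
Fact nuV_mapD M N (f g : mhom M N) : nuV_map (f + g) = nuV_map f + nuV_map g.
Proof.
apply: mhomP => h; rewrite maddE !nuV_mapE.
by have := mcmp_linr h 1 f g; rewrite !scale1r.
Qed.
Definition nuVF : mfunctor B := MFunctor nuV_map_id nuV_map_cmp nuV_mapD.

Section Eta.
Variable M : rmod B.

Fact unit_nu_lin0 (m : M) (phi : dualB B) :
  linear (fun h : mhom M (regmod B) => dapp phi (vsval h m) : K^o).
Proof. by move=> a h h'; rewrite mlinE; apply: dapp_linr. Qed.
Definition unit_nu0 (m : M) (phi : dualB B) : nu M := mkdual (unit_nu_lin0 m phi).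
Lemma unit_nu0E m phi h : dapp (unit_nu0 m phi) h = dapp phi (vsval h m).
Proof. exact: mkdualE. Qed.
Fact unit_nu_lin1 m : linear (unit_nu0 m).
Proof.
by move=> a phi psi; apply: dualP => h; rewrite [RHS]dapp_linl !unit_nu0E [LHS]dapp_linl.
Qed.
Fact unit_nu_act1 m (phi : dualB B) b : unit_nu0 m (ract phi b) = ract (unit_nu0 m phi) b.
Proof.
by apply: dualP => h; rewrite unit_nu0E nu_actE unit_nu0E dual_actE lmulhE.
Qed.
Definition unit_nu1 m : nuV (nu M) := mk_mhom (unit_nu_lin1 m) (unit_nu_act1 m).
Lemma unit_nu1E m phi h : dapp (vsval (unit_nu1 m) phi) h = dapp phi (vsval h m).
Proof. by rewrite mk_mhomE unit_nu0E. Qed.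
Fact unit_nu_lin2 : linear unit_nu1.
Proof.
move=> a m n; apply: mhomP => phi; rewrite mlinE; apply: dualP => h.
by rewrite [RHS]dapp_linl !unit_nu1E linearP; apply: dapp_linr.
Qed.
Fact unit_nu_act2 m b : unit_nu1 (ract m b) = ract (unit_nu1 m) b.
Proof.
apply: mhomP => phi; rewrite mcmpE; apply: dualP => h.
by rewrite !unit_nu1E dual_lmulE mhom_ract.
Qed.
(** Up to isomorphism [nu] is the tensor product with [D B], and [nuV] is [Hom_B(D B, -)]; this is
    the unit of their adjunction. *)
Definition unit_nu : mhom M (nuV (nu M)) := mk_mhom unit_nu_lin2 unit_nu_act2.
Lemma unit_nuE m phi h : dapp (vsval (vsval unit_nu m : nuV (nu M)) phi) h = dapp phi (vsval h m).
Proof. by rewrite mk_mhomE unit_nu1E. Qed.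
End Eta.

Lemma unit_nu_nat M N (f : mhom M N) : mcmp (unit_nu M) (nuV_map (nu_map f)) = mcmp f (unit_nu N).
Proof.
apply: mhomP => m; rewrite mcmpE [RHS]mcmpE [LHS]nuV_mapE.
apply: mhomP => phi; rewrite mcmpE.
by apply: dualP => h; rewrite nu_mapE !unit_nuE mcmpE.
Qed.

Lemma regmod_hom (h : mhom (regmod B) (regmod B)) :
  h = lmulh (vsval h (1 : B)) (mid (regmod B)).
Proof.
apply: mhomP => x; rewrite lmulhE midE; have := mhom_ract h (1 : B) x.
by rewrite /= mul1r.
Qed.

Lemma unit_nu_regmod : mono_mod (unit_nu (regmod B)) /\ epi_mod (unit_nu (regmod B)).
Proof.
split.
  apply/mono_modP => x x0; apply: (@dapp_sep K B) => phi.
  have := unit_nuE x phi (mid (regmod B)); rewrite midE => <-.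
  by rewrite x0 mzeroE dapp0l.
apply: epi_modP => H.
(* [H] is recovered from the functional that evaluates each [H phi] at the identity of [B]; by
   biduality it is an element [x] of [B]. *)
have L : linear (fun phi : Kdual B => dapp (vsval H phi) (mid (regmod B)) : K^o).
  by move=> a phi psi; rewrite linearP; apply: dapp_linl.
have [x xE] := bidualP L; exists x; apply: mhomP => phi; apply: dualP => h.
rewrite unit_nuE {2}[h]regmod_hom -nu_actE.
have -> : nu_act (vsval H phi) (vsval h (1 : B)) = vsval H (ract phi (vsval h (1 : B))).
  by rewrite mhom_ract.
rewrite xE dual_actE; congr dapp.
by rewrite {1}[h]regmod_hom lmulhE midE.
Qed.

Lemma unit_nu_bij P : projective_mod P -> mono_mod (unit_nu P) /\ epi_mod (unit_nu P).
Proof.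
pose G := compmf nuF nuVF.
have tN M N (f : mhom M N) : mcmp (unit_nu M) (mfmap G f) = mcmp (mfmap (idmf B) f) (unit_nu N).
  exact: unit_nu_nat.
apply: (proj_ind (Pr := fun P => mono_mod (unit_nu P) /\ epi_mod (unit_nu P))).
- apply: allzero_bij => [x|h]; first exact: mod0_eq.
  apply: mhomP => phi; rewrite mzeroE; apply: dualP => k.
  have -> : k = 0 by apply: mhomP => x; rewrite (mod0_eq x 0) !linear0.
  by rewrite !dapp0r.
- exact: unit_nu_regmod.
- exact: (bij_dsum2 (F := idmf B) (G := G) tN).
- exact: (bij_retract (F := idmf B) (G := G) tN).
Qed.

Lemma nu_inj P : projective_mod P -> injective_mod (nu P).
Proof.
apply: (proj_ind (Pr := fun P => injective_mod (nu P))).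
- apply: allzero_inj => phi; apply: dualP => h; rewrite dapp0l.
  have -> : h = 0 by apply: mhomP => x; rewrite (mod0_eq x 0) !linear0.
  by rewrite dapp0r.
- apply: (retract_inj (Y := dualB B)) (@injective_dualB K B).
  pose f (phi : nu (regmod B)) (c : B) : K^o := dapp phi (lmulh c (mid (regmod B))).
  have lf phi : linear (f phi).
    move=> a c d; rewrite /f; apply: etrans (dapp_linr phi a _ _); congr dapp.
    by apply: mhomP => m; rewrite mlinE !lmulhE mulrDl scalerAl.
  have lf2 : linear (fun phi => mkdual (lf phi) : dualB B).
    by move=> a phi psi; apply: dualP => c; rewrite [RHS]dapp_linl !mkdualE /f [LHS]dapp_linl.
  have ef phi b : mkdual (lf (ract phi b)) = ract (mkdual (lf phi) : dualB B) b.
    apply: dualP => c; rewrite dual_actE !mkdualE /f nu_actE; congr dapp.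
    by apply: mhomP => x; rewrite !lmulhE mulrA.
  (* [nu B] maps to [D B] by restriction to the left multiplications; a functional [phi] on [B]
     comes back as [h |-> phi (h 1)]. *)
  exists (mk_mhom lf2 ef), (vsval (unit_nu (regmod B)) (1 : B)).
  apply: mhomP => phi; rewrite mcmpE midE; apply: dualP => h.
  by rewrite unit_nuE mk_mhomE mkdualE /f -regmod_hom.
- move=> X Y hX hY; apply: retract_inj (mf_dsum2 nuF X Y) _.
  exact: (@injective_dsum2 K B (nu X) (nu Y)).
- by move=> X Y /(mf_retract nuF) r; apply: retract_inj r.
Qed.

Section Eps.
Variable I : rmod B.

Fact bev_lin (xi : Kdual I) (h : mhom (dualB B) I) :
  linear (fun phi : Kdual B => dapp xi (vsval h phi) : K^o).
Proof. by move=> a phi psi; rewrite linearP; apply: dapp_linr. Qed.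

(* The functional [xi \o h] on [D B], seen as an element of [B = D D B]. *)
Definition bev (xi : Kdual I) (h : mhom (dualB B) I) : B :=
  sval (constructive_indefinite_description _ (bidualP (bev_lin xi h))).
Lemma bevE xi h (phi : Kdual B) : dapp phi (bev xi h) = dapp xi (vsval h phi).
Proof. by rewrite /bev; case: constructive_indefinite_description => x /= ->. Qed.

Fact bev_lin1 xi : linear (bev xi : nuV I -> regmod B).
Proof.
move=> a h h'; apply: dapp_inj => phi.
by rewrite bevE mlinE dapp_linr [RHS]dapp_linr !bevE.
Qed.
Fact bev_act xi (h : nuV I) b : bev xi (ract h b) = ract (bev xi h : regmod B) b.
Proof.
apply: dapp_inj => phi; rewrite bevE mcmpE -bevE.
exact: (dual_lmulE b phi).
Qed.
Definition bevm xi : mhom (nuV I) (regmod B) := mk_mhom (bev_lin1 xi) (bev_act xi).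
Lemma bevmE xi h : vsval (bevm xi) h = bev xi h.
Proof. exact: mk_mhomE. Qed.

Fact counit_nu_lin0 (F : nu (nuV I)) : linear (fun xi : Kdual I => dapp F (bevm xi) : K^o).
Proof.
move=> a xi zeta; apply: etrans (dapp_linr F a _ _); congr dapp.
apply: mhomP => h; rewrite mlinE !bevmE; apply: dapp_inj => phi.
by rewrite [RHS]dapp_linr !bevE [LHS]dapp_linl.
Qed.
(** The counit of the same adjunction: [xi |-> F (bevm xi)] is a functional on [D I], hence an
    element of [I]. *)
Definition counit_nu0 (F : nu (nuV I)) : I :=
  sval (constructive_indefinite_description _ (bidualP (counit_nu_lin0 F))).
Lemma counit_nu0E F xi : dapp xi (counit_nu0 F) = dapp F (bevm xi).
Proof. by rewrite /counit_nu0; case: constructive_indefinite_description => x /= ->. Qed.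
End Eps.

Section Eps2.
Variable I : rmod B.
Fact counit_nu_lin : linear (@counit_nu0 I).
Proof.
by move=> a F G; apply: dapp_inj => xi; rewrite counit_nu0E dapp_linr !counit_nu0E [LHS]dapp_linl.
Qed.
Fact counit_nu_act F b : @counit_nu0 I (ract F b) = ract (counit_nu0 F) b.
Proof.
apply: dapp_inj => xi; rewrite counit_nu0E nu_actE.
have lx : linear (fun x : I => dapp xi (ract x b) : K^o).
  by move=> a x y; rewrite ract_linl; apply: dapp_linr.
rewrite -(mkdualE lx) counit_nu0E; congr dapp; apply: mhomP => h.
rewrite lmulhE !bevmE; apply: dapp_inj => phi; rewrite bevE mkdualE -mhom_ract -bevE.
by rewrite dual_actE.
Qed.
Definition counit_nu : mhom (nu (nuV I)) I := mk_mhom counit_nu_lin counit_nu_act.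
Lemma counit_nuE F xi : dapp xi (vsval counit_nu F) = dapp F (bevm xi).
Proof. by rewrite mk_mhomE counit_nu0E. Qed.
End Eps2.

Lemma counit_nu_nat M N (f : mhom M N) : mcmp (counit_nu M) f = mcmp (nu_map (nuV_map f)) (counit_nu N).
Proof.
apply: mhomP => F; rewrite !mcmpE; apply: dapp_inj => xi.
have lx : linear (fun x : M => dapp xi (vsval f x) : K^o).
  by move=> a x y; rewrite linearP; apply: dapp_linr.
rewrite [RHS]counit_nuE [RHS]nu_mapE -[LHS](mkdualE lx) [LHS]counit_nuE; congr dapp; apply: mhomP => h.
rewrite mcmpE !bevmE nuV_mapE; apply: dapp_inj => phi.
by rewrite !bevE mkdualE mcmpE.
Qed.

(** [b] represents the functional [phi |-> (h phi)(1)] on [D B]; right linearity then determines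
    [h]. *)
Lemma dualB_hom (h : mhom (dualB B) (dualB B)) : exists b, h = dual_lmul b.
Proof.
have L : linear (fun phi : Kdual B => dapp (vsval h phi : Kdual B) 1 : K^o).
  by move=> a phi psi; rewrite linearP; apply: dapp_linl.
have [b bE] := bidualP L; exists b; apply: mhomP => phi; apply: dualP => x.
rewrite dual_lmulE -[x in LHS]mulr1 -dual_actE.
have -> : dual_act (vsval h phi) x = vsval h (ract phi x) by rewrite mhom_ract.
by rewrite bE dual_actE.
Qed.

Lemma counit_nu_dualB : mono_mod (counit_nu (dualB B)) /\ epi_mod (counit_nu (dualB B)).
Proof.
pose id1 : nuV (dualB B) := mid (dualB B).
have lev c : linear (fun phi : dualB B => dapp phi c : K^o) by move=> a p q; apply: dapp_linl.
split.
  apply/mono_modP => F F0; apply: dualP => h; rewrite dapp0l.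
  have -> : h = bevm (mkdual (lev (vsval h id1))); last by rewrite -counit_nuE F0 dapp0r.
  apply: mhomP => k; rewrite bevmE; apply: dapp_inj => phi.
  rewrite bevE mkdualE; have [b ->] := dualB_hom k.
  rewrite dual_lmulE.
  have -> : dual_lmul b = ract id1 b by rewrite /= /nuV_act mcmpm1.
  by rewrite mhom_ract.
apply: epi_modP => x.
have lx : linear (fun h : mhom (nuV (dualB B)) (regmod B) => dapp (x : Kdual B) (vsval h id1) : K^o).
  by move=> a h k; rewrite mlinE; apply: dapp_linr.
exists (mkdual lx); apply: dapp_inj => xi; rewrite counit_nuE mkdualE bevmE bevE.
by rewrite midE.
Qed.

Lemma counit_nu_bij I : injective_mod I -> mono_mod (counit_nu I) /\ epi_mod (counit_nu I).
Proof.
pose F := compmf nuVF nuF.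
have tN M N (f : mhom M N) : mcmp (counit_nu M) (mfmap (idmf B) f) = mcmp (mfmap F f) (counit_nu N).
  exact: counit_nu_nat.
apply: (inj_ind (Pr := fun P => mono_mod (counit_nu P) /\ epi_mod (counit_nu P))).
- apply: allzero_bij => [phi|x]; last exact: mod0_eq.
  apply: dualP => k; rewrite dapp0l.
  suff -> : k = 0 by rewrite dapp0r.
  apply: mhomP => h; suff -> : h = 0 by rewrite !linear0.
  by apply: mhomP => x; apply: mod0_eq.
- exact: counit_nu_dualB.
- exact: (bij_dsum2 (F := F) (G := idmf B) tN).
- exact: (bij_retract (F := F) (G := idmf B) tN).
Qed.

Lemma nuV_proj (I : rmod B) : injective_mod I -> projective_mod (nuV I).
Proof.
apply: (inj_ind (Pr := fun P : rmod B => projective_mod (nuV P))).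
- by apply: allzero_proj => h; apply: mhomP => x; apply: mod0_eq.
- apply: (retract_proj (Y := regmod B)) (@projective_regmod K B).
  have lev c : linear (fun phi : dualB B => dapp phi c : K^o) by move=> a p q; apply: dapp_linl.
  exists (bevm (mkdual (lev (1 : B)))), (act_hom (mid (dualB B) : nuV (dualB B))).
  apply: mhomP => h; rewrite mcmpE act_homE midE bevmE.
  apply: mhomP => phi; rewrite mcmpE midE; apply: dualP => x; rewrite dual_lmulE.
  have [b ->] := dualB_hom h; rewrite dual_lmulE; congr (dapp _ (_ * _)).
  by apply: dapp_inj => psi; rewrite bevE mkdualE dual_lmulE mul1r.
- move=> X Y hX hY; apply: retract_proj (mf_dsum2 nuVF X Y) _.
  exact: (@projective_dsum2 K B (nuV X) (nuV Y)).
- by move=> X Y /(mf_retract nuVF) r; apply: retract_proj r.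
Qed.

End NakayamaFunctors.

(** * Auslander-Reiten translations *)

Section Translation.
Local Open Scope ring_scope.
Variables (K : fieldType) (B : falgType K).
Implicit Types M N P X Y Z : rmod B.

Lemma nu_map_linear M N a (f g : mhom M N) :
  nu_map (a *: f + g) = a *: nu_map f + nu_map g.
Proof.
apply: mhomP => phi; rewrite mlinE; apply: dualP => h.
rewrite [RHS]dapp_linl !nu_mapE -dapp_linr; congr dapp.
exact: (mcmp_linl h).
Qed.

Lemma nuV_map_linear M N a (f g : mhom M N) :
  nuV_map (a *: f + g) = a *: nuV_map f + nuV_map g.
Proof.
apply: mhomP => h; rewrite mlinE !nuV_mapE; exact: mcmp_linr.
Qed.

Lemma nu_map0 M N : nu_map (0 : mhom M N) = 0.
Proof. exact: (mfmap0 (nuF B)). Qed.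
Lemma nuV_map0 M N : nuV_map (0 : mhom M N) = 0.
Proof. exact: (mfmap0 (nuVF B)). Qed.

(* A projective presentation [td_d] of [M], not necessarily minimal, together
   with a kernel [N] of its image under the Nakayama functor. *)
Record tau_data M N := TauData {
  td1 : rmod B;
  td0 : rmod B;
  td_d : mhom td1 td0;
  td_aug : mhom td0 M;
  td_k : mhom N (nu td1);
  td_proj1 : projective_mod td1;
  td_proj0 : projective_mod td0;
  td_epi : epi_mod td_aug;
  td_exact : exact td_d td_aug;
  td_mono : mono_mod td_k;
  td_exact_nu : exact td_k (nu_map td_d)
}.

Arguments td_proj1 {M N} t.
Arguments td_proj0 {M N} t.
Arguments td_exact {M N} t.
Arguments td_exact_nu {M N} t.

(** [h] is induced by some lift of [g]. As a relation this respects identities, composition and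
    linear combinations strictly; only the uniqueness of [h] requires working modulo injectives. *)
Definition tau_rel M N M' N' (p : tau_data M N) (q : tau_data M' N')
    (g : mhom M M') (h : mhom N N') : Prop :=
  exists (g0 : mhom (td0 p) (td0 q)) (g1 : mhom (td1 p) (td1 q)),
    [/\ mcmp (td_aug p) g = mcmp g0 (td_aug q),
        mcmp (td_d p) g0 = mcmp g1 (td_d q)
      & mcmp h (td_k q) = mcmp (td_k p) (nu_map g1)].

(** Dual to [tau_data], with the copresented module as first argument: [tau_data M N] and
    [tauV_data N M] describe the same situation, up to projective and injective summands. *)
Record tauV_data N M := TauVData {
  vd0 : rmod B;
  vd1 : rmod B;
  vd_i : mhom N vd0;
  vd_d : mhom vd0 vd1;
  vd_c : mhom (nuV vd1) M;
  vd_inj0 : injective_mod vd0;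
  vd_inj1 : injective_mod vd1;
  vd_mono : mono_mod vd_i;
  vd_exact : exact vd_i vd_d;
  vd_epi : epi_mod vd_c;
  vd_exact_nuV : exact (nuV_map vd_d) vd_c
}.

Arguments vd_inj0 {N M} t.
Arguments vd_inj1 {N M} t.
Arguments vd_exact {N M} t.
Arguments vd_exact_nuV {N M} t.

Definition tauV_rel N M N' M' (p : tauV_data N M) (q : tauV_data N' M')
    (h : mhom N N') (g : mhom M M') : Prop :=
  exists (k0 : mhom (vd0 p) (vd0 q)) (k1 : mhom (vd1 p) (vd1 q)),
    [/\ mcmp (vd_i p) k0 = mcmp h (vd_i q),
        mcmp (vd_d p) k1 = mcmp k0 (vd_d q)
      & mcmp (vd_c p) g = mcmp (nuV_map k1) (vd_c q)].

Lemma tau_rel_id M N (p : tau_data M N) : tau_rel p p (mid M) (mid N).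
Proof.
by exists (mid _), (mid _); split; rewrite ?nu_map_id !(mcmp1m, mcmpm1).
Qed.

Lemma tauV_rel_id N M (p : tauV_data N M) : tauV_rel p p (mid N) (mid M).
Proof.
by exists (mid _), (mid _); split; rewrite ?nuV_map_id !(mcmp1m, mcmpm1).
Qed.

Lemma tau_rel_cmp M N M' N' M2 N2 (p : tau_data M N) (q : tau_data M' N')
  (r : tau_data M2 N2) g h g' h' :
  tau_rel p q g h -> tau_rel q r g' h' -> tau_rel p r (mcmp g g') (mcmp h h').
Proof.
move=> [g0 [g1 [e1 e2 e3]]] [f0 [f1 [d1 d2 d3]]].
exists (mcmp g0 f0), (mcmp g1 f1); split.
- by rewrite mcmpA e1 -mcmpA d1 mcmpA.
- by rewrite mcmpA e2 -mcmpA d2 mcmpA.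
- by rewrite -mcmpA d3 mcmpA e3 -mcmpA nu_map_cmp.
Qed.

Lemma tauV_rel_cmp N M N' M' N2 M2 (p : tauV_data N M) (q : tauV_data N' M')
  (r : tauV_data N2 M2) g h g' h' :
  tauV_rel p q g h -> tauV_rel q r g' h' -> tauV_rel p r (mcmp g g') (mcmp h h').
Proof.
move=> [g0 [g1 [e1 e2 e3]]] [f0 [f1 [d1 d2 d3]]].
exists (mcmp g0 f0), (mcmp g1 f1); split.
- by rewrite mcmpA e1 -mcmpA d1 mcmpA.
- by rewrite mcmpA e2 -mcmpA d2 mcmpA.
- by rewrite mcmpA e3 -mcmpA d3 mcmpA nuV_map_cmp.
Qed.

Lemma tau_rel_lin M N M' N' (p : tau_data M N) (q : tau_data M' N') a g h g' h' :
  tau_rel p q g h -> tau_rel p q g' h' -> tau_rel p q (a *: g + g') (a *: h + h').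
Proof.
move=> [g0 [g1 [e1 e2 e3]]] [f0 [f1 [d1 d2 d3]]].
exists (a *: g0 + f0), (a *: g1 + f1); split.
- by rewrite mcmp_linr mcmp_linl e1 d1.
- by rewrite mcmp_linr mcmp_linl e2 d2.
- by rewrite nu_map_linear mcmp_linr mcmp_linl e3 d3.
Qed.

Lemma tauV_rel_lin N M N' M' (p : tauV_data N M) (q : tauV_data N' M') a g h g' h' :
  tauV_rel p q g h -> tauV_rel p q g' h' -> tauV_rel p q (a *: g + g') (a *: h + h').
Proof.
move=> [g0 [g1 [e1 e2 e3]]] [f0 [f1 [d1 d2 d3]]].
exists (a *: g0 + f0), (a *: g1 + f1); split.
- by rewrite mcmp_linr mcmp_linl e1 d1.
- by rewrite mcmp_linr mcmp_linl e2 d2.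
- by rewrite nuV_map_linear mcmp_linr mcmp_linl e3 d3.
Qed.

Lemma tau_rel_ex M N M' N' (p : tau_data M N) (q : tau_data M' N') g :
  exists h, tau_rel p q g h.
Proof.
have [g0 e0] := td_proj0 p _ _ _ (mcmp (td_aug p) g) (td_epi q).
have [x|g1 e1] := proj_lift (f := mcmp (td_d p) g0) (d := td_d q) (td_proj1 p).
  apply/(td_exact q); rewrite -mcmpE -mcmpA e0 mcmpA (exact0 (td_exact p)).
  by rewrite mcmp0l mzeroE.
have [x|h e2] := mono_lift (f := mcmp (td_k p) (nu_map g1)) (td_mono q).
  apply/(td_exact_nu q); rewrite -mcmpE -mcmpA -nu_map_cmp e1 nu_map_cmp mcmpA.
  by rewrite (exact0 (td_exact_nu p)) mcmp0l mzeroE.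
by exists h, g0, g1.
Qed.

Lemma tauV_rel_ex N M N' M' (p : tauV_data N M) (q : tauV_data N' M') h :
  exists g, tauV_rel p q h g.
Proof.
have [k0 e0] := vd_inj0 q _ _ _ (mcmp h (vd_i q)) (vd_mono p).
have [x x0|k1 e1] := inj_ext (f := mcmp k0 (vd_d q)) (d := vd_d p) (vd_inj1 q).
  have [y <-] := (vd_exact p x).1 x0.
  by rewrite -mcmpE mcmpA e0 -mcmpA (exact0 (vd_exact q)) mcmp0r mzeroE.
have [x x0|g e2] := epi_factor (f := mcmp (nuV_map k1) (vd_c q)) (vd_epi p).
  have [y <-] := (vd_exact_nuV p x).1 x0.
  rewrite -mcmpE mcmpA -nuV_map_cmp e1 nuV_map_cmp -mcmpA.
  by rewrite (exact0 (vd_exact_nuV q)) mcmp0r mzeroE.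
by exists g, k0, k1.
Qed.

(* A map that factors through a projective has lifts differing from
   (aug u v0, 0) by a chain homotopy [s] and a map [r] into the kernel of the
   presentation; only [r] contributes to the map of kernels. *)
Lemma tau_rel_null M N M' N' (p : tau_data M N) (q : tau_data M' N') g h :
  tau_rel p q g h -> factors (@projective_mod K B) g -> factors (@injective_mod K B) h.
Proof.
move=> [g0 [g1 [e1 e2 e3]]] [X [hX [u [v e]]]].
have [v0 ev] := hX _ _ _ v (td_epi q).
have [x|s es] := proj_lift (f := g0 - mcmp (td_aug p) (mcmp u v0)) (d := td_d q) (td_proj0 p).
  apply/(td_exact q); rewrite -mcmpE mcmpBl -!mcmpA ev -e e1 subrr.
  exact: mzeroE.
pose r := g1 - mcmp (td_d p) s.
have rd : mcmp r (td_d q) = 0.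
  rewrite mcmpBl -(mcmpA _ s) es mcmpBr e2 (mcmpA _ _ (mcmp u v0)).
  by rewrite (exact0 (td_exact p)) mcmp0l subr0 subrr.
have [x|r' er] := mono_lift (f := nu_map r) (td_mono q).
  by apply/(td_exact_nu q); rewrite -mcmpE -nu_map_cmp rd nu_map0 mzeroE.
exists (nu (td1 p)); split; first exact/nu_inj/td_proj1.
exists (td_k p), r'; apply: (mono_cancel (td_mono q)).
rewrite e3 -mcmpA er.
have -> : g1 = r + mcmp (td_d p) s by rewrite subrK.
rewrite nu_mapD nu_map_cmp.
by rewrite mcmpDr mcmpA (exact0 (td_exact_nu p)) mcmp0l addr0.
Qed.

Lemma tauV_rel_null N M N' M' (p : tauV_data N M) (q : tauV_data N' M') h g :
  tauV_rel p q h g -> factors (@injective_mod K B) h -> factors (@projective_mod K B) g.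
Proof.
move=> [k0 [k1 [e1 e2 e3]]] [J [hJ [u [v e]]]].
have [u0 eu] := hJ _ _ _ u (vd_mono p).
have [x x0|s es] := inj_ext (f := k0 - mcmp u0 (mcmp v (vd_i q))) (d := vd_d p) (vd_inj0 q).
  have [y <-] := (vd_exact p x).1 x0.
  by rewrite -mcmpE mcmpBr !mcmpA eu -e e1 subrr mzeroE.
pose r := k1 - mcmp s (vd_d q).
have rd : mcmp (vd_d p) r = 0.
  rewrite mcmpBr (mcmpA _ s) es mcmpBl e2 -(mcmpA u0) -(mcmpA v).
  by rewrite (exact0 (vd_exact q)) !mcmp0r subr0 subrr.
have [x x0|r' er] := epi_factor (f := nuV_map r) (vd_epi p).
  have [y <-] := (vd_exact_nuV p x).1 x0.
  by rewrite -mcmpE -nuV_map_cmp rd nuV_map0 mzeroE.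
exists (nuV (vd1 q)); split; first exact/nuV_proj/vd_inj1.
exists r', (vd_c q); apply: (epi_cancel (vd_epi p)).
rewrite e3 mcmpA er.
have -> : k1 = r + mcmp s (vd_d q) by rewrite subrK.
rewrite nuV_mapD nuV_map_cmp.
by rewrite mcmpDl -(mcmpA (nuV_map s)) (exact0 (vd_exact_nuV q)) mcmp0r addr0.
Qed.

Lemma tau_rel_unique M N M' N' (p : tau_data M N) (q : tau_data M' N') g h g' h' :
  tau_rel p q g h -> tau_rel p q g' h' ->
  heq (g : Defs.hom (M : stmod B) (M' : stmod B)) g' ->
  heq (h : Defs.hom (N : costmod B) (N' : costmod B)) h'.
Proof.
move=> r r' e; have := tau_rel_lin (-1) r' r.
by rewrite !scaleN1r (addrC (- g')) (addrC (- h')) => /tau_rel_null; apply.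
Qed.

Lemma tauV_rel_unique N M N' M' (p : tauV_data N M) (q : tauV_data N' M') h g h' g' :
  tauV_rel p q h g -> tauV_rel p q h' g' ->
  heq (h : Defs.hom (N : costmod B) (N' : costmod B)) h' ->
  heq (g : Defs.hom (M : stmod B) (M' : stmod B)) g'.
Proof.
move=> r r' e; have := tauV_rel_lin (-1) r' r.
by rewrite !scaleN1r (addrC (- g')) (addrC (- h')) => /tauV_rel_null; apply.
Qed.

Definition unit_nu_inv P (hP : projective_mod P) :
  {f : mhom (nuV (nu P)) P | mcmp (unit_nu P) f = mid P /\ mcmp f (unit_nu P) = mid (nuV (nu P))}.
Proof.
apply: constructive_indefinite_description.
by have [m s] := unit_nu_bij hP; apply: bij_inv.
Qed.

Definition counit_nu_inv (I : rmod B) (hI : injective_mod I) :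
  {f : mhom I (nu (nuV I)) | mcmp (counit_nu I) f = mid (nu (nuV I)) /\ mcmp f (counit_nu I) = mid I}.
Proof.
apply: constructive_indefinite_description.
by have [m s] := counit_nu_bij hI; apply: bij_inv.
Qed.

Section ToV.
Variables (M N : rmod B) (p : tau_data M N).
Let e := unit_nu_inv (td_proj0 p).
Let c := mcmp (sval e) (td_aug p).

Fact toV_epi : epi_mod c.
Proof.
apply: epi_modP => m; have [x <-] := epi_mod_ex (td_epi p) m.
by exists (vsval (unit_nu _) x); rewrite /c mcmpE -(mcmpE (unit_nu _) (sval e)) (svalP e).1 midE.
Qed.
Fact toV_exact : exact (nuV_map (nu_map (td_d p))) c.
Proof.
have [e1 e2] := svalP e.
move=> x; split=> [x0|[y <-]].
  have [y yE] := (td_exact p (vsval (sval e) x)).1 (etrans (esym (mcmpE _ _ _)) x0).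
  exists (vsval (unit_nu _) y); rewrite -mcmpE unit_nu_nat mcmpE yE -mcmpE e2.
  exact: midE.
have [z <-] := epi_mod_ex (unit_nu_bij (td_proj1 p)).2 y.
rewrite -mcmpE -mcmpE mcmpA unit_nu_nat /c -mcmpA (mcmpA _ (sval e)) e1 mcmp1m.
by rewrite (exact0 (td_exact p)) mzeroE.
Qed.

Definition to_tauV : tauV_data N M :=
  TauVData (nu_inj (td_proj1 p)) (nu_inj (td_proj0 p)) (td_mono p) (td_exact_nu p)
    toV_epi toV_exact.
End ToV.

Lemma to_tauV_rel M N M' N' (p : tau_data M N) (q : tau_data M' N') g h :
  tau_rel p q g h -> tauV_rel (to_tauV p) (to_tauV q) h g.
Proof.
move=> [g0 [g1 [e1 e2 e3]]]; exists (nu_map g1), (nu_map g0); split=> //=.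
  by rewrite -!nu_map_cmp e2.
rewrite -mcmpA e1 !mcmpA; congr mcmp.
case: (unit_nu_inv (td_proj0 p)) => f [f1 f2]; case: (unit_nu_inv (td_proj0 q)) => f' [f1' f2'] /=.
apply: (epi_cancel (unit_nu_bij (td_proj0 p)).2).
by rewrite !mcmpA f1 mcmp1m unit_nu_nat -mcmpA f1' mcmpm1.
Qed.

Section FromV.
Variables (N M : rmod B) (p : tauV_data N M).
Let e := counit_nu_inv (vd_inj0 p).
Let k := mcmp (vd_i p) (sval e).

Fact fromV_mono : mono_mod k.
Proof.
have [e1 e2] := svalP e.
apply/mono_modP => m; rewrite mcmpE => /(congr1 (vsval (counit_nu _))).
by rewrite -mcmpE e2 midE linear0 => /(mono_modP _).2-/(_ (vd_mono p)).
Qed.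
Fact fromV_exact : exact k (nu_map (nuV_map (vd_d p))).
Proof.
have [e1 e2] := svalP e.
move=> x; split=> [x0|[y <-]].
  have [|y yE] := (vd_exact p (vsval (counit_nu _) x)).1.
    have E := congr1 (fun f : mhom (nu (nuV (vd0 p))) (vd1 p) => vsval f x) (counit_nu_nat (vd_d p)).
    rewrite mcmpE in E; apply: etrans E _; rewrite mcmpE.
    apply: etrans (congr1 (fun z : nu (nuV (vd1 p)) => vsval (counit_nu (vd1 p)) z) x0) _.
    exact: linear0.
  by exists y; rewrite mcmpE yE -mcmpE e1 midE.
apply: (mono_modP (counit_nu _)).2; first exact: (counit_nu_bij (vd_inj1 p)).1.
rewrite -mcmpE -mcmpE -counit_nu_nat /k -mcmpA (mcmpA (sval e)) e2 mcmp1m.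
by rewrite (exact0 (vd_exact p)) mzeroE.
Qed.

Definition of_tauV : tau_data M N :=
  TauData (nuV_proj (vd_inj0 p)) (nuV_proj (vd_inj1 p)) (vd_epi p) (vd_exact_nuV p)
    fromV_mono fromV_exact.
End FromV.

Lemma of_tauV_rel N M N' M' (p : tauV_data N M) (q : tauV_data N' M') h g :
  tauV_rel p q h g -> tau_rel (of_tauV p) (of_tauV q) g h.
Proof.
move=> [k0 [k1 [e1 e2 e3]]]; exists (nuV_map k1), (nuV_map k0); split=> //=.
  by rewrite -!nuV_map_cmp e2.
rewrite mcmpA -e1 -!mcmpA; congr mcmp.
case: (counit_nu_inv (vd_inj0 p)) => f [f1 f2]; case: (counit_nu_inv (vd_inj0 q)) => f' [f1' f2'] /=.
apply: (mono_cancel (counit_nu_bij (vd_inj0 q)).1).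
by rewrite -!mcmpA f2' mcmpm1 -counit_nu_nat mcmpA f2 mcmp1m.
Qed.

End Translation.

Arguments td_proj1 {K B M N} t.
Arguments td_proj0 {K B M N} t.
Arguments td_exact {K B M N} t.
Arguments td_exact_nu {K B M N} t.
Arguments vd_inj0 {K B N M} t.
Arguments vd_inj1 {K B N M} t.
Arguments vd_exact {K B N M} t.
Arguments vd_exact_nuV {K B N M} t.

(** * Natural isomorphisms and equivalences modulo ideals *)

Section Equivalences.
Local Open Scope ring_scope.
Variable K : fieldType.

Lemma heq_sym (C : kcat K) (x y : C) (f g : Defs.hom x y) : heq f g -> heq g f.
Proof.
rewrite /heq => e; have := null_lin (-1) e (null0 x y).
by rewrite scaleN1r addr0 opprB.
Qed.

Lemma heq_cmp (C : kcat K) (x y z : C) (f f' : Defs.hom x y) (g g' : Defs.hom y z) :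
  heq f f' -> heq g g' -> heq (cmp f g) (cmp f' g').
Proof.
move=> ef eg; apply: (heq_trans (g := cmp f' g)); rewrite /heq.
  by rewrite -cmpBl; apply: null_cmpl.
by rewrite -cmpBr; apply: null_cmpr.
Qed.

Lemma heq_cmpl (C : kcat K) (x y z : C) (f : Defs.hom x y) (g g' : Defs.hom y z) :
  heq g g' -> heq (cmp f g) (cmp f g').
Proof. by move=> e; apply: heq_cmp e; apply: heq_refl. Qed.

Lemma heq_cmpr (C : kcat K) (x y z : C) (f f' : Defs.hom x y) (g : Defs.hom y z) :
  heq f f' -> heq (cmp f g) (cmp f' g).
Proof. by move=> e; apply: heq_cmp e _; apply: heq_refl. Qed.

Section NatIso.
Variables C D : kcat K.

Lemma nat_iso_sym (F0 G0 : C -> D) (F : functor F0) (G : functor G0) :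
  nat_iso F G -> nat_iso G F.
Proof.
move=> [u [v [uv nat]]]; exists v, u; split=> [x | x y f].
  by have [] := uv x.
have [_ vu] := uv x; have [uvy _] := uv y.
have e1 : heq (fmap G f) (cmp (v x) (cmp (u x) (fmap G f))).
  by rewrite cmpA -{1}[fmap G f]cmp1m; apply/heq_cmpr/heq_sym.
apply: heq_trans (heq_cmpr _ e1) _.
apply: heq_trans (heq_cmpr _ (heq_cmpl _ (heq_sym (nat _ _ f)))) _.
by rewrite -!cmpA; apply: heq_cmpl; rewrite -{2}[fmap F f]cmpm1; apply: heq_cmpl.
Qed.

Lemma nat_iso_trans (F0 G0 H0 : C -> D) (F : functor F0) (G : functor G0) (H : functor H0) :
  nat_iso F G -> nat_iso G H -> nat_iso F H.
Proof.
move=> [u [v [uv nat]]] [u' [v' [uv' nat']]].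
exists (fun x => cmp (u x) (u' x)), (fun x => cmp (v' x) (v x)); split=> [x | x y f].
  have [e1 e2] := uv x; have [e1' e2'] := uv' x; split.
    apply: heq_trans e1; rewrite -cmpA; apply: heq_cmpl; rewrite cmpA -{2}[v x]cmp1m.
    exact: heq_cmpr.
  apply: heq_trans e2'; rewrite -cmpA; apply: heq_cmpl; rewrite cmpA -{2}[u' x]cmp1m.
  exact: heq_cmpr.
apply: (heq_trans (g := cmp (cmp (u x) (fmap G f)) (u' y))).
  by rewrite cmpA; apply/heq_cmpr/nat.
by rewrite -!cmpA; apply/heq_cmpl/nat'.
Qed.
End NatIso.

Lemma nat_iso_post (C D E : kcat K) (F0 F0' : C -> D) (G0 : D -> E) (F : functor F0)
  (F' : functor F0') (G : functor G0) :
  nat_iso F F' -> nat_iso (cmpfunctor F G) (cmpfunctor F' G).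
Proof.
move=> [u [v [uv nat]]].
exists (fun x => fmap G (u x)), (fun x => fmap G (v x)); split=> [x | x y f].
  have [e1 e2] := uv x; split.
    apply: heq_trans (heq_sym (fmap_cmp G _ _)) _.
    by apply: heq_trans (fmap_heq G e1) (fmap_id G _).
  apply: heq_trans (heq_sym (fmap_cmp G _ _)) _.
  by apply: heq_trans (fmap_heq G e2) (fmap_id G _).
apply: heq_trans (heq_sym (fmap_cmp G _ _)) _.
exact: heq_trans (fmap_heq G (nat x y f)) (fmap_cmp G _ _).
Qed.

Lemma nat_iso_pre (C D E : kcat K) (F0 F0' : D -> E) (G0 : C -> D) (F : functor F0)
  (F' : functor F0') (G : functor G0) :
  nat_iso F F' -> nat_iso (cmpfunctor G F) (cmpfunctor G F').
Proof.
move=> [u [v [uv nat]]].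
exists (fun x => u (G0 x)), (fun x => v (G0 x)).
by split=> [x | x y f]; [exact: uv | exact: nat].
Qed.

Lemma mutually_inverse_cmp (C D E : kcat K) (F0 : C -> D) (G0 : D -> C) (F0' : D -> E)
  (G0' : E -> D) (F : functor F0) (G : functor G0) (F' : functor F0') (G' : functor G0') :
  mutually_inverse F G -> mutually_inverse F' G' ->
  mutually_inverse (cmpfunctor F F') (cmpfunctor G' G).
Proof.
move=> [FG GF] [FG' GF']; split.
  apply: nat_iso_trans FG.
  exact: (nat_iso_pre F (nat_iso_post G FG')).
apply: nat_iso_trans GF'.
exact: (nat_iso_pre G' (nat_iso_post F' GF)).
Qed.

Lemma mutually_inverse_iso (C D : kcat K) (F0 F1 : C -> D) (G0 : D -> C) (F : functor F0)
  (F' : functor F1) (G : functor G0) :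
  nat_iso F F' -> mutually_inverse F G -> mutually_inverse F' G.
Proof.
move=> i [FG GF]; split; apply: nat_iso_trans (FG) || apply: nat_iso_trans (GF).
  exact/nat_iso_sym/nat_iso_post.
exact/nat_iso_sym/nat_iso_pre.
Qed.

Lemma mutually_inverse_restrict (C D : kcat K) (P : C -> Prop) (P' : D -> Prop)
  (F0 : C -> D) (G0 : D -> C) (F : functor F0) (G : functor G0)
  (h : forall x, P x -> P' (F0 x)) (h' : forall x, P' x -> P (G0 x)) :
  mutually_inverse F G -> mutually_inverse (restrict F h) (restrict G h').
Proof.
move=> [[u [v [uv nat]]] [u' [v' [uv' nat']]]]; split.
  exists (fun x : fullcat P => u (sval x)), (fun x : fullcat P => v (sval x)).
  by split=> [x|x y f]; [exact: uv|exact: nat].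
exists (fun x : fullcat P' => u' (sval x)), (fun x : fullcat P' => v' (sval x)).
by split=> [x|x y f]; [exact: uv'|exact: nat'].
Qed.

End Equivalences.

(** * The translations as mutually inverse functors *)

Section TranslationEquivalence.
Local Open Scope ring_scope.
Variables (K : fieldType) (B : falgType K).
Implicit Types M N P X Y Z : rmod B.

Definition tau_mor M N M' N' (p : tau_data M N) (q : tau_data M' N') (g : mhom M M') :
    mhom N N' :=
  sval (constructive_indefinite_description _ (tau_rel_ex p q g)).
Lemma tau_morP M N M' N' (p : tau_data M N) (q : tau_data M' N') g :
  tau_rel p q g (tau_mor p q g).
Proof. exact: (svalP (constructive_indefinite_description _ _)). Qed.

Definition tauV_mor M N M' N' (p : tauV_data M N) (q : tauV_data M' N') (g : mhom M M') :
    mhom N N' :=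
  sval (constructive_indefinite_description _ (tauV_rel_ex p q g)).
Lemma tauV_morP M N M' N' (p : tauV_data M N) (q : tauV_data M' N') g :
  tauV_rel p q g (tauV_mor p q g).
Proof. exact: (svalP (constructive_indefinite_description _ _)). Qed.

Lemma tau_mor_inv M N N' (p : tau_data M N) (q : tau_data M N') :
  heq (mcmp (tau_mor p q (mid M)) (tau_mor q p (mid M)) : Defs.hom (N : costmod B) (N : costmod B))
      (mid N).
Proof.
apply: (tau_rel_unique (tau_rel_cmp (tau_morP _ _ _) (tau_morP _ _ _)) (tau_rel_id p)).
by rewrite mcmp1m; apply: heq_refl.
Qed.

Lemma tauV_mor_inv M N N' (p : tauV_data M N) (q : tauV_data M N') :
  heq (mcmp (tauV_mor p q (mid M)) (tauV_mor q p (mid M)) : Defs.hom (N : stmod B) (N : stmod B))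
      (mid N).
Proof.
apply: (tauV_rel_unique (tauV_rel_cmp (tauV_morP _ _ _) (tauV_morP _ _ _)) (tauV_rel_id p)).
by rewrite mcmp1m; apply: heq_refl.
Qed.

Section TauFunctor.
Variables (C : kcat K) (M0 : C -> rmod B) (F : functor (M0 : C -> stmod B)).
Variables (N0 : C -> rmod B) (p : forall x, tau_data (M0 x) (N0 x)).
Local Notation tm x y f := (tau_mor (p x) (p y) (fmap F f)).
Local Notation N1 := (N0 : C -> costmod B).

Fact tauf_lin (x y : C) a (f g : Defs.hom x y) :
  heq (tm x y (a *: f + g) : Defs.hom (N1 x) (N1 y)) (a *: tm x y f + tm x y g).
Proof.
apply: tau_rel_unique (tau_morP _ _ _) _ (fmap_lin F a f g).
by apply: tau_rel_lin; apply: tau_morP.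
Qed.
Fact tauf_null (x y : C) (f : Defs.hom x y) : null f ->
  null (tm x y f : Defs.hom (N1 x) (N1 y)).
Proof. by move=> nf; apply: tau_rel_null (tau_morP _ _ _) (fmap_null F nf). Qed.
Fact tauf_id (x : C) : heq (tm x x (idm C x) : Defs.hom (N1 x) (N1 x)) (mid (N0 x)).
Proof. by apply: tau_rel_unique (tau_morP _ _ _) (tau_rel_id _) (fmap_id F x). Qed.
Fact tauf_cmp (x y z : C) (f : Defs.hom x y) (g : Defs.hom y z) :
  heq (tm x z (cmp f g) : Defs.hom (N1 x) (N1 z)) (mcmp (tm x y f) (tm y z g)).
Proof.
apply: tau_rel_unique (tau_morP _ _ _) _ (fmap_cmp F f g).
by apply: tau_rel_cmp; apply: tau_morP.
Qed.

(** The source is any category over the stable module category, with data chosen object by object.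
    The identity functor yields an [AR_translation]; the given [F] yields a functor with exactly the
    prescribed objects. *)
Definition tau_functor : functor N1 := Functor tauf_lin tauf_null tauf_id tauf_cmp.
End TauFunctor.

Section TauVFunctor.
Variables (C : kcat K) (M0 : C -> rmod B) (F : functor (M0 : C -> costmod B)).
Variables (N0 : C -> rmod B) (p : forall x, tauV_data (M0 x) (N0 x)).
Local Notation tm x y f := (tauV_mor (p x) (p y) (fmap F f)).
Local Notation N1 := (N0 : C -> stmod B).

Fact tauVf_lin (x y : C) a (f g : Defs.hom x y) :
  heq (tm x y (a *: f + g) : Defs.hom (N1 x) (N1 y)) (a *: tm x y f + tm x y g).
Proof.
apply: tauV_rel_unique (tauV_morP _ _ _) _ (fmap_lin F a f g).
by apply: tauV_rel_lin; apply: tauV_morP.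
Qed.
Fact tauVf_null (x y : C) (f : Defs.hom x y) : null f ->
  null (tm x y f : Defs.hom (N1 x) (N1 y)).
Proof. by move=> nf; apply: tauV_rel_null (tauV_morP _ _ _) (fmap_null F nf). Qed.
Fact tauVf_id (x : C) : heq (tm x x (idm C x) : Defs.hom (N1 x) (N1 x)) (mid (N0 x)).
Proof. by apply: tauV_rel_unique (tauV_morP _ _ _) (tauV_rel_id _) (fmap_id F x). Qed.
Fact tauVf_cmp (x y z : C) (f : Defs.hom x y) (g : Defs.hom y z) :
  heq (tm x z (cmp f g) : Defs.hom (N1 x) (N1 z)) (mcmp (tm x y f) (tm y z g)).
Proof.
apply: tauV_rel_unique (tauV_morP _ _ _) _ (fmap_cmp F f g).
by apply: tauV_rel_cmp; apply: tauV_morP.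
Qed.

Definition tauV_functor : functor N1 := Functor tauVf_lin tauVf_null tauVf_id tauVf_cmp.
End TauVFunctor.

Lemma proj_presentation_ex M : inhabited (proj_presentation M).
Proof.
have [P0 [p0 [hP0 s0 m0]]] := proj_cover M.
have [P1 [p1 [hP1 s1 m1]]] := proj_cover (kerm p0).
have ex : exact (mcmp p1 (ker_incl p0)) p0.
  move=> x; split=> [/(exact_ker_incl p0)[y <-]|[y <-]].
    by have [z <-] := epi_mod_ex s1 y; exists z; rewrite mcmpE.
  by rewrite -mcmpE -mcmpA (exact0 (exact_ker_incl p0)) mcmp0r mzeroE.
constructor; apply: (@ProjPresentation K B M P1 P0 (mcmp p1 (ker_incl p0)) p0).
split=> //; first exact: exact_eq.
move=> U hU e; apply: m1 => //; rewrite -e; congr (U + _)%VS.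
apply/vspaceP => x; rewrite !memv_ker mcmpE; apply/eqP/eqP => [->|]; first by rewrite linear0.
by move/(mono_modP _).2; apply; apply: mono_ker_incl.
Qed.

Lemma inj_copresentation_ex M : inhabited (inj_copresentation M).
Proof.
have [I0 [i0 [hI0 s0 m0]]] := inj_hull M.
have [I1 [i1 [hI1 s1 m1]]] := inj_hull (cokm i0).
have ex : exact i0 (mcmp (cok_proj i0) i1).
  move=> x; rewrite mcmpE; split=> [/(mono_modP _).2-/(_ s1)/(exact_cok_proj i0) //|].
  by move/(exact_cok_proj i0) => ->; rewrite linear0.
constructor; apply: (@InjCopresentation K B M I0 I1 i0 (mcmp (cok_proj i0) i1)).
split=> //; first exact: exact_eq.
move=> U hU e; apply: m1 => //; rewrite -e; congr (U :&: _)%VS.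
apply/vspaceP => x; apply/memv_imgP/memv_imgP => -[y _ ->].
  have [z <-] := epi_mod_ex (epi_cok_proj i0) y.
  by exists z; rewrite ?memvf // mcmpE.
by exists (vsval (cok_proj i0) y); rewrite ?memvf // mcmpE.
Qed.

Definition pres_data M (m : proj_presentation M) : tau_data M (kerm (nu_map (pp_d m))) :=
  TauData (mpp_proj1 (pp_min m)) (mpp_proj0 (pp_min m)) (mpp_surj (pp_min m))
    (exactE (mpp_exact (pp_min m))) (mono_ker_incl _) (exact_ker_incl _).

Definition copres_data M (m : inj_copresentation M) :
    tauV_data M (cokm (nuV_map (ip_d m))) :=
  TauVData (mic_inj0 (ip_min m)) (mic_inj1 (ip_min m)) (mic_mono (ip_min m))
    (exactE (mic_exact (ip_min m))) (epi_cok_proj _) (exact_cok_proj _).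

Lemma AR_translation_ex : inhabited (AR_translation B).
Proof.
pose m M : proj_presentation M :=
  sval (constructive_indefinite_description (fun=> True)
    (let: inhabits x := proj_presentation_ex M in ex_intro _ x I)).
constructor.
exists m (tau_functor (idfunctor (stmod B)) (fun M => pres_data (m M))).
move=> M N g g0 g1 h e0 e1 e2.
apply: (tau_rel_unique (tau_morP _ _ _) _ (heq_refl _)).
by exists g0, g1.
Qed.

Lemma AR_translation_inv_ex : inhabited (AR_translation_inv B).
Proof.
pose m M : inj_copresentation M :=
  sval (constructive_indefinite_description (fun=> True)
    (let: inhabits x := inj_copresentation_ex M in ex_intro _ x I)).
constructor.
exists m (tauV_functor (idfunctor (costmod B)) (fun M => copres_data (m M))).
move=> M N g g0 g1 h e0 e1 e2.
apply: (tauV_rel_unique (tauV_morP _ _ _) _ (heq_refl _)).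
by exists g0, g1.
Qed.

Section TwoTranslations.
Variables (T : AR_translation B) (T' : AR_translation_inv B).

Definition ar_data M : tau_data M (ar_ob T M) := pres_data (ar_pres T M).
Definition arV_data M : tauV_data M (arV_ob T' M) := copres_data (arV_copres T' M).

Lemma ar_data_rel M N g h : tau_rel (ar_data M) (ar_data N) g h ->
  heq (fmap (ar_fun T) (g : Defs.hom (M : stmod B) (N : stmod B)))
      (h : Defs.hom (ar_ob T M : costmod B) (ar_ob T N : costmod B)).
Proof. by move=> [g0 [g1 [e1 e2 e3]]]; apply: ar_spec e1 e2 e3. Qed.

Lemma arV_data_rel M N g h : tauV_rel (arV_data M) (arV_data N) g h ->
  heq (fmap (arV_fun T') (g : Defs.hom (M : costmod B) (N : costmod B)))
      (h : Defs.hom (arV_ob T' M : stmod B) (arV_ob T' N : stmod B)).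
Proof. by move=> [g0 [g1 [e1 e2 e3]]]; apply: arV_spec e1 e2 e3. Qed.

(** [arV_data (ar_ob T M)] and [to_tauV (ar_data M)] copresent the same module, the first with
    cokernel [tau^-1 tau M], the second with cokernel [M]. Comparing them along the identity gives
    the isomorphism; the other composite is dual. *)
Lemma AR_mutually_inverse : mutually_inverse (ar_fun T) (arV_fun T').
Proof.
split.
  pose r M := arV_data (ar_ob T M); pose p M := to_tauV (ar_data M).
  exists (fun M => tauV_mor (r M) (p M) (mid _)), (fun M => tauV_mor (p M) (r M) (mid _)).
  split=> [M | M N g].
    by split; apply: tauV_mor_inv.
  have h1 := tau_morP (ar_data M) (ar_data N) g.
  pose h := tau_mor (ar_data M) (ar_data N) g.
  have h2 := tauV_morP (r M) (r N) h.
  apply: (heq_trans (g := mcmp (tauV_mor (r M) (r N) h) (tauV_mor (r N) (p N) (mid _))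
      : Defs.hom (_ : stmod B) (_ : stmod B))).
    apply: (heq_cmpr (C := stmod B)).
    apply: heq_trans (arV_data_rel h2); apply: (fmap_heq (arV_fun T')).
    exact: ar_data_rel.
  apply: (tauV_rel_unique (tauV_rel_cmp h2 (tauV_morP _ _ _))
    (tauV_rel_cmp (tauV_morP _ _ _) (to_tauV_rel h1))).
  by rewrite mcmp1m mcmpm1; apply: heq_refl.
pose r M := ar_data (arV_ob T' M); pose p M := of_tauV (arV_data M).
exists (fun M => tau_mor (r M) (p M) (mid _)), (fun M => tau_mor (p M) (r M) (mid _)).
split=> [M | M N g].
  by split; apply: tau_mor_inv.
have h1 := tauV_morP (arV_data M) (arV_data N) g.
pose h := tauV_mor (arV_data M) (arV_data N) g.
have h2 := tau_morP (r M) (r N) h.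
apply: (heq_trans (g := mcmp (tau_mor (r M) (r N) h) (tau_mor (r N) (p N) (mid _))
    : Defs.hom (_ : costmod B) (_ : costmod B))).
  apply: (heq_cmpr (C := costmod B)).
  apply: heq_trans (ar_data_rel h2); apply: (fmap_heq (ar_fun T)).
  exact: arV_data_rel.
apply: (tau_rel_unique (tau_rel_cmp h2 (tau_morP _ _ _))
  (tau_rel_cmp (tau_morP _ _ _) (of_tauV_rel h1))).
by rewrite mcmp1m mcmpm1; apply: heq_refl.
Qed.

End TwoTranslations.

End TranslationEquivalence.

(** * Cohomology of Jacobian algebras *)

Section PathAlgebra.
Local Open Scope ring_scope.
Variables (K : fieldType) (Q : quiver).
Implicit Types (i j k : vert Q) (a : arr Q) (s t : seq (arr Q)).

Lemma qhom_ind i j (P : qhom K i j -> Prop) : P 0 ->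
  (forall c f g, P f -> P g -> P (c *: f + g)) -> (forall p, P (qlin K p)) -> forall f, P f.
Proof.
move=> P0 PD PU f; rewrite -[f]qextE /qext.
elim: (enum_fset (msupp f)) => [|p r IH]; first by rewrite big_nil.
by rewrite big_cons; apply: PD.
Qed.

Lemma qcmp_qlin i j k (p : qpath i j) (q : qpath j k) :
  qcmp (qlin K p) (qlin K q) = qlin K (qcat p q).
Proof. by rewrite /qcmp !qextU. Qed.

Lemma qcmp_linE_l i j k d (f f' : qhom K i j) (g : qhom K j k) :
  qcmp (d *: f + f') g = d *: qcmp f g + qcmp f' g.
Proof. exact: qcmp_linl. Qed.

Lemma qcmp_linE_r i j k d (f : qhom K i j) (g g' : qhom K j k) :
  qcmp f (d *: g + g') = d *: qcmp f g + qcmp f g'.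
Proof. exact: qcmp_linr. Qed.

Fact arr_path_subproof a : qpathb (src a) [:: a] (tgt a).
Proof. by rewrite /= !eqxx. Qed.
Definition arr_path a : qpath (src a) (tgt a) := exist _ [:: a] (arr_path_subproof a).

Lemma qext_lin i j (V : lmodType K) (h : qpath i j -> V) c f g :
  qext h (c *: f + g) = c *: qext h f + qext h g.
Proof. exact: qext_is_linear. Qed.

Lemma qext0 i j (V : lmodType K) (h : qpath i j -> V) : qext h 0 = 0.
Proof. exact: (linear0 (qext h)). Qed.

Lemma pathelt_path i j s (h : qpathb i s j) : pathelt K i j s = qlin K (exist _ s h : qpath i j).
Proof.
rewrite /pathelt; case: insubP => [p _ e|]; last by rewrite h.
by congr qlin; apply: val_inj.
Qed.

Lemma path_qpathb a s b : path (fun c d => tgt c == src d) a (rcons s b) ->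
  qpathb (tgt a) s (src b).
Proof.
elim: s a => [|c s IH] a /=; first by rewrite andbT.
by case/andP=> /eqP <- /IH ->; rewrite eqxx.
Qed.

(** What follows [a] in the cyclic sequence [s]: the cyclic derivative of [s] at [a], as a word. *)
Definition tail_at a s := behead (rot (index a s) s).

Lemma rot_index_tail a s : a \in s -> rot (index a s) s = a :: tail_at a s.
Proof.
move=> h; rewrite /tail_at /rot (drop_nth a) ?index_mem // nth_index //.
Qed.

Lemma qext_cyc_deriv (V : lmodType K) a s (F : seq (arr Q) -> V) : uniq s ->
  cycle (fun c d => tgt c == src d) s ->
  qext (fun p => F (sval p)) (cyc_deriv K a s) = if a \in s then F (tail_at a s) else 0.
Proof.
move=> us cs; rewrite /cyc_deriv; case: ifPn => [h|h]; last first.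
  rewrite big1 ?qext0 // => p /eqP e; case/negP: h; rewrite -e.
  exact: mem_nth.
have ip : (index a s < size s)%N by rewrite index_mem.
rewrite (bigD1 (Ordinal ip)) /= ?nth_index // big1 ?addr0; last first.
  move=> p /andP[/eqP e ne]; case/negP: ne; apply/eqP/val_inj => /=.
  by rewrite -[in RHS]e index_uniq.
have -> : drop (index a s).+1 s ++ take (index a s) s = tail_at a s.
  by rewrite /tail_at /rot [in RHS](drop_nth a) //.
have hp : qpathb (tgt a) (tail_at a s) (src a).
  apply: path_qpathb; have := cs; rewrite -(rot_cycle (index a s)) rot_index_tail //.
by rewrite (pathelt_path hp) qextU.
Qed.

Lemma chordless_seqP s : chordless_seq s ->
  uniq s /\ cycle (fun a b => tgt a == src b) s.
Proof. by case/and4P=> _ cs us _; split=> //; apply: map_uniq us. Qed.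

Lemma cyc_pathP C : C \in chordless Q ->
  uniq (cyc_path C) /\ cycle (fun a b => tgt a == src b) (cyc_path C).
Proof.
rewrite inE /cyc_path => h; apply: chordless_seqP.
have : head [::] [seq s <- permutations (enum C) | chordless_seq s] \in
    [seq s <- permutations (enum C) | chordless_seq s].
  by move: h; rewrite has_filter; case: (filter _ _) => // x r _; rewrite mem_head.
by rewrite mem_filter => /andP[].
Qed.

End PathAlgebra.

(** * Elements of the Jacobian algebra and their lifts to paths *)

Section Jacobian.
Local Open Scope ring_scope.
Variables (K : fieldType) (Q : quiver) (C0 : {set arr Q}) (B : falgType K).
Variables (pr : forall i j : vert Q, {linear qhom K i j -> B}).
Hypothesis hB : jacobian_algebra C0 pr.
Implicit Types (i j k : vert Q) (a b : arr Q) (s t : seq (arr Q)).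

Definition idem i : B := pr i i (qlin K (qnil i)).
Definition arrow a : B := pr (src a) (tgt a) (qlin K (arr_path a)).
(** The empty word is 1 rather than an idempotent, which makes [word] multiplicative on arbitrary
    sequences; [pr_path_l] and [pr_path_r] put back the idempotent at an end of a path. *)
Definition word s : B := foldr (fun a x => arrow a * x) 1 s.

Lemma pr_lin i j d (f g : qhom K i j) : pr i j (d *: f + g) = d *: pr i j f + pr i j g.
Proof. exact: linearP. Qed.

Lemma idem_pr i j (f : qhom K i j) : idem i * pr i j f = pr i j f.
Proof. by rewrite /idem -(jac_cmp hB) qcmp1m. Qed.
Lemma pr_idem i j (f : qhom K i j) : pr i j f * idem j = pr i j f.
Proof. by rewrite /idem -(jac_cmp hB) qcmpm1. Qed.
Lemma idemM i : idem i * idem i = idem i.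
Proof. exact: idem_pr. Qed.
Lemma idemM0 i j : i != j -> idem i * idem j = 0.
Proof. by move=> h; rewrite /idem (jac_orth hB). Qed.
Lemma idem_sum : \sum_i idem i = 1.
Proof. exact: (jac_unit hB). Qed.
Lemma idem_arrow a : idem (src a) * arrow a = arrow a.
Proof. exact: idem_pr. Qed.
Lemma arrow_idem a : arrow a * idem (tgt a) = arrow a.
Proof. exact: pr_idem. Qed.
Lemma idem_pr0 k i j (f : qhom K i j) : k != i -> idem k * pr i j f = 0.
Proof. by move=> h; rewrite -idem_pr mulrA idemM0 // mul0r. Qed.
Lemma pr_idem0 k i j (f : qhom K i j) : j != k -> pr i j f * idem k = 0.
Proof. by move=> h; rewrite -pr_idem -mulrA idemM0 // mulr0. Qed.

Lemma idem_arrow0 i a : i != src a -> idem i * arrow a = 0.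
Proof. exact: idem_pr0. Qed.
Lemma arrow_idem0 a i : tgt a != i -> arrow a * idem i = 0.
Proof. exact: pr_idem0. Qed.

Lemma word_cat s t : word (s ++ t) = word s * word t.
Proof. by elim: s => [|a s IH] /=; rewrite ?mul1r // IH mulrA. Qed.

Lemma pr_path_l i j (p : qpath i j) : pr i j (qlin K p) = idem i * word (sval p).
Proof.
case: p => s h /=; elim: s i h => [|a s IH] i h.
  have /eqP E : i == j by exact: h.
  subst j; rewrite mulr1; congr (pr _ _ (qlin K _)).
  exact: val_inj.
have /andP[/eqP E h'] : (src a == i) && qpathb (tgt a) s j by exact: h.
subst i.
have -> : exist _ (a :: s) h = qcat (arr_path a) (exist _ s h' : qpath _ _) :> qpath _ _.
  exact: val_inj.
by rewrite -qcmp_qlin (jac_cmp hB) IH !mulrA idem_arrow arrow_idem.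
Qed.

Lemma word_path i j s : qpathb i s j -> idem i * word s = word s * idem j.
Proof.
elim: s i => [|a s IH] i /=; first by move/eqP->; rewrite mulr1 mul1r.
by case/andP => /eqP <- h; rewrite mulrA idem_arrow -mulrA -(IH (tgt a)) // mulrA arrow_idem.
Qed.

Lemma pr_path_r i j (p : qpath i j) : pr i j (qlin K p) = word (sval p) * idem j.
Proof. by rewrite pr_path_l; exact: (@word_path i j (sval p) (svalP p)). Qed.

Lemma pr_potential a : pr _ _ (potential_deriv K C0 a) = 0.
Proof. by apply/(jac_ker hB); apply: IdealGen; constructor. Qed.

Lemma lift_ex i j (x : B) : exists f : qhom K i j, pr i j f = idem i * x * idem j.
Proof.
have [g ->] := jac_surj hB x; exists (g i j).
rewrite mulr_sumr mulr_suml (bigD1 i) //= [X in _ + X]big1 ?addr0 => [|k ki]; last first.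
  rewrite mulr_sumr mulr_suml big1 // => l _; by rewrite idem_pr0 ?mul0r // eq_sym.
rewrite mulr_sumr mulr_suml (bigD1 j) //= [X in _ + X]big1 ?addr0 => [|k ki].
  by rewrite idem_pr pr_idem.
by rewrite -mulrA pr_idem0 ?mulr0.
Qed.

Definition lift0 i j (x : B) : qhom K i j :=
  sval (constructive_indefinite_description _ (lift_ex i j x)).

(** Representatives are chosen on a basis only and extended linearly, so that cocycles and
    homotopies defined through [lift] are linear in [x]. *)
Definition lift i j (x : B) : qhom K i j :=
  \sum_n coord (vbasis {:B}) n x *: lift0 i j (vbasis {:B})`_n.

Lemma lift_lin i j : linear (lift i j).
Proof.
move=> c x y; rewrite /lift scaler_sumr -big_split; apply: eq_bigr => k _ /=.
by rewrite linearP scalerDl scalerA.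
Qed.

Lemma pr_lift i j x : pr i j (lift i j x) = idem i * x * idem j.
Proof.
rewrite linear_sum {2}[x](coord_vbasis (memvf x)) mulr_sumr mulr_suml.
apply: eq_bigr => k _; rewrite linearZ /= -scalerAr -scalerAl; congr (_ *: _).
by rewrite /lift0; case: constructive_indefinite_description.
Qed.

Local Notation "x ** y" := (ract x y) (at level 40, left associativity).

(** * Fox derivatives and cocycles *)

Section Fox.
Variables X Z : rmod B.
Implicit Type c : arr Q -> 'Hom(X, Z).

(* The Fox derivative: the value on the path [s] of the cocycle [X x B -> Z]
   which has the values [c] on the arrows and vanishes on the idempotents. *)
Fixpoint fox c (x : X) s : Z :=
  if s is a :: s' then
    c a (x ** idem (src a)) ** idem (tgt a) ** word s' + fox c (x ** arrow a) s'
  else 0.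

Lemma fox_cat c x s t :
  fox c x (s ++ t) = fox c x s ** word t + fox c (x ** word s) t.
Proof.
elim: s x => [|a s IH] x /=; first by rewrite ract0 add0r ract1.
by rewrite IH word_cat !ractM ractD addrA.
Qed.

Lemma fox_idem_l c x i j s : qpathb i s j -> fox c (x ** idem i) s = fox c x s.
Proof.
case: s => //= a s /andP[/eqP <- _].
by rewrite -!ractM idemM idem_arrow.
Qed.

Lemma fox_idem_r c x i j s : qpathb i s j -> fox c x s ** idem j = fox c x s.
Proof.
elim: s x i => [|a s IH] x i /=; first by rewrite ract0.
case/andP => _ h; rewrite ractD (IH _ _ h); congr (_ + _).
by rewrite -!ractM -(word_path h) mulrA idemM.
Qed.

Lemma fox_linx c s : linear (fun x => fox c x s).
Proof.
elim: s => [|a s IH] d x y /=; first by rewrite scaler0 addr0.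
by rewrite !ract_linl IH linearP !ract_linl scalerDr addrACA.
Qed.

Lemma fox_linc d (c c' c2 : arr Q -> 'Hom(X, Z)) x s :
  (forall a y, c2 a y = d *: c a y + c' a y) -> fox c2 x s = d *: fox c x s + fox c' x s.
Proof.
move=> e; elim: s x => [|a s IH] x /=; first by rewrite scaler0 addr0.
by rewrite IH e !ract_linl scalerDr addrACA.
Qed.

Definition foxq c x i j (f : qhom K i j) : Z := qext (fun p => fox c x (sval p)) f.

Lemma foxqU c x i j (p : qpath i j) : foxq c x (qlin K p) = fox c x (sval p).
Proof. by rewrite /foxq qextU. Qed.

Lemma foxq_lin c x i j d (f g : qhom K i j) :
  foxq c x (d *: f + g) = d *: foxq c x f + foxq c x g.
Proof. exact: qext_lin. Qed.

Lemma foxq0 c x i j : foxq c x (0 : qhom K i j) = 0.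
Proof. exact: qext0. Qed.

Lemma foxq_linx c i j (f : qhom K i j) : linear (fun x => foxq c x f).
Proof.
move=> d x y; rewrite /foxq -qext_lin_fun; apply: eq_qext => p.
exact: fox_linx.
Qed.

Lemma foxq0x c i j (f : qhom K i j) : foxq c 0 f = 0.
Proof. by have := foxq_linx c f (-1) 0 0; rewrite scaler0 addr0 scaleN1r addNr. Qed.

Lemma foxq_sum c x i j (I : finType) (f : I -> qhom K i j) :
  foxq c x (\sum_n f n) = \sum_n foxq c x (f n).
Proof. exact: (linear_sum (qext _)). Qed.

Lemma foxq_sumx c i j (f : qhom K i j) (I : finType) (x : I -> X) :
  foxq c (\sum_n x n) f = \sum_n foxq c (x n) f.
Proof.
by elim/big_rec2: _ => [|k y z _ <-]; rewrite ?foxq0x // -[x k]scale1r foxq_linx !scale1r.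
Qed.

Lemma foxq_linc d (c c' c2 : arr Q -> 'Hom(X, Z)) x i j (f : qhom K i j) :
  (forall a y, c2 a y = d *: c a y + c' a y) ->
  foxq c2 x f = d *: foxq c x f + foxq c' x f.
Proof.
move=> e; rewrite /foxq -qext_lin_fun; apply: eq_qext => p; exact: fox_linc.
Qed.

Lemma foxq_idem_l c x i j (f : qhom K i j) : foxq c (x ** idem i) f = foxq c x f.
Proof. by apply: eq_qext => p; apply: fox_idem_l (svalP p). Qed.

Lemma foxq_idem_r c x i j (f : qhom K i j) : foxq c x f ** idem j = foxq c x f.
Proof.
elim/qhom_ind: f => [|d f g ef eg|p]; first by rewrite foxq0 ract0.
  by rewrite foxq_lin ract_linl ef eg.
by rewrite foxqU; apply: fox_idem_r (svalP p).
Qed.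

Lemma foxq_cmp c x i j k (f : qhom K i j) (g : qhom K j k) :
  foxq c x (qcmp f g) = foxq c x f ** pr j k g + foxq c (x ** pr i j f) g.
Proof.
elim/qhom_ind: f => [|d f f' ef ef'|p].
- have -> : qcmp (0 : qhom K i j) g = 0 by apply: qnull_cmpl.
  by rewrite !foxq0 ract0 linear0 ractr0 foxq0x addr0.
- rewrite qcmp_linE_l; apply: etrans (foxq_lin _ _ _ _ _) _.
  apply: etrans (congr2 (fun u v : Z => d *: u + v) ef ef') _.
  rewrite (foxq_lin c x d f f') pr_lin ract_linr ract_linl foxq_linx.
  by rewrite scalerDr addrACA.
elim/qhom_ind: g => [|d g g' eg eg'|q].
- have -> : qcmp (qlin K p) (0 : qhom K j k) = 0 by apply: qnull_cmpr.
  by rewrite !foxq0 linear0 ractr0 addr0.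
- rewrite qcmp_linE_r; apply: etrans (foxq_lin _ _ _ _ _) _.
  apply: etrans (congr2 (fun u v : Z => d *: u + v) eg eg') _.
  by rewrite (foxq_lin c _ d g g') pr_lin ract_linr scalerDr addrACA.
rewrite qcmp_qlin !foxqU fox_cat pr_path_l pr_path_r !ractM (fox_idem_r _ _ (svalP p)).
by rewrite (fox_idem_l _ _ (svalP q)).
Qed.

(** The condition for the values on arrows to descend from paths to [B]; by [fox_ideal] the
    generators of the ideal suffice. *)
Definition closed1 c := forall a x, foxq c x (potential_deriv K C0 a) = 0.

Lemma fox_ideal c i j (f : qhom K i j) : closed1 c ->
  ideal_gen (@jac_rel Q K C0) (f : Defs.hom (i : pathcat K Q) j) ->
  forall x, foxq c x f = 0.
Proof.
(* In the product rule, the derivative of the factor outside the ideal is paired with the image in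
   [B] of the factor inside it; the vanishing of that image is therefore carried through the
   induction. *)
move=> hc H; suff : pr i j f = 0 /\ forall x, foxq c x f = 0 by case.
elim: i j f / H => [i j f r|i j f ->|i j d f g _ [ef hf] _ [eg hg]|i j k f g _ [ef hf]|
                    i j k f g _ [eg hg]].
- by case: i j f / r => a; split=> [|x]; [exact: pr_potential | exact: hc].
- by split=> [|x]; [exact: linear0 | exact: foxq0].
- split=> [|x]; first by rewrite pr_lin ef eg scaler0 addr0.
  by rewrite foxq_lin hf hg scaler0 addr0.
- split=> [|x]; first by rewrite [LHS](jac_cmp hB) ef mul0r.
  by rewrite [LHS]foxq_cmp hf ef ract0 ractr0 foxq0x addr0.
split=> [|x]; first by rewrite [LHS](jac_cmp hB) eg mulr0.
by rewrite [LHS]foxq_cmp hg eg ractr0 addr0.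
Qed.

Lemma fox_wd c x i j (f g : qhom K i j) : closed1 c -> pr i j f = pr i j g ->
  foxq c x f = foxq c x g.
Proof.
move=> hc e; apply/eqP; rewrite -subr_eq0; apply/eqP.
have := foxq_lin c x (-1) g f; rewrite !scaleN1r ![- _ + _]addrC => <-.
by apply: fox_ideal => //; apply/(jac_ker hB); rewrite linearB /= e subrr.
Qed.

(* Cocycles [X x B -> Z]; they classify extensions of [X] by [Z]. *)
Definition cocycle (D : X -> B -> Z) : Prop :=
  [/\ forall x, linear (D x), forall y, linear (D^~ y)
    & forall x y z, D x (y * z) = D x y ** z + D (x ** y) z].

Definition fox_cocycle c (x : X) (y : B) : Z := \sum_i \sum_j foxq c x (lift i j y).

Lemma fox_cocycleP c : closed1 c -> cocycle (fox_cocycle c).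
Proof.
move=> hc; split=> [x d y z|y d x z|x y z].
- rewrite /fox_cocycle scaler_sumr -big_split; apply: eq_bigr => i _ /=.
  rewrite scaler_sumr -big_split; apply: eq_bigr => j _ /=.
  by rewrite lift_lin foxq_lin.
- rewrite /fox_cocycle scaler_sumr -big_split; apply: eq_bigr => i _ /=.
  rewrite scaler_sumr -big_split; apply: eq_bigr => j _ /=.
  exact: foxq_linx.
(* [e_i y z e_j] is the sum over [k] of [(e_i y e_k)(e_k z e_j)]. As [c] is closed, its lift may be
   replaced by the sum of the composed lifts, to which the product rule applies. *)
have E i j : foxq c x (lift i j (y * z)) =
    \sum_k (foxq c x (lift i k y) ** (z * idem j)
            + foxq c (x ** (idem i * y * idem k)) (lift k j z)).
  have -> : foxq c x (lift i j (y * z)) =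
      foxq c x (\sum_k qcmp (lift i k y) (lift k j z)).
    apply: fox_wd => //; rewrite pr_lift linear_sum /=.
    rewrite -{1}[y]mulr1 -idem_sum mulr_sumr mulr_suml mulr_sumr mulr_suml.
    apply: eq_bigr => k _; rewrite (jac_cmp hB) !pr_lift -!mulrA.
    by rewrite (mulrA (idem k) (idem k)) idemM.
  rewrite foxq_sum; apply: eq_bigr => k _; rewrite foxq_cmp !pr_lift.
  by rewrite -mulrA ractM foxq_idem_r.
have -> : fox_cocycle c x (y * z) =
    \sum_i \sum_j \sum_k foxq c x (lift i k y) ** (z * idem j) +
    \sum_i \sum_j \sum_k foxq c (x ** (idem i * y * idem k)) (lift k j z).
  rewrite -big_split; apply: eq_bigr => i _; rewrite -big_split; apply: eq_bigr => j _.
  by rewrite -big_split; apply: E.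
congr (_ + _).
  rewrite ract_sum; apply: eq_bigr => i _; rewrite exchange_big ract_sum.
  by apply: eq_bigr => k _; rewrite -ractr_sum -mulr_sumr idem_sum mulr1.
transitivity (\sum_k \sum_j \sum_i foxq c (x ** (idem i * y * idem k)) (lift k j z)).
  rewrite exchange_big [RHS]exchange_big; apply: eq_bigr => j _; exact: exchange_big.
apply: eq_bigr => k _; apply: eq_bigr => j _.
rewrite -foxq_sumx -ractr_sum -mulr_suml -mulr_suml idem_sum mul1r ractM.
exact: foxq_idem_l.
Qed.

End Fox.

Section FoxNaturality.
Variables (X Z X' Z' : rmod B) (c : arr Q -> 'Hom(X, Z)) (c' : arr Q -> 'Hom(X', Z')).
Variables (f : mhom X X') (g : mhom Z Z').
Hypothesis cf : forall a x, c' a (vsval f x) = vsval g (c a x).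

Lemma fox_nat x s : fox c' (vsval f x) s = vsval g (fox c x s).
Proof.
elim: s x => [|a s IH] x /=; first by rewrite linear0.
by rewrite linearD /= -IH !(mhom_ract g) -!(mhom_ract f) cf.
Qed.

Lemma foxq_nat x i j (h : qhom K i j) : foxq c' (vsval f x) h = vsval g (foxq c x h).
Proof.
elim/qhom_ind: h => [|d h h' eh eh'|p]; first by rewrite !foxq0 linear0.
  apply: etrans (foxq_lin _ _ _ _ _) _; apply: etrans (congr2 (fun u v : Z' => d *: u + v) eh eh') _.
  by rewrite (foxq_lin c x d h h') linearP.
by rewrite !foxqU fox_nat.
Qed.
End FoxNaturality.

Definition csign (C : {set arr Q}) : K := (-1) ^+ dual_dist C0 C.

Lemma qext_potential (V : lmodType K) (F : seq (arr Q) -> V) a :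
  qext (fun p => F (sval p)) (potential_deriv K C0 a) =
  \sum_(C in chordless Q) csign C *:
    (if a \in cyc_path C then F (tail_at a (cyc_path C)) else 0).
Proof.
rewrite /potential_deriv linear_sum; apply: eq_bigr => C hC.
have [uC cC] := cyc_pathP hC.
by rewrite linearZ_LR /= qext_cyc_deriv.
Qed.

(** * Normalized cocycles and the obstruction in degree 2 *)

Section Normalize.
Variables (X Z : rmod B).
Implicit Types (D : X -> B -> Z) (c : arr Q -> 'Hom(X, Z)).

(** Along a path, the cocycle identity is the recursion that defines [fox]. *)
Lemma cocycle_fox D c : cocycle D -> (forall x i, D x (idem i) = 0) ->
  (forall a x, c a x = D x (arrow a)) -> forall x i j (f : qhom K i j),
  D x (pr i j f) = foxq c x f.
Proof.
move=> [Dl Dl' DM] D0 cE x i j f.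
have Dz y : D y 0 = 0 by have := Dl y (-1) 0 0; rewrite scaler0 addr0 scaleN1r addNr.
elim/qhom_ind: f => [|d f g ef eg|[s h]]; first by rewrite foxq0 linear0 Dz.
  rewrite pr_lin Dl; apply: esym; apply: etrans (foxq_lin _ _ _ _ _) _.
  exact: (congr2 (fun u v : Z => d *: u + v) (esym ef) (esym eg)).
rewrite foxqU /=; elim: s i h x => [|a s IH] i h x.
  have /eqP E : i == j by exact: h.
  by subst j; rewrite pr_path_l mulr1 D0.
have /andP[/eqP E h'] : (src a == i) && qpathb (tgt a) s j by exact: h.
subst i.
have -> : exist _ (a :: s) h = qcat (arr_path a) (exist _ s h' : qpath _ _) :> qpath _ _.
  exact: val_inj.
rewrite -qcmp_qlin (jac_cmp hB) DM IH -/(arrow a) pr_path_l ractM /=; congr (_ ** _ + _).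
(* A cocycle that vanishes on the idempotents absorbs those at the source and at the target of
   [a]. *)
rewrite cE; have := DM x (idem (src a)) (arrow a); rewrite idem_arrow D0 ract0 add0r => <-.
by have := DM x (arrow a) (idem (tgt a)); rewrite arrow_idem D0 addr0 => <-.
Qed.

Lemma cocycle_closed D c : cocycle D -> (forall x i, D x (idem i) = 0) ->
  (forall a x, c a x = D x (arrow a)) -> closed1 c.
Proof.
move=> hD D0 cE a x; rewrite -(cocycle_fox hD D0 cE) pr_potential.
by case: hD => Dl _ _; have := Dl x (-1) 0 0; rewrite scaler0 addr0 scaleN1r addNr.
Qed.

Definition coboundary (h : 'Hom(X, Z)) (x : X) (y : B) : Z := h (x ** y) - h x ** y.

Lemma coboundaryP h : cocycle (coboundary h).
Proof.
split=> [x d y z|y d x z|x y z]; rewrite /coboundary.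
- by rewrite !ract_linr linearP scalerBr opprD addrACA.
- by rewrite ract_linl !linearP /= ract_linl scalerBr opprD addrACA.
by rewrite !ractM ractB [RHS]addrC addrA subrK.
Qed.

Lemma cocycleB D D' : cocycle D -> cocycle D' -> cocycle (fun x y => D x y - D' x y).
Proof.
move=> [Dl Dl' DM] [El El' EM]; split=> [x d y z|y d x z|x y z].
- by rewrite Dl El scalerBr opprD addrACA.
- by rewrite Dl' El' scalerBr opprD addrACA.
by rewrite DM EM ractB opprD addrACA.
Qed.

Lemma cocycleD D D' : cocycle D -> cocycle D' -> cocycle (fun x y => D x y + D' x y).
Proof.
move=> [Dl Dl' DM] [El El' EM]; split=> [x d y z|y d x z|x y z].
- by rewrite Dl El scalerDr addrACA.
- by rewrite Dl' El' scalerDr addrACA.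
by rewrite DM EM ractD addrACA.
Qed.

(* By separability of the span of the idempotents, every cocycle is
   cohomologous to one that vanishes on them. *)
Lemma normalize D : cocycle D ->
  exists h : 'Hom(X, Z), forall x i, D x (idem i) = coboundary h x (idem i).
Proof.
move=> [Dl Dl' DM].
(* The correcting map comes from the separability idempotent, the sum of the tensors of [e_i] with
   itself. *)
have lh : linear (fun x => - \sum_i D x (idem i) ** idem i).
  move=> d x y; rewrite scalerN -opprD scaler_sumr -big_split; congr (- _).
  by apply: eq_bigr => i _ /=; rewrite Dl' ract_linl.
exists (mklin lh) => x j; rewrite /coboundary !mklinE ractN opprK ract_sum.
have Dz : D x 0 = 0 by have := Dl x (-1) 0 0; rewrite scaler0 addr0 scaleN1r addNr.
(* This is the cocycle identity on [e_j e_i], which is [e_j] or 0. *)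
have E i : D (x ** idem j) (idem i) ** idem i =
    (if i == j then D x (idem j) ** idem j else 0) - D x (idem j) ** idem i.
  have := DM x (idem j) (idem i); case: eqP => [->|/eqP ne].
    rewrite idemM => /(congr1 (fun z => z ** idem j)); rewrite ractD -!ractM idemM => e.
    rewrite subrr; apply: (addrI (D x (idem j) ** idem j)); rewrite addr0; exact: esym e.
  rewrite idemM0 1?eq_sym // Dz => /eqP; rewrite eq_sym addrC addr_eq0 => /eqP ->.
  by rewrite ractN -ractM idemM sub0r.
under eq_bigr => i _ do rewrite E.
rewrite sumrB -big_mkcond big_pred1_eq -ractr_sum idem_sum ract1 opprB -[LHS]addr0 -addrA.
congr (_ + _); rewrite (bigD1 j) //= -ractM idemM big1 ?addr0 ?addNr // => i ne.
by rewrite -ractM idemM0 // ractr0.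
Qed.

(** The kernel of the differential from degree 2 to degree 3; [fox_closed2] says that consecutive
    differentials compose to 0. *)
Definition closed2 (phi : arr Q -> 'Hom(X, Z)) : Prop := forall x,
  \sum_a phi a (x ** arrow a) ** idem (src a) = \sum_a phi a (x ** idem (tgt a)) ** arrow a.

(* [H^2 = 0] for the complex whose terms in degrees 1, 2 and 3 are the sums of
   the spaces Hom(X e_s(a), Z e_t(a)), Hom(X e_t(a), Z e_s(a)) and
   Hom(X e_i, Z e_i). The families of maps [X -> Z] are unconstrained: only the
   corners cut out by the idempotents matter. *)
Definition exact2 : Prop := forall phi, closed2 phi -> exists psi : arr Q -> 'Hom(X, Z),
  forall a x, foxq psi x (potential_deriv K C0 a) = phi a (x ** idem (tgt a)) ** idem (src a).

(** The left sum runs over the rotations of [s] by [0, ..., size s - 1], the right one over those by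
    [1, ..., size s]; the extreme rotations coincide. *)
Lemma rot_sum (V : zmodType) s (F : seq (arr Q) -> V) : uniq s ->
  \sum_a (if a \in s then F (a :: tail_at a s) else 0) =
  \sum_a (if a \in s then F (rcons (tail_at a s) a) else 0).
Proof.
move=> us; rewrite -!big_mkcond /= -!big_uniq //.
have sumE (G : arr Q -> V) (H : nat -> V) :
    (forall p a, (p < size s)%N -> G (nth a s p) = H p) ->
    \sum_(a <- s) G a = \sum_(p < size s) H p.
  move=> GH; case E: s => [|a0 s0]; first by rewrite big_nil big_ord0.
  by rewrite -E (big_nth a0) big_mkord; apply: eq_bigr => p _; apply: GH.
rewrite (sumE _ (fun p => F (rot p s))) => [|p a lp]; last first.
  by rewrite -rot_index_tail ?mem_nth // index_uniq.
rewrite (sumE _ (fun p => F (rot p.+1 s))) => [|p a lp]; last first.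
  have := @rot_index_tail _ (nth a s p) s (mem_nth a lp); rewrite index_uniq // => e.
  by rewrite -rot1_cons -e -rotS.
have E : \sum_(p < (size s).+1) F (rot p s) =
    \sum_(p < size s) F (rot p s) + F (rot (size s) s) by rewrite big_ord_recr.
rewrite big_ord_recl rot_size /= rot0 addrC in E.
by rewrite -(addIr _ E); apply: eq_bigr.
Qed.

Lemma foxq_qlinl c x i j k (p : qpath i j) (f : qhom K j k) :
  foxq c x (qcmp (qlin K p) f) = qext (fun q => fox c x (sval p ++ sval q)) f.
Proof.
rewrite /qcmp qextU; elim/qhom_ind: f => [|d f g ef eg|q]; first by rewrite !qext0 foxq0.
  rewrite [RHS]qext_lin -ef -eg qext_lin; exact: foxq_lin.
by rewrite !qextU foxqU.
Qed.

Lemma foxq_qlinr c x i j k (p : qpath j k) (f : qhom K i j) :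
  foxq c x (qcmp f (qlin K p)) = qext (fun q => fox c x (sval q ++ sval p)) f.
Proof.
elim/qhom_ind: f => [|d f g ef eg|q].
- have -> : qcmp (0 : qhom K i j) (qlin K p) = 0 by apply: qnull_cmpl.
  by rewrite qext0 foxq0.
- rewrite [RHS]qext_lin -ef -eg qcmp_linE_l; exact: foxq_lin.
by rewrite qcmp_qlin !qextU foxqU.
Qed.

(* This is where [sum_a (a * d_a W - d_a W * a) = 0] is used: both sums run over
   all rotations of the chordless cycles. *)
Lemma fox_closed2 c x :
  \sum_a foxq c (x ** arrow a) (potential_deriv K C0 a) =
  \sum_a foxq c x (potential_deriv K C0 a) ** arrow a.
Proof.
transitivity (\sum_a foxq c x (qcmp (qlin K (arr_path a)) (potential_deriv K C0 a))).
  by apply: eq_bigr => a _; rewrite foxq_cmp pr_potential ractr0 add0r.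
transitivity (\sum_a foxq c x (qcmp (potential_deriv K C0 a) (qlin K (arr_path a)))); last first.
  by apply: eq_bigr => a _; rewrite foxq_cmp pr_potential ractr0 foxq0x addr0.
under eq_bigr => a _ do rewrite foxq_qlinl (qext_potential (fun t => fox c x (a :: t))).
under [RHS]eq_bigr => a _ do rewrite foxq_qlinr (qext_potential (fun t => fox c x (t ++ [:: a]))).
rewrite exchange_big [RHS]exchange_big; apply: eq_bigr => C hC /=.
rewrite -!scaler_sumr (rot_sum (fun t => fox c x t)) ?(cyc_pathP hC).1 //.
by congr (_ *: _); apply: eq_bigr => a _; rewrite cats1.
Qed.

Lemma cocycle_sum D x (I : finType) (g : I -> B) : cocycle D ->
  D x (\sum_n g n) = \sum_n D x (g n).
Proof.
case=> Dl _ _; elim/big_rec2: _ => [|n u v _ <-].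
  by have := Dl x (-1) 0 0; rewrite scaler0 addr0 scaleN1r addNr.
by rewrite -{1}[g n]scale1r Dl scale1r.
Qed.

Lemma cocycle_eq D D' : cocycle D -> cocycle D' ->
  (forall x i j (f : qhom K i j), D x (pr i j f) = D' x (pr i j f)) ->
  forall x y, D x y = D' x y.
Proof.
move=> hD hD' e x y; have -> : y = \sum_i \sum_j pr i j (lift i j y).
  rewrite -{1}[y]mulr1 -{1}[y]mul1r -idem_sum !mulr_suml; apply: eq_bigr => i _.
  by rewrite mulr_sumr; apply: eq_bigr => j _; rewrite pr_lift.
rewrite !cocycle_sum //; apply: eq_bigr => i _.
by rewrite !cocycle_sum //; apply: eq_bigr => j _.
Qed.

Lemma fox_cocycle_pr c x i j (f : qhom K i j) : closed1 c ->
  fox_cocycle c x (pr i j f) = foxq c x f.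
Proof.
move=> hc; transitivity (\sum_k (if k == i then foxq c x f else 0)); last first.
  by rewrite -big_mkcond big_pred1_eq.
apply: eq_bigr => k _; case: eqP => [->|/eqP ne].
  transitivity (\sum_l (if l == j then foxq c x f else 0)); last first.
    by rewrite -big_mkcond big_pred1_eq.
  apply: eq_bigr => l _; case: eqP => [->|/eqP ne].
    by apply: fox_wd => //; rewrite pr_lift idem_pr pr_idem.
  rewrite -(foxq0 c x i l); apply: fox_wd => //.
  by rewrite pr_lift linear0 -mulrA pr_idem0 ?mulr0 // eq_sym.
apply: big1 => l _; rewrite -(foxq0 c x k l); apply: fox_wd => //.
by rewrite pr_lift linear0 idem_pr0 ?mul0r.
Qed.

End Normalize.

Lemma arr_choice (U V : vectType K) (P : arr Q -> 'Hom(U, V) -> Prop) :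
  (forall a, exists f, P a f) -> exists c : arr Q -> 'Hom(U, V), forall a, P a (c a).
Proof.
move=> H; exists (fun a => sval (constructive_indefinite_description _ (H a))) => a.
exact: svalP (constructive_indefinite_description _ (H a)).
Qed.

(* The obstruction to extending a cocycle from a submodule lies in [H^2]. *)
Lemma cocycle_extend (M P Z : rmod B) (i : mhom M P) (D : M -> B -> Z) : mono_mod i ->
  exact2 (cokm i) Z -> cocycle D ->
  exists D' : P -> B -> Z, cocycle D' /\ forall m y, D' (vsval i m) y = D m y.
Proof.
move=> mi ex hD; have ii := (mono_modP i).2 mi.
have [h hE] := normalize hD; pose D0 x y := D x y - coboundary h x y.
have hD0 : cocycle D0 by apply: cocycleB => //; apply: coboundaryP.
have D00 x k : D0 x (idem k) = 0 by rewrite /D0 hE subrr.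
have [h' h'E] := lfun_ext h ii.
have lc a : linear (fun x => D0 x (arrow a)) by case: hD0.
pose c a := mklin (lc a); have cE a x : c a x = D0 x (arrow a) by apply: mklinE.
(* The values on arrows extend to [P] as linear maps; whether the relations still hold is the
   obstruction. *)
have [ct ctE] := arr_choice (fun a => lfun_ext (c a) ii).
have ctn x k j (f : qhom K k j) : foxq ct (vsval i x) f = foxq c x f.
  by rewrite (@foxq_nat M Z P Z c ct i (mid Z)) ?midE // => a y; rewrite midE ctE.
(* The defect on each relation vanishes on [M], hence lives on the cokernel, where [fox_closed2]
   makes it a closed family. *)
have [phi phiE] : exists phi : arr Q -> 'Hom(cokm i, Z), forall a x,
    phi a (vsval (cok_proj i) x) = foxq ct x (potential_deriv K C0 a).
  apply: (arr_choice (P := fun a f => forall x, f (vsval (cok_proj i) x) = _)) => a.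
  have lf : linear (fun x => foxq ct x (potential_deriv K C0 a)) by apply: foxq_linx.
  have [x x0|f fE] := lfun_factor (t := vsval (cok_proj i)) (f := mklin lf).
    rewrite mklinE; have [m <-] := (exact_cok_proj i x).1 x0.
    by rewrite ctn; apply: (cocycle_closed hD0 D00 cE).
  by exists f => x; rewrite fE mklinE.
have [x|psi psiE] := ex phi.
  have [p <-] := epi_mod_ex (epi_cok_proj i) x.
  transitivity (\sum_a foxq ct (p ** arrow a) (potential_deriv K C0 a)).
    by apply: eq_bigr => a _; rewrite -mhom_ract phiE foxq_idem_r.
  rewrite fox_closed2; apply: eq_bigr => a _.
  by rewrite -mhom_ract phiE foxq_idem_l.
(* The correction factors through the cokernel: it restores the relations without changing the
   values on [M]. *)
pose c1 a := (ct a - (psi a \o vsval (cok_proj i)))%VF.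
pose ps a := (psi a \o vsval (cok_proj i))%VF : 'Hom(P, Z).
have c1E x k j (f : qhom K k j) : foxq c1 x f = foxq ct x f - foxq psi (vsval (cok_proj i) x) f.
  rewrite (@foxq_nat P Z (cokm i) Z ps psi (cok_proj i) (mid Z)) ?midE; last first.
    by move=> a y; rewrite midE comp_lfunE.
  rewrite (@foxq_linc _ _ (-1) ps ct c1) ?scaleN1r 1?addrC // => a y.
  by rewrite add_lfunE opp_lfunE scaleN1r addrC.
have hc1 : closed1 c1.
  move=> a x; rewrite c1E psiE -mhom_ract phiE foxq_idem_l foxq_idem_r.
  by rewrite subrr.
have hD1 := fox_cocycleP hc1.
exists (fun x y => fox_cocycle c1 x y + coboundary h' x y); split.
  by apply: cocycleD => //; apply: coboundaryP.
move=> m y.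
have -> : fox_cocycle c1 (vsval i m) y = D0 m y.
  have hi : cocycle (fun x z => fox_cocycle c1 (vsval i x) z).
    case: hD1 => El El' EM; split=> [x|z d u v|x u v]; first exact: El.
      by rewrite linearP El'.
    by rewrite EM mhom_ract.
  apply: (cocycle_eq hi hD0) => x k j f.
  rewrite (cocycle_fox hD0 D00 cE) fox_cocycle_pr // c1E ctn.
  by rewrite -mcmpE (exact0 (exact_cok_proj i)) mzeroE foxq0x subr0.
by rewrite /coboundary -mhom_ract !h'E subrK.
Qed.

(* Dually, the obstruction to lifting a cocycle along a quotient map. *)
Lemma cocycle_lift (X I M : rmod B) (p : mhom I M) (D : X -> B -> M) : epi_mod p ->
  exact2 X (kerm p) -> cocycle D ->
  exists D' : X -> B -> I, cocycle D' /\ forall x y, vsval p (D' x y) = D x y.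
Proof.
move=> sp ex hD; pose k := ker_incl p.
have ik := (mono_modP k).2 (mono_ker_incl p).
have [h hE] := normalize hD; pose D0 x y := D x y - coboundary h x y.
have hD0 : cocycle D0 by apply: cocycleB => //; apply: coboundaryP.
have D00 x i : D0 x (idem i) = 0 by rewrite /D0 hE subrr.
have [h' h'E] := lfun_lift (t := vsval p) (f := h) (fun x => epi_mod_ex sp (h x)).
have lc a : linear (fun x => D0 x (arrow a)) by case: hD0.
pose c a := mklin (lc a); have cE a x : c a x = D0 x (arrow a) by apply: mklinE.
have [ct ctE] := arr_choice
  (fun a => lfun_lift (t := vsval p) (f := c a) (fun x => epi_mod_ex sp (c a x))).
have ctn x i j (f : qhom K i j) : vsval p (foxq ct x f) = foxq c x f.
  by rewrite -(@foxq_nat X I X M ct c (mid X) p) ?midE // => a y; rewrite midE ctE.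
have [phi phiE] : exists phi : arr Q -> 'Hom(X, kerm p), forall a x,
    vsval k (phi a x) = foxq ct x (potential_deriv K C0 a).
  apply: (arr_choice (P := fun a f => forall x, vsval k (f x) = _)) => a.
  have lf : linear (fun x => foxq ct x (potential_deriv K C0 a)) by apply: foxq_linx.
  have [x|f fE] := lfun_lift (t := vsval k) (f := mklin lf).
    apply/(exact_ker_incl p); rewrite mklinE ctn.
    exact: (cocycle_closed hD0 D00 cE).
  by exists f => x; rewrite fE mklinE.
have [x|psi psiE] := ex phi.
  have kinj u v : vsval k u = vsval k v -> u = v.
    by move=> e; apply/eqP; rewrite -subr_eq0; apply/eqP/ik; rewrite linearB /= e subrr.
  apply: kinj; rewrite !mhom_sum.
  transitivity (\sum_a foxq ct (x ** arrow a) (potential_deriv K C0 a)).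
    by apply: eq_bigr => a _; rewrite mhom_ract phiE foxq_idem_r.
  rewrite fox_closed2; apply: eq_bigr => a _.
  by rewrite mhom_ract phiE foxq_idem_l.
pose ps a := (vsval k \o psi a)%VF : 'Hom(X, I).
pose c1 a := (ct a - ps a)%VF.
have c1E x i j (f : qhom K i j) : foxq c1 x f = foxq ct x f - vsval k (foxq psi x f).
  rewrite -(@foxq_nat X _ X I psi ps (mid X) k) ?midE; last first.
    by move=> a y; rewrite midE comp_lfunE.
  rewrite (@foxq_linc _ _ (-1) ps ct c1) ?scaleN1r 1?addrC // => a y.
  by rewrite add_lfunE opp_lfunE scaleN1r addrC.
have hc1 : closed1 c1.
  move=> a x; rewrite c1E psiE mhom_ract phiE foxq_idem_l foxq_idem_r.
  by rewrite subrr.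
have hD1 := fox_cocycleP hc1.
exists (fun x y => fox_cocycle c1 x y + coboundary h' x y); split.
  by apply: cocycleD => //; apply: coboundaryP.
move=> x y; rewrite linearD /=.
have -> : vsval p (fox_cocycle c1 x y) = D0 x y.
  have hi : cocycle (fun x z => vsval p (fox_cocycle c1 x z)).
    case: hD1 => El El' EM; split=> [u d v w|v d u w|u v w].
    - by rewrite El linearP.
    - by rewrite El' linearP.
    - by rewrite EM linearD /= mhom_ract.
  apply: (cocycle_eq hi hD0) => {}x i j f.
  rewrite (cocycle_fox hD0 D00 cE) fox_cocycle_pr // c1E mhomB ctn.
  by rewrite -(mcmpE k p) (exact0 (exact_ker_incl p)) mzeroE subr0.
by rewrite /coboundary linearB /= mhom_ract !h'E subrK.
Qed.

(** * Symmetry of the second derivatives and contraction of the complex *)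

Section Contraction.
Variables X Z : rmod B.
Implicit Types (x : X) (z : Z) (y : Kdual X).

Definition cobounds (phi : arr Q -> X -> Z) : Prop :=
  exists psi : arr Q -> 'Hom(X, Z), forall a x, foxq psi x (potential_deriv K C0 a) = phi a x.

Lemma cobounds_ext phi phi' : (forall a x, phi a x = phi' a x) -> cobounds phi -> cobounds phi'.
Proof. by move=> e [psi psiE]; exists psi => a x; rewrite psiE e. Qed.

Lemma cobounds_lin d phi phi' : cobounds phi -> cobounds phi' ->
  cobounds (fun a x => d *: phi a x + phi' a x).
Proof.
move=> [psi psiE] [psi' psi'E]; exists (fun a => d *: psi a + psi' a) => a x.
rewrite (@foxq_linc _ _ d psi psi') ?psiE ?psi'E // => b u.
by rewrite add_lfunE scale_lfunE.
Qed.

Lemma cobounds0 : cobounds (fun _ _ => 0).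
Proof.
exists (fun _ => 0) => a x.
rewrite (@foxq_linc _ _ (-1) (fun _ => 0) (fun _ => 0)) ?scaleN1r ?addNr // => b u.
by rewrite !zero_lfunE scaleN1r addNr.
Qed.

Lemma cobounds_sum (I : finType) (phi : I -> arr Q -> X -> Z) :
  (forall n, cobounds (phi n)) -> cobounds (fun a x => \sum_n phi n a x).
Proof.
move=> h; elim: (index_enum I) => [|n r IH].
  by apply: cobounds_ext cobounds0 => a x; rewrite big_nil.
apply: cobounds_ext (cobounds_lin 1 (h n) IH) => a x.
by rewrite big_cons scale1r.
Qed.

Fact rank1_lin y z : linear (fun x => dapp y x *: z).
Proof. by move=> d x x'; rewrite dapp_linr scalerDl scalerA. Qed.
(** The pure tensor of [y] and [z] in Hom(X, Z), the tensor product of D X and Z, placed at the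
    arrow [b]. *)
Definition rank1 b y z (a : arr Q) : 'Hom(X, Z) :=
  if a == b then mklin (rank1_lin y z) else 0.

Lemma fox_rank1_notin b y z x s : b \notin s -> fox (rank1 b y z) x s = 0.
Proof.
elim: s x => //= a s IH x; rewrite in_cons negb_or eq_sym => /andP[ne bs].
by rewrite IH // /rank1 (negPf ne) zero_lfunE !ract0 addr0.
Qed.

Lemma fox_rank1 b y z x s t : b \notin s -> b \notin t ->
  fox (rank1 b y z) x (s ++ b :: t) =
  dapp y (x ** (word s * idem (src b))) *: (z ** (idem (tgt b) * word t)).
Proof.
move=> bs bt; rewrite fox_cat fox_rank1_notin // ract0 add0r /= fox_rank1_notin // addr0.
by rewrite /rank1 eqxx mklinE !ractZ !ractM.
Qed.

(* The Fox derivative of [s] at [a], its two tensor factors acting on [z] and [y]. *)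
Fixpoint dfox a z s y x : Z :=
  if s is b :: s' then
    (if b == a then dapp y (x ** (idem (tgt a) * word s')) *: (z ** idem (src a)) else 0)
    + dfox a (z ** arrow b) s' y x
  else 0.

Definition lact (b : B) y : Kdual X :=
  mkdual (f := fun x => dapp y (x ** b))
    (fun d u v => etrans (congr1 (dapp y) (ract_linl b d u v)) (dapp_linr y d _ _)).

Lemma lactE (b : B) y x : dapp (lact b y) x = dapp y (x ** b).
Proof. exact: mkdualE. Qed.

Lemma dfox_notin a z s y x : a \notin s -> dfox a z s y x = 0.
Proof.
elim: s z => //= b s IH z; rewrite in_cons negb_or eq_sym => /andP[ne bs].
by rewrite IH // (negPf ne) addr0.
Qed.

Lemma dfox_cat a z s t y x :
  dfox a z (s ++ t) y x = dfox a (z ** word s) t y x + dfox a z s (lact (word t) y) x.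
Proof.
elim: s z => [|b s IH] z /=; first by rewrite ract1 addr0.
rewrite IH word_cat lactE mulrA !ractM addrCA.
by [].
Qed.

Lemma dfox_split a z s t y x : a \notin s -> a \notin t ->
  dfox a z (s ++ a :: t) y x =
  dapp y (x ** (idem (tgt a) * word t)) *: (z ** (word s * idem (src a))).
Proof.
move=> hs ht; rewrite dfox_cat (dfox_notin _ _ _ hs) addr0 /= eqxx.
by rewrite (dfox_notin _ _ _ ht) addr0 -(ractM z).
Qed.

Lemma dfox_linz a d z z' s y x :
  dfox a (d *: z + z') s y x = d *: dfox a z s y x + dfox a z' s y x.
Proof.
elim: s z z' => [|b s IH] z z' /=; first by rewrite scaler0 addr0.
rewrite !ract_linl IH [in RHS]scalerDr [RHS]addrACA; congr (_ + _).
case: eqP => _; last by rewrite scaler0 addr0.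
by rewrite scalerDr !scalerA mulrC.
Qed.

Lemma dfox_liny a d z s y y' x :
  dfox a z s (d *: y + y') x = d *: dfox a z s y x + dfox a z s y' x.
Proof.
elim: s z => [|b s IH] z /=; first by rewrite scaler0 addr0.
rewrite IH [in RHS]scalerDr [RHS]addrACA; congr (_ + _).
case: eqP => _; last by rewrite scaler0 addr0.
by rewrite dapp_linl scalerDl scalerA.
Qed.

Lemma dfox_idem_z a z i j s y x : qpathb i s j -> dfox a (z ** idem i) s y x = dfox a z s y x.
Proof.
case: s => //= b s /andP[/eqP <- _]; rewrite -!ractM idem_arrow; congr (_ + _).
by case: eqP => // ->; rewrite idemM.
Qed.

Lemma dfox_idem_y a z i j s (b : B) y x : qpathb i s j ->
  dfox a z s (lact (idem j * b) y) x = dfox a z s (lact b y) x.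
Proof.
elim: s i z => [|c s IH] i z //= /andP[_ h]; rewrite (IH _ _ h); congr (_ + _).
case: eqP => // <-; congr (_ *: _); rewrite !lactE -!ractM; congr (dapp y (_ ** _)).
by rewrite (word_path h) mulrA -(mulrA (word s)) idemM.
Qed.

Definition dfoxq a z i j (f : qhom K i j) y x : Z := qext (fun p => dfox a z (sval p) y x) f.

Lemma dfoxqU a z i j (p : qpath i j) y x : dfoxq a z (qlin K p) y x = dfox a z (sval p) y x.
Proof. by rewrite /dfoxq qextU. Qed.

Lemma dfoxq_lin a z i j d (f g : qhom K i j) y x :
  dfoxq a z (d *: f + g) y x = d *: dfoxq a z f y x + dfoxq a z g y x.
Proof. exact: qext_lin. Qed.

Lemma dfoxq0 a z i j y x : dfoxq a z (0 : qhom K i j) y x = 0.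
Proof. exact: qext0. Qed.

Lemma dfoxq_linz a d z z' i j (f : qhom K i j) y x :
  dfoxq a (d *: z + z') f y x = d *: dfoxq a z f y x + dfoxq a z' f y x.
Proof. by rewrite /dfoxq -qext_lin_fun; apply: eq_qext => p; apply: dfox_linz. Qed.

Lemma dfoxq_liny a d z i j (f : qhom K i j) y y' x :
  dfoxq a z f (d *: y + y') x = d *: dfoxq a z f y x + dfoxq a z f y' x.
Proof. by rewrite /dfoxq -qext_lin_fun; apply: eq_qext => p; apply: dfox_liny. Qed.

Lemma dfoxq0z a i j (f : qhom K i j) y x : dfoxq a 0 f y x = 0.
Proof. by have := dfoxq_linz a (-1) 0 0 f y x; rewrite scaler0 addr0 scaleN1r addNr. Qed.

Lemma dfoxq0y a z i j (f : qhom K i j) x : dfoxq a z f 0 x = 0.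
Proof. by have := dfoxq_liny a (-1) z f 0 0 x; rewrite scaler0 addr0 scaleN1r addNr. Qed.

Lemma dfoxq_idem_y a z i j (f : qhom K i j) (b : B) y x :
  dfoxq a z f (lact (idem j * b) y) x = dfoxq a z f (lact b y) x.
Proof. by apply: eq_qext => p; apply: dfox_idem_y (svalP p). Qed.

Lemma dfoxq_idem_z a z i j (f : qhom K i j) y x : dfoxq a (z ** idem i) f y x = dfoxq a z f y x.
Proof. by apply: eq_qext => p; apply: dfox_idem_z (svalP p). Qed.

Lemma lact_lin d (b b' : B) y : lact (d *: b + b') y = d *: lact b y + lact b' y.
Proof. by apply: dualP => x; rewrite dapp_linl !lactE ract_linr dapp_linr. Qed.

Lemma lact0 y : lact 0 y = 0.
Proof. by apply: dualP => x; rewrite lactE ractr0 dapp0r dapp0l. Qed.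

Lemma dfoxq_cmp a z i j k (f : qhom K i j) (g : qhom K j k) y x :
  dfoxq a z (qcmp f g) y x =
  dfoxq a (z ** pr i j f) g y x + dfoxq a z f (lact (pr j k g) y) x.
Proof.
elim/qhom_ind: f => [|d f f' ef ef'|p].
- have -> : qcmp (0 : qhom K i j) g = 0 by apply: qnull_cmpl.
  by rewrite !dfoxq0 linear0 ractr0 dfoxq0z addr0.
- rewrite qcmp_linE_l; apply: etrans (dfoxq_lin _ _ _ _ _ _ _) _.
  apply: etrans (congr2 (fun u v : Z => d *: u + v) ef ef') _.
  rewrite (dfoxq_lin a z d f f') pr_lin ract_linr dfoxq_linz.
  by rewrite scalerDr addrACA.
elim/qhom_ind: g => [|d g g' eg eg'|q].
- have -> : qcmp (qlin K p) (0 : qhom K j k) = 0 by apply: qnull_cmpr.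
  by rewrite !dfoxq0 linear0 lact0 dfoxq0y addr0.
- rewrite qcmp_linE_r; apply: etrans (dfoxq_lin _ _ _ _ _ _ _) _.
  apply: etrans (congr2 (fun u v : Z => d *: u + v) eg eg') _.
  by rewrite (dfoxq_lin a _ d g g') pr_lin lact_lin dfoxq_liny scalerDr addrACA.
rewrite qcmp_qlin !dfoxqU dfox_cat pr_path_r pr_path_l ractM.
by rewrite (dfox_idem_z _ _ _ _ (svalP q)) (dfox_idem_y _ _ _ _ _ (svalP p)).
Qed.

Lemma tail_at_rot n b s t : uniq s -> (n <= size s)%N -> rot n s = b :: t -> tail_at b s = t.
Proof.
rewrite leq_eqVlt => us /orP[/eqP-> | ln].
  by rewrite rot_size => e; rewrite /tail_at e /= eqxx rot0.
rewrite /rot (drop_nth b ln) /= => -[e1 e2].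
by rewrite /tail_at -{1}e1 index_uniq // /rot (drop_nth b ln).
Qed.

Lemma qpathb_split i s b t j : qpathb i (s ++ b :: t) j ->
  qpathb i s (src b) /\ qpathb (tgt b) t j.
Proof.
elim: s i => [|c s IH] i /=; first by case/andP => /eqP->.
by case/andP => /eqP <- /IH; rewrite eqxx.
Qed.

(* The Hessian of a cyclic path is symmetric. *)
Lemma fox_sym a b y z x s : uniq s -> cycle (fun c d => tgt c == src d) s ->
  (if a \in s then fox (rank1 b y z) x (tail_at a s) else 0) =
  (if b \in s then dfox a z (tail_at b s) y x else 0).
Proof.
move=> us cs; have ta c : c \in s -> uniq (c :: tail_at c s) by move=> h; rewrite -rot_index_tail ?rot_uniq.
have tsub c d : c \in s -> d \in tail_at c s -> d \in s.
  by move=> hc hd; rewrite -(mem_rot (index c s)) rot_index_tail // in_cons hd orbT.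
case: ifPn => as_; last first.
  by case: ifPn => bs //; rewrite dfox_notin //; apply: contra as_; apply: tsub.
case: ifPn => bs; last by rewrite fox_rank1_notin //; apply: contra bs; apply: tsub.
have [ab|ab] := eqVneq a b.
  subst b; have /andP[na _] := ta a as_.
  by rewrite fox_rank1_notin // dfox_notin.
have bt : b \in tail_at a s.
  by have := bs; rewrite -(mem_rot (index a s)) rot_index_tail // in_cons eq_sym (negPf ab).
have ut := ta a as_; have et := rot_index_tail as_.
have ht : qpathb (tgt a) (tail_at a s) (src a).
  by apply: path_qpathb; have := cs; rewrite -(rot_cycle (index a s)) et.
case: (splitPr bt) et ut ht => u v et ut ht.
have [hu hv] := qpathb_split ht.
(* [s] rotates to [a u b v], and further to [b v a u]. *)
have -> : tail_at b s = v ++ a :: u.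
  have e2 : rot (size (a :: u)) (rot (index a s) s) = b :: (v ++ a :: u).
    by rewrite et -cat_cons rot_size_cat.
  have ia : (index a s <= size s)%N by apply: index_size.
  have iu : (size (a :: u) <= size s)%N.
    by rewrite -(size_rot (index a s) s) et /= size_cat ltnS leq_addr.
  move: e2; rewrite rot_add_mod //; apply: tail_at_rot => //.
  case: ifP => // _; rewrite leq_subLR; exact: leq_add.
have : uniq (a :: u ++ b :: v) by [].
rewrite /= mem_cat in_cons cat_uniq /= !negb_or => /and5P[/and3P[au _ av] uu /andP[bu _] bv _].
(* Both sides are now [y (x u)] times [z v], up to the side on which the idempotents stand. *)
rewrite fox_rank1 // dfox_split //.
by rewrite (word_path hu) -(word_path hv).
Qed.

(* The Fox derivatives of the relation [d_b W] are the second derivatives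
   [d_a d_b W], which the symmetry moves to those of [d_a W]. *)
Lemma dfox_ideal i j (f : qhom K i j) :
  ideal_gen (@jac_rel Q K C0) (f : Defs.hom (i : pathcat K Q) j) ->
  forall z y, cobounds (fun a x => dfoxq a z f y x).
Proof.
move=> H; suff : pr i j f = 0 /\ forall z y, cobounds (fun a x => dfoxq a z f y x) by case.
elim: i j f / H => [i j f r|i j f ->|i j d f g _ [ef hf] _ [eg hg]|i j k f g _ [ef hf]|
                    i j k f g _ [eg hg]].
- case: i j f / r => b; split=> [|z y]; first exact: pr_potential.
  (* At [a], the coboundary of the pure tensor at [b] is the derivative of [d_a W] at [b]; cycle by
     cycle, [fox_sym] turns it into the derivative of [d_b W] at [a]. *)
  exists (rank1 b y z) => a x.
  rewrite /dfoxq /foxq (qext_potential (fox (rank1 b y z) x)).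
  rewrite (qext_potential (fun s => dfox a z s y x)); apply: eq_bigr => C hC.
  by have [uC cC] := cyc_pathP hC; rewrite fox_sym.
- split=> [|z y]; first exact: linear0.
  by apply: cobounds_ext cobounds0 => a x; rewrite dfoxq0.
- split=> [|z y]; first by rewrite pr_lin ef eg scaler0 addr0.
  by apply: cobounds_ext (cobounds_lin d (hf z y) (hg z y)) => a x; rewrite -dfoxq_lin.
- split=> [|z y]; first by rewrite [LHS](jac_cmp hB) ef mul0r.
  apply: cobounds_ext (hf z (lact (pr j k g) y)) => a x.
  by rewrite [RHS]dfoxq_cmp ef ractr0 dfoxq0z add0r.
split=> [|z y]; first by rewrite [LHS](jac_cmp hB) eg mulr0.
apply: cobounds_ext (hg (z ** pr i j f) y) => a x.
by rewrite [RHS]dfoxq_cmp eg lact0 dfoxq0y addr0.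
Qed.

Lemma dfox_wd i j (f g : qhom K i j) z y : pr i j f = pr i j g ->
  cobounds (fun a x => dfoxq a z f y x - dfoxq a z g y x).
Proof.
move=> e; have h : pr i j (-1 *: g + f) = 0 by rewrite pr_lin e scaleN1r addNr.
apply: cobounds_ext (dfox_ideal ((jac_ker hB _).1 h) z y) => a x.
by rewrite [LHS]dfoxq_lin scaleN1r addrC.
Qed.

Definition rcomp (h : 'Hom(X, Z)) (b : B) : 'Hom(X, Z) := (actl Z b \o h)%VF.
Definition lcomp (h : 'Hom(X, Z)) (b : B) : 'Hom(X, Z) := (h \o actl X b)%VF.
Lemma rcompE h (b : B) x : rcomp h b x = h x ** b.
Proof. by rewrite comp_lfunE actlE. Qed.
Lemma lcompE h (b : B) x : lcomp h b x = h (x ** b).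
Proof. by rewrite comp_lfunE actlE. Qed.

(* [T] contracts the complex up to coboundaries. *)
Lemma contraction_exact2 (T : 'Hom(X, Z) -> arr Q -> X -> Z) :
  (forall d h h' a x, T (d *: h + h') a x = d *: T h a x + T h' a x) ->
  (forall h b, cobounds (fun a x => T (rcomp h (arrow b)) a x - T (lcomp h (arrow b)) a x
      - (if a == b then h (x ** idem (tgt a)) ** idem (src a) else 0))) ->
  exact2 X Z.
Proof.
move=> Tl TC phi hphi.
have T0 a x : T 0 a x = 0 by have := Tl (-1) 0 0 a x; rewrite scaler0 addr0 scaleN1r addNr.
have TD h h' a x : T (h + h') a x = T h a x + T h' a x.
  by have := Tl 1 h h' a x; rewrite !scale1r.
have TN h a x : T (- h) a x = - T h a x.
  by have := Tl (-1) h 0 a x; rewrite T0 !addr0 !scaleN1r.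
have Ts (h : arr Q -> 'Hom(X, Z)) a x : T (\sum_b h b) a x = \sum_b T (h b) a x.
  by elim/big_rec2: _ => [|b u v _ <-]; [exact: T0 | rewrite TD].
(* With [phi b] cut down to its corner, the sum over [b] of the hypothesis on [T] loses its first
   two terms, because [phi] is closed. What remains is minus [phi], whence the sign of the
   witness. *)
pose ph b := lcomp (rcomp (phi b) (idem (src b))) (idem (tgt b)).
have [psi psiE] := cobounds_sum (fun b => TC (ph b) b).
exists (fun a => - psi a) => a x.
have psiN : foxq (fun b => - psi b) x (potential_deriv K C0 a) = - foxq psi x (potential_deriv K C0 a).
  have -> : foxq (fun b => - psi b) x (potential_deriv K C0 a) =
      -1 *: foxq psi x (potential_deriv K C0 a) + foxq (fun=> 0) x (potential_deriv K C0 a).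
    by apply: foxq_linc => b u; rewrite opp_lfunE zero_lfunE scaleN1r addr0.
  have -> : foxq (fun=> 0 : 'Hom(X, Z)) x (potential_deriv K C0 a) = 0.
    have := (@foxq_linc _ _ (-1) (fun=> 0 : 'Hom(X, Z)) (fun=> 0) (fun=> 0) x _ _
      (potential_deriv K C0 a)).
    by rewrite scaleN1r addNr; apply=> b u; rewrite zero_lfunE scaler0 addr0.
  by rewrite scaleN1r addr0.
rewrite psiN psiE sumrB sumrB opprB -!Ts -big_mkcond /= (big_pred1 a) => [|b]; last exact: eq_sym.
have -> : \sum_b rcomp (ph b) (arrow b) = \sum_b lcomp (ph b) (arrow b).
  apply/lfunP => u; rewrite !sum_lfunE.
  transitivity (\sum_b phi b (u ** idem (tgt b)) ** arrow b).
    by apply: eq_bigr => b _; rewrite rcompE lcompE rcompE -ractM idem_arrow.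
  rewrite -hphi; apply: eq_bigr => b _.
  by rewrite !lcompE rcompE -ractM arrow_idem.
by rewrite subrr subr0 lcompE rcompE -!ractM !idemM.
Qed.

End Contraction.

(** * The contraction for maps into [B] *)

Section TargetRegular.
Variable X : rmod B.
Implicit Types (x : X) (y : Kdual X).

(** The Fox derivative of [b], computed on lifts of its corners, with the left factor kept in [B]
    and the right one acting on [y]. Another lift changes it by a coboundary, by [dfox_wd]. *)
Definition theta1 (b : B) y (a : arr Q) x : regmod B :=
  \sum_i \sum_j dfoxq a (1 : regmod B) (lift i j b) y x.

Lemma theta1_linl y a x : linear (fun b : B => theta1 b y a x).
Proof.
move=> d b b'; rewrite /theta1 scaler_sumr -big_split; apply: eq_bigr => i _ /=.
rewrite scaler_sumr -big_split; apply: eq_bigr => j _ /=.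
by rewrite lift_lin dfoxq_lin.
Qed.

Lemma theta1_linr (b : B) a x : linear (fun y => theta1 b y a x).
Proof.
move=> d y y'; rewrite /theta1 scaler_sumr -big_split; apply: eq_bigr => i _ /=.
rewrite scaler_sumr -big_split; apply: eq_bigr => j _ /=.
by rewrite dfoxq_liny.
Qed.

(** The product rule for [b c]: the derivative of [b] with [c] acting on [y], plus the term of the
    arrow [c]. Composed lifts replace the lift of [b c] at the cost of a coboundary. *)
Lemma theta1_arrow (b : B) c y : cobounds (fun a x =>
  theta1 (b * arrow c) y a x - theta1 b (lact (arrow c) y) a x
  - (if a == c then dapp y (x ** idem (tgt a)) *: ((b : regmod B) ** idem (src a)) else 0)).
Proof.
pose S i a x := dfoxq a (1 : regmod B)
  (qcmp (lift i (src c) b) (qlin K (arr_path c))) y x.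
have H : cobounds (fun a x => \sum_i \sum_j (dfoxq a (1 : regmod B) (lift i j (b * arrow c)) y x
    - (if j == tgt c then S i a x else 0))).
  apply: cobounds_sum => i; apply: cobounds_sum => j; case: eqP => [->|/eqP ne].
    apply: dfox_wd; rewrite (jac_cmp hB) !pr_lift -/(arrow c).
    by rewrite -!mulrA arrow_idem idem_arrow.
  apply: cobounds_ext (@dfox_wd _ _ _ _ _ 0 _ _ _) => [a x|]; first by rewrite dfoxq0.
  by rewrite pr_lift linear0 -!mulrA arrow_idem0 ?mulr0 // eq_sym.
apply: cobounds_ext H => a x.
rewrite -addrA -opprD /theta1; under eq_bigr => i _ do rewrite sumrB -big_mkcond big_pred1_eq.
rewrite sumrB; congr (_ - _).
under eq_bigr => i _ do rewrite /S dfoxq_cmp -/(arrow c).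
rewrite big_split addrC; congr (_ + _); last first.
  apply: eq_bigr => i _; rewrite (bigD1 (src c)) //= big1 ?addr0 // => j ne.
  by rewrite -dfoxq_idem_y idem_arrow0 // lact0 dfoxq0y.
under eq_bigr => i _ do rewrite dfoxqU /= addr0 mulr1 pr_lift.
rewrite (eq_sym a); case: eqP => [e|_]; last by rewrite big1.
subst c; rewrite -scaler_sumr; congr (_ *: _); rewrite -ract_sum -ractr_sum.
by rewrite -!mulr_suml idem_sum /= !mul1r -mulrA idemM.
Qed.

Fact coordy_lin (n : 'I_(\dim {:B})) (h : 'Hom(X, regmod B)) : linear (fun x => coord (vbasis {:B}) n (h x) : K^o).
Proof. by move=> d x x'; rewrite !linearP. Qed.
Definition coordy n h : Kdual X := mkdual (coordy_lin n h).
Lemma coordyE n h x : dapp (coordy n h) x = coord (vbasis {:B}) n (h x).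
Proof. exact: mkdualE. Qed.

(* [Hom(X, B) = B (x) D X], and [theta1] is the homotopy on pure tensors. *)
Definition homotopy1 (h : 'Hom(X, regmod B)) (a : arr Q) x : regmod B :=
  \sum_(n < \dim {:B}) theta1 (vbasis {:B})`_n (coordy n h) a x.

Lemma exact2_regmod : exact2 X (regmod B).
Proof.
apply: (contraction_exact2 (T := homotopy1)) => [d h h' a x|h c].
  rewrite /homotopy1 scaler_sumr -big_split; apply: eq_bigr => n _ /=.
  rewrite -theta1_linr; congr theta1; apply: dualP => u.
  by rewrite dapp_linl !coordyE add_lfunE scale_lfunE linearP.
apply: cobounds_ext (cobounds_sum (fun n : 'I_(\dim {:B}) => theta1_arrow (vbasis {:B})`_n c (coordy n h))).
move=> a x; rewrite !sumrB; congr (_ - _ - _).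
(* Expanding the products [b_n c] in the basis moves [c] from the tensor factor [B] to the
   coordinates of [h], where it becomes [rcomp]. *)
- transitivity (\sum_(n < \dim {:B}) \sum_(l < \dim {:B}) coord (vbasis {:B}) l ((vbasis {:B})`_n * arrow c) *:
      theta1 (vbasis {:B})`_l (coordy n h) a x).
    apply: eq_bigr => n _; rewrite {1}[_ * arrow c](coord_vbasis (memvf _)).
    exact: (lin_sum _ _ (theta1_linl (coordy n h) a x)).
  rewrite exchange_big; apply: eq_bigr => l _.
  rewrite -(lin_sum _ _ (theta1_linr (vbasis {:B})`_l a x)); congr theta1.
  apply: dualP => u; rewrite dapp_suml coordyE rcompE.
  transitivity (coord (vbasis {:B}) l ((h u : B) * arrow c)); last by [].
  rewrite [X in coord _ _ (X * _)](coord_vbasis (memvf (h u : B))) mulr_suml linear_sum.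
  by apply: eq_bigr => n _; rewrite coordyE -scalerAl linearZ [LHS]mulrC.
- apply: eq_bigr => n _; congr theta1; apply: dualP => u.
  by rewrite lactE !coordyE lcompE.
case: eqP => [e|_]; last by rewrite big1.
transitivity ((\sum_(n < \dim {:B}) coord (vbasis {:B}) n (h (x ** idem (tgt a)) : B) *: ((vbasis {:B})`_n : regmod B) : regmod B)
    ** idem (src a)).
  by rewrite ract_sum; apply: eq_bigr => n _; rewrite coordyE ractZ.
by congr (_ ** _); rewrite -coord_vbasis ?memvf.
Qed.

End TargetRegular.

(** * The contraction for maps out of [D B] *)

Section SourceDual.
Variable Z : rmod B.
Implicit Types (x : dualB B) (z : Z).

Fact ev1_lin : linear (fun x : dualB B => dapp x 1 : K^o).
Proof. by move=> d x x'; apply: dapp_linl. Qed.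
(** The element 1 of [B = D (D B)]; [lact b ev1] is [b]. *)
Definition ev1 : Kdual (dualB B) := mkdual ev1_lin.
Lemma lact_ev1 (b : B) x : dapp (lact b ev1) x = dapp (x : Kdual B) b.
Proof. by rewrite lactE mkdualE dual_actE mulr1. Qed.

Definition theta2 z (b : B) (a : arr Q) x : Z := \sum_i \sum_j dfoxq a z (lift i j b) ev1 x.

Lemma theta2_linl (b : B) a x : linear (fun z => theta2 z b a x).
Proof.
move=> d z z'; rewrite /theta2 scaler_sumr -big_split; apply: eq_bigr => i _ /=.
rewrite scaler_sumr -big_split; apply: eq_bigr => j _ /=.
by rewrite dfoxq_linz.
Qed.

Lemma theta2_linr z a x : linear (fun b : B => theta2 z b a x).
Proof.
move=> d b b'; rewrite /theta2 scaler_sumr -big_split; apply: eq_bigr => i _ /=.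
rewrite scaler_sumr -big_split; apply: eq_bigr => j _ /=.
by rewrite lift_lin dfoxq_lin.
Qed.

Lemma theta2_arrow z (b : B) c : cobounds (fun a x =>
  theta2 z (arrow c * b) a x - theta2 (z ** arrow c) b a x
  - (if a == c then dapp (x ** idem (tgt a) : Kdual B) b *: (z ** idem (src a)) else 0)).
Proof.
pose S j a x := dfoxq a z (qcmp (qlin K (arr_path c)) (lift (tgt c) j b)) ev1 x.
have H : cobounds (fun a x => \sum_j \sum_i (dfoxq a z (lift i j (arrow c * b)) ev1 x
    - (if i == src c then S j a x else 0))).
  apply: cobounds_sum => j; apply: cobounds_sum => i; case: eqP => [->|/eqP ne].
    apply: dfox_wd; rewrite (jac_cmp hB) !pr_lift -/(arrow c).
    by rewrite !mulrA arrow_idem idem_arrow.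
  apply: cobounds_ext (@dfox_wd _ _ _ _ _ 0 _ _ _) => [a x|]; first by rewrite dfoxq0.
  by rewrite pr_lift linear0 !mulrA idem_arrow0 ?mul0r.
apply: cobounds_ext H => a x.
rewrite -addrA -opprD /theta2; under eq_bigr => i _ do rewrite sumrB -big_mkcond big_pred1_eq.
rewrite sumrB exchange_big; congr (_ - _).
under eq_bigr => i _ do rewrite /S dfoxq_cmp -/(arrow c).
rewrite big_split; congr (_ + _).
  rewrite exchange_big; apply: eq_bigr => j _; rewrite (bigD1 (tgt c)) //= big1 ?addr0 // => i ne.
  rewrite -dfoxq_idem_z -ractM arrow_idem0 ?ractr0 ?dfoxq0z //.
  by rewrite eq_sym.
under eq_bigr => j _ do rewrite dfoxqU /= addr0 mulr1 pr_lift lact_ev1.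
rewrite (eq_sym a); case: eqP => [e|_]; last by rewrite big1.
subst c; rewrite -scaler_suml; congr (_ *: _).
transitivity (\sum_j dapp (x : Kdual B) (idem (tgt a) * b * idem j)).
  by apply: eq_bigr => j _; rewrite dual_actE !mulrA idemM.
rewrite dual_actE -[RHS]/(dapp (x : Kdual B) _) -[in RHS](mulr1 (idem (tgt a) * b)) -idem_sum mulr_sumr.
have := lin_sum (fun=> 1) (fun j => idem (tgt a) * b * idem j) (dapp_lin (x : Kdual B)).
under eq_bigr => j _ do rewrite scale1r.
by move=> ->; apply: eq_bigr => j _; rewrite scale1r.
Qed.

(* [Hom(D B, Z) = Z (x) B]; the vector of [D B] dual to the n-th basis vector of
   [B] is [dcoord n]. *)
Definition homotopy2 (h : 'Hom(dualB B, Z)) (a : arr Q) x : Z :=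
  - \sum_(n < \dim {:B}) theta2 (h (dcoord n : Kdual B)) (vbasis {:B})`_n a x.

Lemma exact2_dualB : exact2 (dualB B) Z.
Proof.
apply: (contraction_exact2 (T := homotopy2)) => [d h h' a x|h c].
  rewrite /homotopy2 scalerN -opprD scaler_sumr -big_split; congr (- _).
  apply: eq_bigr => n _ /=; rewrite -theta2_linl; congr theta2.
  by rewrite add_lfunE scale_lfunE.
apply: cobounds_ext
  (cobounds_sum (fun n : 'I_(\dim {:B}) => theta2_arrow (h (dcoord n : Kdual B)) (vbasis {:B})`_n c)).
(* The factor [B] is now multiplied by precomposition, whereas for maps into [B] it was by
   postcomposition. The first two terms are thus exchanged, which the sign of [homotopy2]
   compensates. *)
move=> a x; rewrite !sumrB; apply: sub_swap.
- transitivity (\sum_(n < \dim {:B}) \sum_(l < \dim {:B}) coord (vbasis {:B}) l (arrow c * (vbasis {:B})`_n) *: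
      theta2 (h (dcoord n : Kdual B)) (vbasis {:B})`_l a x).
    apply: eq_bigr => n _; rewrite {1}[arrow c * _](coord_vbasis (memvf _)).
    exact: (lin_sum _ _ (theta2_linr _ a x)).
  rewrite exchange_big; apply: eq_bigr => l _.
  rewrite -(lin_sum _ _ (theta2_linl (vbasis {:B})`_l a x)); congr theta2.
  rewrite lcompE.
  have -> : (dcoord l : dualB B) ** arrow c =
      \sum_(n < \dim {:B}) coord (vbasis {:B}) l (arrow c * (vbasis {:B})`_n) *: (dcoord n : dualB B).
    apply: etrans (dual_basisE _) _; apply: eq_bigr => n _.
    by congr (_ *: _); rewrite dual_actE dcoordE.
  by rewrite linear_sum; apply: eq_bigr => n _; rewrite linearZ.
- by apply: eq_bigr => n _; rewrite rcompE.
case: eqP => [e|_]; last by rewrite big1.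
have E : x ** idem (tgt a) =
    \sum_(n < \dim {:B}) dapp (x ** idem (tgt a) : Kdual B) (vbasis {:B})`_n *: dcoord n.
  exact: dual_basisE.
rewrite {2}E linear_sum ract_sum; apply: eq_bigr => n _.
by rewrite linearZ ractZ.
Qed.

End SourceDual.

(** * Vanishing of Ext, and translations of syzygies and cosyzygies *)

Section Vanishing.

(** [Ext^1(P, -) = 0]. On [B], the cocycle identity at [x = 1] exhibits [D] as the coboundary of
    [y |-> D 1 y]. *)
Lemma cocycle_proj P : projective_mod P -> forall (Z : rmod B) (D : P -> B -> Z), cocycle D ->
  exists h : 'Hom(P, Z), forall x y, D x y = coboundary h x y.
Proof.
have l0 (X Z : rmod B) (D : X -> B -> Z) y : cocycle D -> D 0 y = 0.
  by case=> _ Dl _; have := Dl y (-1) 0 0; rewrite scaler0 addr0 scaleN1r addNr.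
apply: (proj_ind (Pr := fun P => forall (Z : rmod B) (D : P -> B -> Z), cocycle D ->
  exists h : 'Hom(P, Z), forall x y, D x y = coboundary h x y)).
- move=> Z D hD; exists 0 => x y; rewrite (mod0_eq x 0) l0 //.
  by rewrite /coboundary !zero_lfunE ract0 subrr.
- move=> Z D [Dl Dl' DM]; exists (mklin (Dl (1 : regmod B))) => x y.
  rewrite /coboundary !mklinE; have := DM (1 : regmod B) x y.
  by rewrite /= mul1r => ->; rewrite addrAC subrr add0r.
- move=> X Y hX hY Z D hD; have [_ Dl' DM] := hD.
  have hDX : cocycle (fun x y => D (vsval (minl X Y) x) y).
    case: hD => Dl _ _; split=> [x|y d u v|x y z]; first exact: Dl.
      by rewrite linearP Dl'.
    by rewrite DM mhom_ract.
  have hDY : cocycle (fun x y => D (vsval (minr X Y) x) y).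
    case: hD => Dl _ _; split=> [x|y d u v|x y z]; first exact: Dl.
      by rewrite linearP Dl'.
    by rewrite DM mhom_ract.
  have [h hE] := hX _ _ hDX; have [h' h'E] := hY _ _ hDY.
  exists ((h \o vsval (mfst X Y)) + (h' \o vsval (msnd X Y)))%VF => x y.
  have {1}-> : x = vsval (minl X Y) (vsval (mfst X Y) x) + vsval (minr X Y) (vsval (msnd X Y) x).
    by rewrite -!mcmpE -maddE dsum2_id midE.
  have DD u v : D (u + v) y = D u y + D v y by have := Dl' y 1 u v; rewrite !scale1r.
  rewrite DD hE h'E /coboundary !add_lfunE !comp_lfunE !mhom_ract ractD.
  by rewrite opprD addrACA.
move=> X Y [i [p e]] hY Z D hD.
have hDY : cocycle (fun x y => D (vsval p x) y).
  case: hD => Dl Dl' DM; split=> [x|y d u v|x y z]; first exact: Dl.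
    by rewrite linearP Dl'.
  by rewrite DM mhom_ract.
have [h hE] := hY _ _ hDY; exists (h \o vsval i)%VF => x y.
have {1}-> : x = vsval p (vsval i x) by rewrite -mcmpE e midE.
by rewrite hE /coboundary !comp_lfunE mhom_ract.
Qed.

(** [Ext^1(-, I) = 0]. Into [D B], [D] is the coboundary of the map sending [x] to the functional
    [y |-> - (D x y)(1)]. *)
Lemma cocycle_inj I : injective_mod I -> forall (X : rmod B) (D : X -> B -> I), cocycle D ->
  exists h : 'Hom(X, I), forall x y, D x y = coboundary h x y.
Proof.
have post (X Z Z' : rmod B) (f : mhom Z Z') (D : X -> B -> Z) : cocycle D ->
    cocycle (fun x y => vsval f (D x y)).
  case=> Dl Dl' DM; split=> [x d u v|y d u v|x y z].
  - by rewrite Dl linearP.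
  - by rewrite Dl' linearP.
  by rewrite DM linearD /= mhom_ract.
apply: (inj_ind (Pr := fun I => forall (X : rmod B) (D : X -> B -> I), cocycle D ->
  exists h : 'Hom(X, I), forall x y, D x y = coboundary h x y)).
- by move=> X D _; exists 0 => x y; apply: mod0_eq.
- move=> X D [Dl Dl' DM].
  have l0 x : linear (fun y : B => - dapp (D x y : Kdual B) 1 : K^o).
    by move=> d u v; rewrite Dl dapp_linl scalerN opprD.
  have l1 : linear (fun x => mkdual (l0 x) : dualB B).
    move=> d u v; apply: dualP => b; rewrite [RHS]dapp_linl !mkdualE Dl' dapp_linl.
    by rewrite opprD mulrN.
  exists (mklin l1) => x y; apply: dualP => b; rewrite /coboundary !mklinE.
  apply: esym; apply: etrans (dappB (mkdual (l0 (x ** y))) (dual_act (mkdual (l0 x)) y) b) _.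
  rewrite dual_actE !mkdualE DM opprK.
  have E := dappD (dual_act (D x y) b) (D (x ** y) b) 1; rewrite dual_actE mulr1 in E.
  by rewrite [X in _ + X]E addrC addrK.
- move=> Y Z hY hZ X D hD.
  have [h hE] := hY _ _ (post _ _ _ (mfst Y Z) _ hD).
  have [h' h'E] := hZ _ _ (post _ _ _ (msnd Y Z) _ hD).
  exists ((vsval (minl Y Z) \o h) + (vsval (minr Y Z) \o h'))%VF => x y.
  have -> : D x y = vsval (minl Y Z) (vsval (mfst Y Z) (D x y))
      + vsval (minr Y Z) (vsval (msnd Y Z) (D x y)).
    by rewrite -!mcmpE -maddE dsum2_id midE.
  rewrite hE h'E /coboundary !add_lfunE !comp_lfunE !mhomB !mhom_ract ractD.
  by rewrite opprD addrACA.
move=> Y Z [i [p e]] hZ X D hD.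
have [h hE] := hZ _ _ (post _ _ _ i _ hD); exists (vsval p \o h)%VF => x y.
have -> : D x y = vsval p (vsval i (D x y)) by rewrite -mcmpE e midE.
by rewrite hE /coboundary !comp_lfunE mhomB mhom_ract.
Qed.

(* [Ext^1(M, B) = 0] for a syzygy [M]. *)
Lemma syzygy_extend (M Y L : rmod B) (k : mhom L Y) (p : mhom Y M) (h : mhom L (regmod B)) :
  syzygy M -> mono_mod k -> epi_mod p -> exact k p -> exists g, mcmp k g = h.
Proof.
move=> [P [i [hP mi]]] mk sp ex.
(* A linear extension [h0] of [h] fails to be a module map by its coboundary, which vanishes on [L]
   and so defines a cocycle on [M]. *)
have [h0 h0E] := lfun_ext (vsval h) ((mono_modP k).2 mk).
have cob0 l y : coboundary h0 (vsval k l) y = 0.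
  by rewrite /coboundary -mhom_ract !h0E mhom_ract subrr.
have [hl hl' hM] := coboundaryP h0.
have wd u v y : vsval p u = vsval p v -> coboundary h0 u y = coboundary h0 v y.
  move=> e; have [|l lE] := (ex (u - v)).1; first by rewrite mhomB e subrr.
  have := hl' y (-1) v u; rewrite !scaleN1r [- v + u]addrC -lE cob0.
  by move/esym/eqP; rewrite addrC subr_eq0 => /eqP.
have [s sE] := lfun_lift (t := vsval p) (f := \1%VF) (fun m => epi_mod_ex sp _).
pose D m y := coboundary h0 (s m) y.
have hD : cocycle D.
  split=> [m|y d m m'|m y z]; first exact: hl.
    by rewrite /D linearP hl'.
  rewrite /D hM; congr (_ + _); apply: wd.
  by rewrite mhom_ract !sE !id_lfunE.
(* Extended to [P], the cocycle is the coboundary of some [h']. Subtracting the pullback of [h'] to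
   [Y], which vanishes on [L], turns [h0] into a module map. *)
have [D' [hD' D'E]] := cocycle_extend mi (@exact2_regmod _) hD.
have [h' h'E] := cocycle_proj hP hD'.
pose g := (h0 - (h' \o vsval i \o vsval p))%VF.
have gE y : g y = h0 y - h' (vsval i (vsval p y)).
  by rewrite add_lfunE opp_lfunE !comp_lfunE.
have ge y (b : B) : g (y ** b) = g y ** b.
  apply/eqP; rewrite -subr_eq0 !gE ractB subrACA !mhom_ract.
  rewrite -/(coboundary h0 y b) -/(coboundary h' (vsval i (vsval p y)) b).
  by rewrite -h'E D'E /D (wd (s (vsval p y)) y) ?subrr // sE id_lfunE.
exists (mkhom ge); apply: mhomP => l; rewrite mcmpE homE gE h0E.
have -> : h' (vsval i (vsval p (vsval k l))) = 0 by rewrite -(mcmpE k p) (exact0 ex) mzeroE !linear0.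
exact: subr0.
Qed.

(* [Ext^1(D B, M) = 0] for a cosyzygy [M]. *)
Lemma cosyzygy_lift (M Y N : rmod B) (k : mhom M Y) (p : mhom Y N) (g : mhom (dualB B) N) :
  cosyzygy M -> mono_mod k -> exact k p -> (forall x, exists y, vsval p y = vsval g x) ->
  exists f, mcmp f p = g.
Proof.
move=> [I [q [hI sq]]] mk ex gp.
have [g0 g0E] := lfun_lift (t := vsval p) (f := vsval g) gp.
have cobk x y : vsval p (coboundary g0 x y) = 0.
  by rewrite /coboundary mhomB mhom_ract !g0E mhom_ract subrr.
(* The defect of the linear lift [g0] takes values in the kernel of [p], that is, in [M]. *)
pose D x y : M := ((vsval k)^-1)%VF (coboundary g0 x y).
have kD x y : vsval k (D x y) = coboundary g0 x y.
  rewrite /D limg_lfunVK //; have [m <-] := (ex _).1 (cobk x y).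
  by rewrite memv_img ?memvf.
have kinj u v : vsval k u = vsval k v -> u = v.
  by move=> e; apply/eqP; rewrite -subr_eq0; apply/eqP/((mono_modP k).2 mk); rewrite mhomB e subrr.
have [gl gl' gM] := coboundaryP g0.
have hD : cocycle D.
  split=> [x d u v|y d u v|x y z].
  - by rewrite /D gl linearP.
  - by rewrite /D gl' linearP.
  by apply: kinj; rewrite linearD /= mhom_ract !kD gM.
have [D' [hD' D'E]] := cocycle_lift sq (@exact2_dualB _) hD.
have [h' h'E] := cocycle_inj hI hD'.
pose f := (g0 - (vsval k \o vsval q \o h'))%VF.
have fE x : f x = g0 x - vsval k (vsval q (h' x)).
  by rewrite add_lfunE opp_lfunE !comp_lfunE.
have fe x (b : B) : f (x ** b) = f x ** b.
  apply/eqP; rewrite -subr_eq0 !fE ractB subrACA -!mhom_ract -!mhomB.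
  by rewrite -/(coboundary g0 x b) -/(coboundary h' x b) -h'E D'E kD subrr.
exists (mkhom fe); apply: mhomP => x; rewrite mcmpE homE fE mhomB g0E.
by rewrite -(mcmpE k p) (exact0 ex) mzeroE; apply: subr0.
Qed.

Lemma tau_cosyzygy (M N : rmod B) (p : tau_data M N) : syzygy M -> cosyzygy N.
Proof.
move=> hM; pose d := td_d p.
have [P2 [c [hP2 sc]]] := enough_proj (kerm d).
pose e := mcmp c (ker_incl d).
have ed : exact e d.
  move=> x; split=> [/(exact_ker_incl d)[y <-]|[y <-]].
    by have [z <-] := epi_mod_ex sc y; exists z; rewrite mcmpE.
  by rewrite -mcmpE -mcmpA (exact0 (exact_ker_incl d)) mcmp0r mzeroE.
exists (nu P2).
have H (phi : nu (td1 p)) : vsval (nu_map d) phi = 0 -> exists psi, vsval (nu_map e) psi = phi.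
  move=> phi0.
  have lt : linear (fun h : mhom (td1 p) (regmod B) => mcmp e h) by apply: mcmp_linr.
  (* [phi] comes from [nu P2] as soon as it vanishes on the [h] with [mcmp e h = 0]. Such an [h]
     factors through the image of [d] and extends to [td0 p] by [syzygy_extend]; [phi] kills it
     because [nu_map d] kills [phi]. *)
  have [h h0|psi psiE] := lfun_factor (t := mklin lt) (f := phi : 'Hom(_, K^o)).
    rewrite mklinE in h0.
    have [W [u [v [su mv uv]]]] := image_fact d.
    have [x x0|h1 h1E] := epi_factor (f := h) su.
      have dx : vsval d x = 0 by rewrite -uv mcmpE x0 linear0.
      have [y <-] := (ed x).1 dx.
      by rewrite -mcmpE h0 mzeroE.
    have ev : exact v (td_aug p).
      move=> x; split=> [/(td_exact p)[y <-]|[w <-]].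
        by exists (vsval u y); rewrite -mcmpE uv.
      have [y <-] := epi_mod_ex su w; rewrite -(mcmpE u v) uv.
      by apply/(td_exact p); exists y.
    have [h2 h2E] := syzygy_extend h1 hM mv (td_epi p) ev.
    rewrite -h1E -h2E mcmpA uv -[LHS]/(dapp phi _) -nu_mapE phi0.
    exact: dapp0l.
  exists psi; apply: dualP => h; rewrite nu_mapE.
  by have := psiE h; rewrite mklinE.
have [x|r rE] := mono_lift (f := nu_map e) (td_mono p).
  by apply/(td_exact_nu p); rewrite -mcmpE -nu_map_cmp (exact0 ed) nu_map0 mzeroE.
exists r; split; first exact: nu_inj.
apply: epi_modP => n; have [psi psiE] := H (vsval (td_k p) n) (proj2 (td_exact_nu p _) (ex_intro _ n erefl)).
exists psi; apply/eqP; rewrite -subr_eq0; apply/eqP/((mono_modP _).2 (td_mono p)).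
by rewrite mhomB -mcmpE rE psiE subrr.
Qed.

Lemma tauV_syzygy (N M : rmod B) (p : tauV_data N M) : cosyzygy N -> syzygy M.
Proof.
move=> hN; pose d := vd_d p.
have [I2 [c [hI2 mc]]] := enough_inj (cokm d).
pose e := mcmp (cok_proj d) c.
have ed : exact d e.
  move=> x; rewrite mcmpE; split=> [/((mono_modP c).2 mc)/(exact_cok_proj d) //|].
  by move/(exact_cok_proj d) => ->; rewrite linear0.
exists (nuV I2).
have [x x0|r rE] := epi_factor (f := nuV_map e) (vd_epi p).
  have [y <-] := (vd_exact_nuV p x).1 x0.
  by rewrite -mcmpE -nuV_map_cmp (exact0 ed) nuV_map0 mzeroE.
exists r; split; first exact: nuV_proj.
apply/mono_modP => m; have [g <-] := epi_mod_ex (vd_epi p) m.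
rewrite -mcmpE rE nuV_mapE => g0; apply/(vd_exact_nuV p).
(* [e] kills [g], so [g] takes values in the image of [d] and lifts to [vd0 p]; hence it dies in the
   cokernel [M]. *)
have [x|f fE] := cosyzygy_lift (g := g) hN (vd_mono p) (vd_exact p).
  have := congr1 (fun h : mhom (dualB B) I2 => vsval h x) g0.
  by rewrite mcmpE mzeroE => /ed.
by exists f; rewrite nuV_mapE.
Qed.

End Vanishing.

End Jacobian.

(** * Sums of presentations and minimality *)

Section Assembly.
Local Open Scope ring_scope.
Variables (K : fieldType) (B : falgType K).
Implicit Types M N P X Y Z : rmod B.

Definition mmap2 M M' N N' (f : mhom M N) (g : mhom M' N') : mhom (dsum2 M M') (dsum2 N N') :=
  mpair (mcmp (mfst M M') f) (mcmp (msnd M M') g).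

Lemma mmap2E M M' N N' (f : mhom M N) (g : mhom M' N') x :
  vsval (mmap2 f g) x = (vsval f x.1, vsval g x.2).
Proof. by rewrite mpairE !mcmpE mfstE msndE. Qed.

Section Sum.
Variables (M N M' N' : rmod B) (p : tau_data M N) (q : tau_data M' N').

Let d := mmap2 (td_d p) (td_d q).
Let aug := mmap2 (td_aug p) (td_aug q).
(** [nu] of a sum is not literally the sum of the images, so the two kernel maps are glued through
    [nu_map] of the injections. *)
Let k := mcopair (mcmp (td_k p) (nu_map (minl (td1 p) (td1 q))))
                 (mcmp (td_k q) (nu_map (minr (td1 p) (td1 q)))).

Fact sum_epi : epi_mod aug.
Proof.
apply: epi_modP => -[m m']; have [x xE] := epi_mod_ex (td_epi p) m.
have [y yE] := epi_mod_ex (td_epi q) m'.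
by exists (x, y); rewrite mmap2E /= xE yE.
Qed.

Fact sum_exact : exact d aug.
Proof.
move=> [x y]; rewrite mmap2E /=; split.
  case=> /(td_exact p)[u <-] /(td_exact q)[v <-].
  by exists (u, v); rewrite mmap2E.
by case=> -[u v]; rewrite mmap2E => -[<- <-]; congr pair; [apply/(td_exact p) | apply/(td_exact q)]; eexists.
Qed.

Fact sum_k_fst : mcmp k (nu_map (mfst _ _)) = mcmp (mfst _ _) (td_k p).
Proof.
apply: dsum2_ext; rewrite !mcmpA ?minl_copair ?minr_copair -mcmpA -nu_map_cmp.
  by rewrite !minl_fst nu_map_id mcmpm1 mcmp1m.
by rewrite !minr_fst nu_map0 mcmp0r mcmp0l.
Qed.

Fact sum_k_snd : mcmp k (nu_map (msnd _ _)) = mcmp (msnd _ _) (td_k q).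
Proof.
apply: dsum2_ext; rewrite !mcmpA ?minl_copair ?minr_copair -mcmpA -nu_map_cmp.
  by rewrite !minl_snd nu_map0 mcmp0r mcmp0l.
by rewrite !minr_snd nu_map_id mcmpm1 mcmp1m.
Qed.

Fact sum_mono : mono_mod k.
Proof.
apply/mono_modP => x x0; have := dsum2_id N N'.
move/(congr1 (fun h : mhom (dsum2 N N') (dsum2 N N') => vsval h x)).
rewrite midE maddE !mcmpE => <-.
have -> : vsval (mfst N N') x = 0.
  apply: (mono_modP (td_k p)).2; first exact: td_mono.
  by rewrite -mcmpE -sum_k_fst mcmpE x0 linear0.
have -> : vsval (msnd N N') x = 0.
  apply: (mono_modP (td_k q)).2; first exact: td_mono.
  by rewrite -mcmpE -sum_k_snd mcmpE x0 linear0.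
by rewrite !linear0 addr0.
Qed.

Fact sum_exact_nu : exact k (nu_map d).
Proof.
have d1 : mcmp d (mfst _ _) = mcmp (mfst _ _) (td_d p).
  by apply: mhomP => x; rewrite !mcmpE !mfstE mmap2E.
have d2 : mcmp d (msnd _ _) = mcmp (msnd _ _) (td_d q).
  by apply: mhomP => x; rewrite !mcmpE !msndE mmap2E.
have dl : mcmp (minl _ _) d = mcmp (td_d p) (minl _ _).
  by apply: mhomP => x; rewrite !mcmpE !minlE mmap2E /= linear0.
have dr : mcmp (minr _ _) d = mcmp (td_d q) (minr _ _).
  by apply: mhomP => x; rewrite !mcmpE !minrE mmap2E /= linear0.
have kE n n' : vsval k (n, n') = vsval (nu_map (minl _ _)) (vsval (td_k p) n)
    + vsval (nu_map (minr _ _)) (vsval (td_k q) n') by rewrite mcopairE !mcmpE.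
move=> x; split=> [x0|[[n n'] <-]].
  have [|n nE] := (td_exact_nu p (vsval (nu_map (mfst _ _)) x)).1.
    by rewrite -mcmpE -nu_map_cmp -d1 nu_map_cmp mcmpE x0 linear0.
  have [|n' n'E] := (td_exact_nu q (vsval (nu_map (msnd _ _)) x)).1.
    by rewrite -mcmpE -nu_map_cmp -d2 nu_map_cmp mcmpE x0 linear0.
  exists (n, n'); rewrite kE nE n'E -!mcmpE -!nu_map_cmp.
  by rewrite -maddE -nu_mapD dsum2_id nu_map_id midE.
rewrite kE mhomD -(mcmpE (nu_map (minl _ _)) (nu_map d)) -(mcmpE (nu_map (minr _ _)) (nu_map d)).
rewrite -!nu_map_cmp dl dr !nu_map_cmp !mcmpE.
have -> : vsval (nu_map (td_d p)) (vsval (td_k p) n) = 0 by apply/(td_exact_nu p); exists n.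
have -> : vsval (nu_map (td_d q)) (vsval (td_k q) n') = 0 by apply/(td_exact_nu q); exists n'.
by rewrite !linear0 addr0.
Qed.

Definition tau_data_dsum2 : tau_data (dsum2 M M') (dsum2 N N') :=
  TauData (projective_dsum2 (td_proj1 p) (td_proj1 q))
    (projective_dsum2 (td_proj0 p) (td_proj0 q)) sum_epi sum_exact sum_mono sum_exact_nu.
End Sum.

Definition tau_data_mod0 : tau_data (mod0 B) (mod0 B).
Proof.
have n0 (x : nu (mod0 B)) : x = 0.
  apply: dualP => h; rewrite dapp0l.
  have -> : h = 0 by apply: mhomP => y; rewrite (mod0_eq y 0) !linear0.
  exact: dapp0r.
apply: (@TauData K B (mod0 B) (mod0 B) (mod0 B) (mod0 B) 0 0 0).
- exact: projective_mod0.
- exact: projective_mod0.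
- by apply: epi_modP => x; exists 0; apply: mod0_eq.
- by move=> x; split=> _; [exists 0 |]; apply: mod0_eq.
- by apply/mono_modP => x _; apply: mod0_eq.
- by move=> x; split=> _; [exists 0; rewrite [RHS]n0 mzeroE | rewrite [LHS]n0].
Qed.

Definition tau_data_dsum (T : Type) (M N : T -> rmod B) (p : forall t, tau_data (M t) (N t))
    (s : seq T) : tau_data (dsum [seq M t | t <- s]) (dsum [seq N t | t <- s]).
Proof.
by elim: s => [|t s IH]; [exact: tau_data_mod0 | exact: tau_data_dsum2].
Qed.

Lemma min_pres_mono M N N' (p : tau_data M N) (q : tau_data M N') h h' :
  ker_superfluous (td_aug p) -> ker_superfluous (td_d p) ->
  tau_rel p q (mid M) h -> tau_rel q p (mid M) h' -> mono_mod h.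
Proof.
move=> m0 m1 [g0 [g1 [e1 e2 e3]]] [f0 [f1 [d1 d2 d3]]].
pose k0 := mcmp g0 f0; pose k1 := mcmp g1 f1.
have k0a : mcmp k0 (td_aug p) = td_aug p by rewrite -mcmpA -d1 mcmpm1 -e1 mcmpm1.
have k01 : mcmp (td_d p) k0 = mcmp k1 (td_d p) by rewrite mcmpA e2 -mcmpA d2 mcmpA.
have s0 : epi_mod k0.
  apply: (m0 _ (@limg_stable _ _ _ _ k0)); apply/vspaceP => x; rewrite memvf.
  rewrite -[x](subrK (vsval k0 x)) addrC; apply: memv_add; first by rewrite memv_img ?memvf.
  by rewrite memv_ker mhomB -mcmpE k0a subrr.
have s1 : epi_mod k1.
  apply: (m1 _ (@limg_stable _ _ _ _ k1)); apply/vspaceP => x; rewrite memvf.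
  have [w wE] := epi_mod_ex s0 (vsval (td_d p) x).
  have [|y yE] := (td_exact p w).1.
    by rewrite -k0a mcmpE wE -mcmpE (exact0 (td_exact p)) mzeroE.
  rewrite -[x](subrK (vsval k1 y)) addrC; apply: memv_add; first by rewrite memv_img ?memvf.
  by rewrite memv_ker mhomB -(mcmpE k1) -k01 mcmpE yE wE subrr.
have [r [kr _]] := bij_inv (epi_endo_mono s1) s1.
apply/mono_modP => n n0; apply: (mono_modP (td_k p)).2; first exact: td_mono.
have e : vsval (nu_map g1) (vsval (td_k p) n) = 0 by rewrite -mcmpE -e3 mcmpE n0 linear0.
rewrite -[LHS](midE (vsval (td_k p) n)) -nu_map_id -kr.
by rewrite /k1 -mcmpA nu_map_cmp mcmpE e linear0.
Qed.

(** An isomorphism in [mod B] itself: minimality makes the comparison maps injective in both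
    directions, and dimensions decide. *)
Lemma min_pres_isom M (m m' : proj_presentation M) :
  isom (kerm (nu_map (pp_d m))) (kerm (nu_map (pp_d m'))).
Proof.
have [h r] := tau_rel_ex (pres_data m) (pres_data m') (mid M).
have [h' r'] := tau_rel_ex (pres_data m') (pres_data m) (mid M).
have mh : mono_mod h by apply: min_pres_mono r r'; [exact: mpp_min0 (pp_min m) | exact: mpp_min1 (pp_min m)].
have mh' : mono_mod h' by apply: min_pres_mono r' r; [exact: mpp_min0 (pp_min m') | exact: mpp_min1 (pp_min m')].
exact: bij_isom mh (mono_dim_epi mh (mono_dim mh')).
Qed.

End Assembly.

Section Functors.
Variables (K : fieldType) (C D : kcat K) (P : D -> Prop) (F0 : C -> fullcat P).

(** Morphisms of [fullcat] are convertible to those of the ambient category, so the same fields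
    serve for both functors. *)
Definition forget_full (F : functor F0) : functor (fun x => sval (F0 x) : D) :=
  @Functor K C D (fun x => sval (F0 x)) (fun x y f => fmap F f)
    (@fmap_lin _ _ _ _ F) (@fmap_null _ _ _ _ F) (@fmap_id _ _ _ _ F) (@fmap_cmp _ _ _ _ F).

Definition into_full (F : functor (fun x => sval (F0 x) : D)) : functor F0 :=
  @Functor K C (fullcat P) F0 (fun x y f => fmap F f)
    (@fmap_lin _ _ _ _ F) (@fmap_null _ _ _ _ F) (@fmap_id _ _ _ _ F) (@fmap_cmp _ _ _ _ F).
End Functors.

Theorem mainTheorem3
  (K : closedFieldType) (Q : quiver) (hQ : dimer_tree_quiver Q)
  (C0 : {set arr Q}) (hC0 : root_cycle C0)
  (B : falgType K) (pi : forall i j : vert Q, {linear qhom K i j -> B})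
  (hB : jacobian_algebra C0 pi)
  (N : nat) (hN : total_weight Q N.*2)
  (rho : vert Q -> diag2 N) (dir : {set arr Q} -> vert Q -> bool)
  (seg : arr Q -> pvertex N) (hS : checkerboard rho dir seg)
  (f : forall g : diag2 N, mhom (P1 pi rho g) (P0 pi rho g))
  (f_syz : forall g, syzygy (cokm (f g)))
  (f_ind : forall g, indecomposable (cokm (f g)))
  (f_nonproj : forall g, ~ projective_mod (cokm (f g)))
  (f_min : forall g, min_proj_pres (f g) (cok_proj (f g)))
  (F : functor (syzygy_ext f_syz)) (hF : equivalence F) :
  exists (kf_cosyz : forall g, cosyzygy (kerm (nu_map (f g))))
         (G : functor (cosyzygy_ext kf_cosyz)),
    [/\ equivalence G,
        inhabited (AR_translation B), inhabited (AR_translation_inv B)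
      & forall (T : AR_translation B) (T' : AR_translation_inv B),
          exists (hT : forall M : rmod B, syzygy M -> cosyzygy (ar_ob T M))
                 (hT' : forall M : rmod B, cosyzygy M -> syzygy (arV_ob T' M)),
            [/\ mutually_inverse (restrict (ar_fun T) hT) (restrict (arV_fun T') hT'),
                forall g, isom (ar_ob T (cokm (f g))) (kerm (nu_map (f g)))
              & nat_iso (cmpfunctor F (restrict (ar_fun T) hT)) G]].
Proof.
pose m g := ProjPresentation (f_min g).
pose p g : tau_data (cokm (f g)) (kerm (nu_map (f g))) := pres_data (m g).
have kf_cosyz g : cosyzygy (kerm (nu_map (f g))) := tau_cosyzygy hB (p g) (f_syz g).
pose d (X : Diag N K) : tau_data (sval (syzygy_ext f_syz X)) (sval (cosyzygy_ext kf_cosyz X)) :=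
  tau_data_dsum (fun k => p (X k)) (enum 'I_(fsize X)).
pose G : functor (cosyzygy_ext kf_cosyz) :=
  @into_full K (Diag N K) (costmod B) (@cosyzygy K B) (cosyzygy_ext kf_cosyz)
    (tau_functor (@forget_full K (Diag N K) (stmod B) (@syzygy K B) (syzygy_ext f_syz) F) d).
have hT (T : AR_translation B) (M : rmod B) : syzygy M -> cosyzygy (ar_ob T M).
  by move=> hM; apply: (tau_cosyzygy hB (ar_data T M) hM).
have hT' (T' : AR_translation_inv B) (M : rmod B) : cosyzygy M -> syzygy (arV_ob T' M).
  by move=> hM; apply: (tauV_syzygy hB (arV_data T' M) hM).
(* Both sides lift the same morphisms [F g], to the presentations chosen by [T] and to [d]; the
   comparison maps over the identity are natural by uniqueness modulo injectives. *)
have iso (T : AR_translation B) : nat_iso (cmpfunctor F (restrict (ar_fun T) (hT T))) G.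
  pose r X := ar_data T (sval (syzygy_ext f_syz X)).
  exists (fun X => tau_mor (r X) (d X) (mid _)), (fun X => tau_mor (d X) (r X) (mid _)).
  split=> [X | X Y g]; first by split; apply: tau_mor_inv.
  have h1 := tau_morP (r X) (r Y) (fmap F g).
  have h2 := tau_morP (d X) (d Y) (fmap F g).
  apply: (heq_trans (g := mcmp (tau_mor (r X) (r Y) (fmap F g)) (tau_mor (r Y) (d Y) (mid _))
      : Defs.hom (_ : costmod B) (_ : costmod B))).
    apply: (heq_cmpr (C := costmod B)); exact: ar_data_rel h1.
  apply: (tau_rel_unique (tau_rel_cmp h1 (tau_morP _ _ _)) (tau_rel_cmp (tau_morP _ _ _) h2)).
  by rewrite mcmp1m mcmpm1; apply: heq_refl.
have mi (T : AR_translation B) (T' : AR_translation_inv B) :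
    mutually_inverse (restrict (ar_fun T) (hT T)) (restrict (arV_fun T') (hT' T')).
  exact/mutually_inverse_restrict/AR_mutually_inverse.
exists kf_cosyz, G; split.
(* [G] is built without a chosen translation; any [T] and [T'] carry the equivalence over from [F]
   followed by [T]. *)
- have [T] := AR_translation_ex B; have [T'] := AR_translation_inv_ex B.
  have [H0 [H FH]] := hF.
  eexists; exists (cmpfunctor (restrict (arV_fun T') (hT' T')) H).
  exact: mutually_inverse_iso (iso T) (mutually_inverse_cmp FH (mi T T')).
- exact: AR_translation_ex.
- exact: AR_translation_inv_ex.
move=> T T'; exists (hT T), (hT' T'); split=> // g.
exact: (min_pres_isom (ar_pres T (cokm (f g))) (m g)).
Qed.
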